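(* Let $n$ be a positive integer and let $f:\mathbb{D}\to f(\mathbb{D})$ be analytic and exactly $n$-to-one as a map of the open unit disk $\mathbb{D}$ onto its image $f(\mathbb{D})$. Then there are a finite Blaschke product $\phi$ and a one-to-one analytic function $\widetilde{f}$ on $\mathbb{D}$ such that $f=\widetilde{f}\circ\phi$.
   Context: $\mathbb{D}$ is the open unit disk in $\mathbb{C}$. ''Exactly $n$-to-one'' means that for every $w\in f(\mathbb{D})$ the equation $f(z)=w$ has exactly $n$ solutions $z\in\mathbb{D}$, counted with multiplicity. A finite Blaschke product is a function of the form $\phi(z)=\lambda\prod_{k=1}^m\frac{z-\alpha_k}{1-\overline{\alpha_k}z}$ with $m$ a positive integer, $\alpha_1,\dots,\alpha_m\in\mathbb{D}$ and $|\lambda|=1$. *)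

(* Defs.v *)
From Stdlib Require Import Reals List.
From Coquelicot Require Import Coquelicot.

Open Scope C_scope.

(* A function on the disk is a total function C -> C of which only the values
   on [unit_disk] are ever constrained. *)
Definition unit_disk (z : C) : Prop := (Cmod z < 1)%R.

Definition has_expansion (f : C -> C) (z0 : C) (a : nat -> C) : Prop :=
  exists r : R, (0 < r)%R /\
    forall z : C, (Cmod (z - z0) < r)%R ->
      is_pseries (K := C_AbsRing) (V := C_NormedModule) a (z - z0) (f z).

(* For open [U] the radius of the expansion may be shrunk so that its disk lies
   in [U]; hence the values of [f] outside [U] do not matter. *)
Definition analytic_on (U : C -> Prop) (f : C -> C) : Prop :=
  forall z0 : C, U z0 -> exists a : nat -> C, has_expansion f z0 a.

(* [m] is the order of vanishing of [f - w] at [z0]; [m = 0] means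
   [f z0 <> w]. *)
Definition multiplicity (f : C -> C) (w z0 : C) (m : nat) : Prop :=
  exists a : nat -> C,
    has_expansion (fun z => f z - w) z0 a /\
    a m <> 0 /\ (forall k : nat, (k < m)%nat -> a k = 0).

(* [s] lists the solutions of [f z = w] in the disk, each one repeated
   according to its multiplicity (a non-solution has multiplicity 0, so it
   does not occur in [s]). *)
Definition exactly_n_to_one (n : nat) (f : C -> C) : Prop :=
  forall w : C,
    (exists z : C, unit_disk z /\ f z = w) ->
    exists s : list C,
      length s = n /\
      (forall z : C, In z s -> unit_disk z) /\
      (forall z : C, unit_disk z ->
         multiplicity f w z (count_occ Ceq_dec s z)).

Definition one_to_one_on (U : C -> Prop) (g : C -> C) : Prop :=
  forall z1 z2 : C, U z1 -> U z2 -> g z1 = g z2 -> z1 = z2.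

Definition blaschke (lambda : C) (alphas : list C) (z : C) : C :=
  lambda * fold_right Cmult 1
             (map (fun alpha => (z - alpha) / (1 - Cconj alpha * z)) alphas).

Definition finite_blaschke_product (phi : C -> C) : Prop :=
  exists (lambda : C) (alphas : list C),
    Cmod lambda = 1%R /\
    alphas <> nil /\
    (forall alpha : C, In alpha alphas -> unit_disk alpha) /\
    (forall z : C, unit_disk z -> phi z = blaschke lambda alphas z).

(* Main.v *)
Require Import Defs.
From Stdlib Require Import Reals List.
From Coquelicot Require Import Coquelicot.
From Stdlib Require Import Factorial Lra Lia ClassicalEpsilon.

(** Let [phi] be the Blaschke product whose zeros are the fibre of [f] through [0].
    The proof shows that [phi] and [f] have the same fibres, with multiplicities;
    then [f = ftilde o phi] for a one-to-one [ftilde].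

    Since every value of [f] is taken exactly [n] times, fibres are proper: the
    fibres of nearby values stay in a common smaller disk ([fibres_stay_inside]), and
    a fibre with one point near the unit circle is entirely near it
    ([fibres_to_boundary]).  By the argument principle, the sum over a fibre of any
    holomorphic [h] is a holomorphic function of the value ([fibre_sum_hol]).

    [phi] is constant on fibres ([phi_fibre]): [phi / (f - f 0)] has no zeros, hence
    it has a logarithm [L] on the disk.  Let [M] be the average of [L] over the fibre
    through a point.  At the boundary [|phi|] tends to [1] at all points of a fibre
    at once, so [|exp (M - L)|] tends to [1] there and, by the maximum principle,
    [exp (M - L)] is constant.  As [M] is constant on fibres, so are [exp L] and
    [phi = (f - f 0) * const * exp L].

    Conversely the level sets of [phi] are no larger than the fibres ([phi_level]):
    dividing the Moebius transform of [phi] that vanishes at [z1] by the Blaschke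
    product of the fibre through [z1] leaves a function of modulus at most [1], whose
    values at the [n] zeros of [phi] multiply to modulus [1]; as [0] is one of these
    zeros, the quotient is constant by the maximum principle.

    Finally [phi] is onto the disk ([phi_onto]), and [ftilde] is locally the average
    of [f] over the fibres of [phi], hence analytic ([ftilde_hol]).

    The complex analysis behind this is built from [cauchy_formula], which holds for
    functions with a continuous complex derivative; that power series are such
    functions ([csum_hol]) and that such functions have power series
    ([hol_has_expansion]) connects it with [analytic_on]. *)

Local Open Scope R_scope.
Local Open Scope C_scope.

(* [ring] does not see the field structure through the carrier of a uniform space. *)
Ltac cring := lazymatch goal with |- @eq _ ?a ?b => change (@eq C a b) end; ring.

Notation contC f z := (@continuous C_UniformSpace C_UniformSpace f z).
Notation nearC z P := (@locally C_UniformSpace z P).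

(** The balls of [C] as a uniform space are squares; all estimates below use disks. *)
Lemma nearC_disk (z : C) (P : C -> Prop) :
  nearC z P <-> exists d : R, (0 < d)%R /\ forall w, (Cmod (w - z) < d)%R -> P w.
Proof.
  split.
  - intros [d Hd]. exists d. split; [apply cond_pos|].
    intros w Hw. apply Hd. apply C_NormedModule_mixin_compat1. exact Hw.
  - intros [d [Hd H]].
    assert (Hd2 : (0 < d / 2)%R) by lra.
    exists (mkposreal _ Hd2). intros w Hw. apply H.
    assert (E := C_NormedModule_mixin_compat2 z w (mkposreal _ Hd2) Hw). simpl in E.
    change (minus w z) with (w - z) in E.
    assert (sqrt 2 < 2)%R.
    { rewrite <- (sqrt_square 2) at 2 by lra. apply sqrt_lt_1; lra. }
    nra.
Qed.

Lemma near_unit_disk z : (Cmod z < 1)%R -> nearC z (fun w => (Cmod w < 1)%R).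
Proof.
  intros Hz. apply nearC_disk. exists (1 - Cmod z)%R. split. lra. intros w Hw.
  assert (T := Cmod_triangle z (w - z)). replace (z + (w - z)) with w in T by ring. lra.
Qed.

(** * Continuity of complex-valued functions *)

Section continuity.
Context {T : UniformSpace}.
Notation cont F x := (@continuous T C_UniformSpace F x).

Lemma cont_pair (F : T -> C) (x : T) :
  continuous (fun y => Re (F y)) x -> continuous (fun y => Im (F y)) x ->
  cont F x.
Proof.
  intros H1 H2.
  apply (continuous_ext (fun y => (Re (F y), Im (F y)))).
  { intros y. symmetry. apply surjective_pairing. }
  intros P HP.
  assert (K := filterlim_pair (F := locally x) _ _ H1 H2).
  apply K. destruct HP as [d Hd].
  exists (ball (Re (F x)) d) (ball (Im (F x)) d).
  - exists d. auto.
  - exists d; auto.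
  - intros a b Ha Hb. apply Hd. split; assumption.
Qed.

Lemma cont_Re (F : T -> C) (x : T) : cont F x -> continuous (fun y => Re (F y)) x.
Proof.
  intros H. apply (continuous_comp F (fun p : C_UniformSpace => fst p)); auto.
  apply continuous_fst.
Qed.

Lemma cont_Im (F : T -> C) (x : T) : cont F x -> continuous (fun y => Im (F y)) x.
Proof.
  intros H. apply (continuous_comp F (fun p : C_UniformSpace => snd p)); auto.
  apply continuous_snd.
Qed.

Lemma cont_const (c : C) (x : T) : cont (fun _ => c) x.
Proof. apply continuous_const. Qed.

Lemma cont_plus (F G : T -> C) (x : T) :
  cont F x -> cont G x -> cont (fun y => F y + G y) x.
Proof.
  intros HF HG. apply cont_pair; simpl.
  - apply (continuous_plus (V := R_NormedModule)); apply cont_Re; auto.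
  - apply (continuous_plus (V := R_NormedModule)); apply cont_Im; auto.
Qed.

Lemma cont_mult (F G : T -> C) (x : T) :
  cont F x -> cont G x -> cont (fun y => F y * G y) x.
Proof.
  intros HF HG.
  assert (F1 := cont_Re _ _ HF). assert (F2 := cont_Im _ _ HF).
  assert (G1 := cont_Re _ _ HG). assert (G2 := cont_Im _ _ HG).
  apply cont_pair; simpl.
  - apply (continuous_minus (V := R_NormedModule));
    apply (continuous_mult (K := R_AbsRing)); auto.
  - apply (continuous_plus (V := R_NormedModule));
    apply (continuous_mult (K := R_AbsRing)); auto.
Qed.

Lemma cont_opp (F : T -> C) (x : T) : cont F x -> cont (fun y => - F y) x.
Proof.
  intros HF. apply (continuous_ext (fun y => (-(1)) * F y)).
  { intros y. cring. }
  apply cont_mult; auto. apply cont_const.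
Qed.

Lemma cont_minus (F G : T -> C) (x : T) :
  cont F x -> cont G x -> cont (fun y => F y - G y) x.
Proof. intros. apply cont_plus; auto. apply cont_opp; auto. Qed.

Lemma cont_inv (F : T -> C) (x : T) :
  cont F x -> F x <> 0 -> cont (fun y => / F y) x.
Proof.
  intros HF H0.
  assert (F1 := cont_Re _ _ HF). assert (F2 := cont_Im _ _ HF).
  assert (D : continuous (fun y => / (Re (F y) * Re (F y) + Im (F y) * Im (F y)))%R x).
  { apply (continuous_comp (fun y => (Re (F y) * Re (F y) + Im (F y) * Im (F y))%R) Rinv).
    - apply (continuous_plus (V := R_NormedModule));
      apply (continuous_mult (K := R_AbsRing)); auto.
    - apply continuous_Rinv. intros E. apply H0.
      destruct (F x) as [a b]; simpl in *.
      assert (a = 0%R) by nra. assert (b = 0%R) by nra. subst. reflexivity. }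
  apply cont_pair.
  - eapply continuous_ext.
    2: { apply (continuous_mult (K := R_AbsRing)). exact F1. exact D. }
    intros y. simpl. unfold Rdiv, mult, Re, Im. simpl. f_equal. f_equal. ring.
  - eapply continuous_ext.
    2: { apply (continuous_opp (V := R_NormedModule)).
         apply (continuous_mult (K := R_AbsRing)). exact F2. exact D. }
    intros y. simpl. unfold Rdiv, mult, opp, Re, Im. simpl.
    rewrite Ropp_mult_distr_l. f_equal. f_equal. ring.
Qed.

Lemma cont_div (F G : T -> C) (x : T) :
  cont F x -> cont G x -> G x <> 0 -> cont (fun y => F y / G y) x.
Proof. intros. apply cont_mult; auto. apply cont_inv; auto. Qed.

Lemma cont_comp (F : C -> C) (G : T -> C) (x : T) :
  cont G x -> contC F (G x) -> cont (fun y => F (G y)) x.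
Proof. intros. apply (continuous_comp G F); auto. Qed.

End continuity.

Lemma contC_id (z : C) : contC (fun w => w) z.
Proof. apply continuous_id. Qed.

Lemma contC_disk (f : C -> C) (z : C) :
  contC f z <-> forall e, (0 < e)%R ->
    exists d, (0 < d)%R /\ forall w, (Cmod (w - z) < d -> Cmod (f w - f z) < e)%R.
Proof.
  split.
  - intros H e He.
    assert (K : nearC (f z) (fun v => (Cmod (v - f z) < e)%R)).
    { apply nearC_disk. exists e. auto. }
    apply H in K. apply nearC_disk in K. exact K.
  - intros H P HP. apply nearC_disk in HP. destruct HP as [e [He HP]].
    destruct (H e He) as [d [Hd Hw]].
    apply nearC_disk. exists d. split; auto.
Qed.

(** * Complex derivatives *)

(** Caratheodory's form: the difference quotient extends continuously to [z].  It
    turns the differentiation rules into identities between continuous functions. *)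
Definition cder (f : C -> C) (z l : C) : Prop :=
  exists p : C -> C, contC p z /\ p z = l /\ forall w, f w = f z + p w * (w - z).

Lemma cder_id z : cder (fun w => w) z 1.
Proof. exists (fun _ => 1). split; [apply cont_const|]. split; auto. intros; ring. Qed.

Lemma cder_const c z : cder (fun _ => c) z 0.
Proof. exists (fun _ => 0). split; [apply cont_const|]. split; auto. intros; ring. Qed.

Lemma cder_cont f z l : cder f z l -> contC f z.
Proof.
  intros [p [Hp [_ E]]].
  apply (continuous_ext (fun w => f z + p w * (w - z))). { intros; now rewrite <- E. }
  apply cont_plus; [apply cont_const|]. apply cont_mult; auto.
  apply cont_minus; [apply contC_id|apply cont_const].
Qed.

Lemma cder_plus f g z l m : cder f z l -> cder g z m -> cder (fun w => f w + g w) z (l + m).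
Proof.
  intros [p [Hp [Ep E]]] [q [Hq [Eq E']]]. exists (fun w => p w + q w).
  split; [now apply cont_plus|]. split. now subst.
  intros w. rewrite (E w), (E' w). ring.
Qed.

Lemma cder_mult f g z l m : cder f z l -> cder g z m ->
  cder (fun w => f w * g w) z (l * g z + f z * m).
Proof.
  intros Hf Hg. assert (Cg := cder_cont _ _ _ Hg).
  destruct Hf as [p [Hp [Ep E]]], Hg as [q [Hq [Eq E']]].
  exists (fun w => p w * g w + f z * q w).
  split. { apply cont_plus; apply cont_mult; auto. apply cont_const. }
  split. now subst.
  intros w. rewrite (E w). rewrite (E' w). ring.
Qed.

Lemma Cminus_neq_0 (a b : C) : a <> b -> a - b <> 0.
Proof. intros H E. apply H. replace a with (a - b + b) by ring. rewrite E. ring. Qed.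

Lemma RtoC_neq_0 (x : R) : x <> 0%R -> RtoC x <> 0.
Proof. intros H E. apply H. now apply RtoC_inj in E. Qed.

Lemma Cinv_neq_0 (z : C) : z <> 0 -> / z <> 0.
Proof.
  intros H. apply Cmod_gt_0. rewrite Cmod_inv by auto. apply Rinv_0_lt_compat. now apply Cmod_gt_0.
Qed.

Lemma cont_neq (f : C -> C) (z a : C) : contC f z -> f z <> a -> nearC z (fun w => f w <> a).
Proof.
  intros Cf H0. assert (Hp : (0 < Cmod (f z - a))%R) by (apply Cmod_gt_0, Cminus_neq_0; auto).
  destruct (proj1 (contC_disk _ _) Cf _ Hp) as [d [Hd Hw]].
  apply nearC_disk. exists d. split; auto.
  intros w Hww E0. specialize (Hw w Hww). rewrite E0 in Hw.
  replace (a - f z) with (- (f z - a)) in Hw by ring. rewrite Cmod_opp in Hw. lra.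
Qed.

(** The slope is prescribed near [z] only; elsewhere the difference quotient
    itself serves. *)
Lemma cder_near (f p : C -> C) (z : C) :
  contC p z -> nearC z (fun w => f w = f z + p w * (w - z)) -> cder f z (p z).
Proof.
  intros Hp Hn.
  exists (fun w => if Ceq_dec w z then p z else (f w - f z) / (w - z)).
  split; [|split].
  - apply (continuous_ext_loc _ p); auto.
    revert Hn. apply filter_imp. intros w Hw.
    destruct (Ceq_dec w z) as [->|Hne]; auto.
    rewrite Hw. apply Cminus_neq_0 in Hne. unfold Cdiv.
    change (@eq C (p w) ((f z + p w * (w - z) - f z) * / (w - z))). field; auto.
  - destruct (Ceq_dec z z); congruence.
  - intros w. destruct (Ceq_dec w z) as [->|Hne]. ring.
    apply Cminus_neq_0 in Hne. field; auto.
Qed.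

Lemma cder_ext_loc f g z l : nearC z (fun w => f w = g w) -> cder f z l -> cder g z l.
Proof.
  intros Hn [p [Hp [<- E]]]. apply cder_near; auto.
  assert (E0 : f z = g z).
  { apply nearC_disk in Hn. destruct Hn as [d [Hd Hn]]. apply Hn.
    replace (z - z) with (RtoC 0) by ring. now rewrite Cmod_0. }
  revert Hn. apply filter_imp. intros w Hw. rewrite <- Hw, <- E0. apply E.
Qed.

Lemma cder_inv f z l : cder f z l -> f z <> 0 ->
  cder (fun w => / f w) z (- (l / (f z * f z))).
Proof.
  intros Hf H0. assert (Cf := cder_cont _ _ _ Hf).
  destruct Hf as [p [Hp [Ep E]]]. subst l.
  apply (cder_near (fun w => / f w) (fun w => - (p w / (f w * f z)))).
  - apply cont_opp, cont_div; auto.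
    + apply cont_mult; auto. apply cont_const.
    + now apply Cmult_neq_0.
  - generalize (cont_neq _ _ _ Cf H0). apply filter_imp. intros w Hw.
    assert (X : p w * (w - z) = f w - f z) by (rewrite (E w); ring).
    replace (/ f z + - (p w / (f w * f z)) * (w - z))
      with (/ f z - (p w * (w - z)) / (f w * f z)) by (field; auto).
    rewrite X. field; auto.
Qed.

Lemma cder_comp f g z l m : cder g z m -> cder f (g z) l ->
  cder (fun w => f (g w)) z (l * m).
Proof.
  intros Hg [p [Hp [<- E]]]. assert (Cg := cder_cont _ _ _ Hg).
  destruct Hg as [q [Hq [<- E']]].
  exists (fun w => p (g w) * q w). split; [|split]; auto.
  - apply cont_mult; auto. now apply cont_comp.
  - intros w. rewrite (E (g w)). rewrite (E' w) at 2. ring.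
Qed.

Lemma cder_unique f z l m : cder f z l -> cder f z m -> l = m.
Proof.
  intros [p [Hp [<- E]]] [q [Hq [<- E']]].
  destruct (Ceq_dec (p z) (q z)) as [|Hne]; auto. exfalso.
  assert (Hn : nearC z (fun w => p w - q w <> 0)).
  { apply (cont_neq (fun w => p w - q w)). now apply cont_minus. now apply Cminus_neq_0. }
  apply nearC_disk in Hn. destruct Hn as [d [Hd Hn]].
  assert (Hh : z + RtoC (d / 2) - z = RtoC (d / 2)) by ring.
  assert (X : (p (z + RtoC (d / 2)) - q (z + RtoC (d / 2))) * RtoC (d / 2) = 0).
  { specialize (E (z + RtoC (d / 2))). rewrite (E' (z + RtoC (d / 2))), Hh in E.
    assert (Y := f_equal (fun x => f z + p (z + RtoC (d / 2)) * RtoC (d / 2) - x) E).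
    simpl in Y. ring_simplify in Y. rewrite <- Y. ring. }
  revert X. apply Cmult_neq_0.
  - apply Hn. rewrite Hh, Cmod_R, Rabs_pos_eq; lra.
  - apply RtoC_neq_0. lra.
Qed.

(** A quadratic remainder, as power series provide. *)
Lemma cder_of_bound f z l (K d : R) : (0 < d)%R ->
  (forall w, (Cmod (w - z) < d)%R ->
     (Cmod (f w - f z - l * (w - z)) <= K * (Cmod (w - z) * Cmod (w - z)))%R) ->
  cder f z l.
Proof.
  intros Hd H.
  set (p := fun w => if Ceq_dec w z then l else (f w - f z) / (w - z)).
  exists p. split; [|split].
  - apply contC_disk. intros e He.
    assert (HK : (0 < e / (Rabs K + 1))%R).
    { apply Rdiv_lt_0_compat; auto. generalize (Rabs_pos K); lra. }
    exists (Rmin d (e / (Rabs K + 1))). split; [now apply Rmin_pos|].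
    intros w Hw. assert (Hw1 := Rlt_le_trans _ _ _ Hw (Rmin_l _ _)).
    assert (Hw2 := Rlt_le_trans _ _ _ Hw (Rmin_r _ _)).
    unfold p. destruct (Ceq_dec z z) as [_|]; [|congruence].
    destruct (Ceq_dec w z) as [->|Hne].
    { replace (l - l) with (RtoC 0) by ring. now rewrite Cmod_0. }
    apply Cminus_neq_0 in Hne.
    replace ((f w - f z) / (w - z) - l) with ((f w - f z - l * (w - z)) / (w - z)) by (field; auto).
    rewrite Cmod_div by auto. assert (Hpos : (0 < Cmod (w - z))%R) by now apply Cmod_gt_0.
    specialize (H w Hw1).
    apply Rle_lt_trans with (K * Cmod (w - z))%R.
    { apply Rmult_le_reg_r with (Cmod (w - z)); auto. unfold Rdiv.
      rewrite Rmult_assoc, Rinv_l by lra. lra. }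
    assert (Hr := Rle_abs K). assert (Hr0 := Rabs_pos K).
    apply Rle_lt_trans with ((Rabs K + 1) * Cmod (w - z))%R. nra.
    apply Rmult_lt_compat_l with (r := (Rabs K + 1)%R) in Hw2; [|lra].
    replace ((Rabs K + 1) * (e / (Rabs K + 1)))%R with e in Hw2 by (field; lra). auto.
  - unfold p. destruct (Ceq_dec z z); congruence.
  - intros w. unfold p. destruct (Ceq_dec w z) as [->|Hne]. ring.
    apply Cminus_neq_0 in Hne. field; auto.
Qed.

(** * Holomorphy at a point *)

(** Continuity of the derivative is part of the definition: it is what allows
    differentiating under the integral sign in Cauchy's formula. *)
Definition hol (f : C -> C) (z : C) : Prop :=
  exists f', nearC z (fun w => cder f w (f' w) /\ contC f' w).

Definition deriv (f : C -> C) (z : C) : C := epsilon (inhabits (RtoC 0)) (cder f z).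

Lemma near_self z (P : C -> Prop) : nearC z P -> P z.
Proof. apply locally_singleton. Qed.

Lemma near_near z (P : C -> Prop) : nearC z P -> nearC z (fun w => nearC w P).
Proof. apply locally_locally. Qed.

Lemma deriv_eq f z l : cder f z l -> deriv f z = l.
Proof.
  intros H. apply (cder_unique f z); auto.
  unfold deriv. apply epsilon_spec. now exists l.
Qed.

Lemma hol_near f z : hol f z -> nearC z (hol f).
Proof.
  intros [f' H]. apply near_near in H. revert H. apply filter_imp. intros w Hw. now exists f'.
Qed.

Lemma hol_cder f z : hol f z -> cder f z (deriv f z).
Proof.
  intros [f' H]. apply near_self in H. destruct H as [H _]. now rewrite (deriv_eq _ _ _ H).
Qed.

Lemma hol_deriv_cont f z : hol f z -> contC (deriv f) z.
Proof.
  intros [f' H]. assert (H0 := near_self _ _ H). destruct H0 as [_ H0].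
  apply (continuous_ext_loc _ f'); auto.
  revert H. apply filter_imp. intros w [Hw _]. symmetry. now apply deriv_eq.
Qed.

Lemma hol_cont f z : hol f z -> contC f z.
Proof. intros H. exact (cder_cont _ _ _ (hol_cder _ _ H)). Qed.

Lemma hol_ext_loc f g z : nearC z (fun w => f w = g w) -> hol f z -> hol g z.
Proof.
  intros Hn [f' H]. exists f'. apply near_near in Hn.
  generalize (filter_and _ _ Hn H). apply filter_imp. intros w [Hw [D Cw]]. split; auto.
  now apply cder_ext_loc with f.
Qed.

Lemma hol_ext f g z : (forall w, f w = g w) -> hol f z -> hol g z.
Proof. intros H. apply hol_ext_loc. now apply filter_forall. Qed.

Lemma hol_const c z : hol (fun _ => c) z.
Proof.
  exists (fun _ => 0). apply filter_forall. intros w. split. apply cder_const. apply cont_const.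
Qed.

Lemma hol_id z : hol (fun w => w) z.
Proof.
  exists (fun _ => 1). apply filter_forall. intros w. split. apply cder_id. apply cont_const.
Qed.

Lemma hol_plus f g z : hol f z -> hol g z -> hol (fun w => f w + g w) z.
Proof.
  intros Hf Hg. apply hol_near in Hf, Hg. exists (fun w => deriv f w + deriv g w).
  generalize (filter_and _ _ Hf Hg). apply filter_imp. intros w [F G]. split.
  - apply cder_plus; now apply hol_cder.
  - apply cont_plus; now apply hol_deriv_cont.
Qed.

Lemma hol_mult f g z : hol f z -> hol g z -> hol (fun w => f w * g w) z.
Proof.
  intros Hf Hg. apply hol_near in Hf, Hg. exists (fun w => deriv f w * g w + f w * deriv g w).
  generalize (filter_and _ _ Hf Hg). apply filter_imp. intros w [F G]. split.
  - apply cder_mult; now apply hol_cder.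
  - apply cont_plus; apply cont_mult; (now apply hol_deriv_cont) || now apply hol_cont.
Qed.

Lemma hol_opp f z : hol f z -> hol (fun w => - f w) z.
Proof.
  intros H. apply hol_ext with (fun w => - (1) * f w). { intros; ring. }
  apply hol_mult; auto. apply hol_const.
Qed.

Lemma hol_minus f g z : hol f z -> hol g z -> hol (fun w => f w - g w) z.
Proof. intros. apply hol_plus; auto. now apply hol_opp. Qed.

Lemma hol_inv f z : hol f z -> f z <> 0 -> hol (fun w => / f w) z.
Proof.
  intros Hf H0. assert (Hn := cont_neq _ _ _ (hol_cont _ _ Hf) H0). apply hol_near in Hf.
  exists (fun w => - (deriv f w / (f w * f w))).
  generalize (filter_and _ _ Hf Hn). apply filter_imp. intros w [F N]. split.
  - apply cder_inv; auto. now apply hol_cder.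
  - apply cont_opp, cont_div. now apply hol_deriv_cont.
    apply cont_mult; now apply hol_cont. now apply Cmult_neq_0.
Qed.

Lemma hol_div f g z : hol f z -> hol g z -> g z <> 0 -> hol (fun w => f w / g w) z.
Proof. intros. apply hol_mult; auto. now apply hol_inv. Qed.

Lemma hol_comp f g z : hol g z -> hol f (g z) -> hol (fun w => f (g w)) z.
Proof.
  intros Hg Hf. assert (Cg := hol_cont _ _ Hg).
  apply hol_near in Hf, Hg.
  assert (Hf' : nearC z (fun w => hol f (g w))) by exact (Cg _ Hf). clear Hf; rename Hf' into Hf.
  exists (fun w => deriv f (g w) * deriv g w).
  generalize (filter_and _ _ Hf Hg). apply filter_imp. intros w [F G]. split.
  - apply cder_comp; now apply hol_cder.
  - apply cont_mult. apply cont_comp with (F := deriv f). now apply hol_cont.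
    now apply hol_deriv_cont. now apply hol_deriv_cont.
Qed.

(** * Power series are holomorphic *)

Definition clim (u : nat -> C) (l : C) : Prop :=
  is_lim_seq (fun n => Cmod (u n - l)) 0%R.

Lemma clim_le (u : nat -> C) (l : C) (v : nat -> R) :
  (forall n, (Cmod (u n - l) <= v n)%R) -> is_lim_seq v 0%R -> clim u l.
Proof.
  intros H Hv. apply is_lim_seq_le_le with (fun _ => 0%R) v; auto.
  - intros n. split; auto. apply Cmod_ge_0.
  - apply is_lim_seq_const.
Qed.

Lemma clim_ext (u v : nat -> C) l : (forall n, u n = v n) -> clim u l -> clim v l.
Proof.
  intros H. apply is_lim_seq_ext. intros n. now rewrite H.
Qed.

Lemma clim_const c : clim (fun _ => c) c.
Proof.
  apply clim_le with (fun _ => 0%R). 2: apply is_lim_seq_const.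
  intros _. replace (c - c) with (RtoC 0) by ring. rewrite Cmod_0. lra.
Qed.

Lemma clim_plus u v l m : clim u l -> clim v m -> clim (fun n => u n + v n) (l + m).
Proof.
  intros Hu Hv. apply clim_le with (fun n => Cmod (u n - l) + Cmod (v n - m))%R.
  - intros n. replace (u n + v n - (l + m)) with ((u n - l) + (v n - m)) by ring.
    apply Cmod_triangle.
  - replace (Finite 0%R) with (Finite (0 + 0)) by (f_equal; lra).
    now apply is_lim_seq_plus'.
Qed.

Lemma clim_scal c u l : clim u l -> clim (fun n => c * u n) (c * l).
Proof.
  intros Hu. apply clim_le with (fun n => Cmod c * Cmod (u n - l))%R.
  - intros n. replace (c * u n - c * l) with (c * (u n - l)) by ring.
    rewrite Cmod_mult. lra.
  - replace (Finite 0%R) with (Rbar_mult (Cmod c) 0%R) by (simpl; f_equal; ring).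
    now apply is_lim_seq_scal_l.
Qed.

Lemma clim_incr u l : clim u l -> clim (fun n => u (S n)) l.
Proof. intros H. now apply (is_lim_seq_incr_1 (fun n => Cmod (u n - l))). Qed.

Lemma clim_decr u l : clim (fun n => u (S n)) l -> clim u l.
Proof. intros H. now apply (is_lim_seq_incr_1 (fun n => Cmod (u n - l))). Qed.

Lemma clim_bound u l (M : R) : (forall n, (Cmod (u n) <= M)%R) -> clim u l -> (Cmod l <= M)%R.
Proof.
  intros H Hu.
  assert (K : Rbar_le (Cmod l) M).
  { apply is_lim_seq_le with (fun _ => Cmod l) (fun n => (M + Cmod (u n - l))%R).
    - intros n. replace l with (u n + - (u n - l)) at 1 by ring.
      apply Rle_trans with (1 := Cmod_triangle _ _). rewrite Cmod_opp.
      apply Rplus_le_compat_r. apply H.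
    - apply is_lim_seq_const.
    - replace (Finite M) with (Finite (M + 0)) by (f_equal; lra).
      apply is_lim_seq_plus'; auto. apply is_lim_seq_const. }
  exact K.
Qed.

Lemma clim_unique u l m : clim u l -> clim u m -> l = m.
Proof.
  intros H1 H2.
  assert (K : (Cmod (l - m) <= 0)%R).
  { apply clim_bound with (fun n => u n + - (1) * u n).
    - intros n. replace (u n + - (1) * u n) with (RtoC 0) by ring. rewrite Cmod_0; lra.
    - replace (l - m) with (l + - (1) * m) by ring. apply clim_plus; auto. now apply clim_scal. }
  destruct (Ceq_dec l m) as [|N]; auto. apply Cminus_neq_0, Cmod_gt_0 in N. lra.
Qed.

(** The first [n] terms, so that [psum a z 0 = 0]. *)
Fixpoint psum (a : nat -> C) (z : C) (n : nat) : C :=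
  match n with
  | O => 0
  | S m => psum a z m + a m * z ^ m
  end.

Definition csum (a : nat -> C) (z l : C) : Prop := clim (psum a z) l.

Lemma is_pseries_csum a z l :
  is_pseries (K := C_AbsRing) (V := C_NormedModule) a z l <-> csum a z l.
Proof.
  assert (E : forall n, sum_n (fun k => @scal C_AbsRing C_NormedModule (pow_n z k) (a k)) n
                        = psum a z (S n)).
  { induction n.
    - rewrite sum_O. cbn [psum]. change (pow_n z 0 * a 0%nat = 0 + a 0%nat * z ^ 0).
      change (pow_n z 0) with (RtoC 1). simpl. cring.
    - rewrite sum_Sn, IHn. cbn [psum].
      change (psum a z n + a n * z ^ n + pow_n z (S n) * a (S n) =
        psum a z n + a n * z ^ n + a (S n) * z ^ S n).
      change (pow_n z (S n)) with (z ^ S n). cring. }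
  unfold is_pseries, is_series, csum. split.
  - intros H. apply clim_decr. apply (is_lim_seq_spec _ 0%R). intros e.
    specialize (H (fun y => (Cmod (y - l) < e)%R)).
    destruct H as [N HN]. { apply nearC_disk. exists e. split; auto. apply cond_pos. }
    exists N. intros n Hn. rewrite <- E. rewrite Rminus_0_r, Rabs_pos_eq by apply Cmod_ge_0.
    now apply HN.
  - intros H P HP. apply nearC_disk in HP. destruct HP as [d [Hd HP]].
    apply clim_incr in H. apply (is_lim_seq_spec _ 0%R) in H.
    destruct (H (mkposreal d Hd)) as [N HN]. exists N. intros n Hn.
    apply HP. rewrite E. specialize (HN n Hn).
    rewrite Rminus_0_r, Rabs_pos_eq in HN by apply Cmod_ge_0. exact HN.
Qed.

(** Cauchy bounds on the coefficients for the radius [r]. *)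
Definition geom_bounded (a : nat -> C) (r M : R) : Prop := forall k, (Cmod (a k) * r ^ k <= M)%R.

Lemma geom_sum (q : R) n : (0 <= q < 1)%R -> (sum_n (fun k => q ^ k) n <= / (1 - q))%R.
Proof.
  intros Hq. rewrite sum_n_Reals, tech3 by lra.
  assert (0 <= q ^ S n)%R by (apply pow_le; lra).
  unfold Rdiv. rewrite <- (Rmult_1_l (/ (1 - q))) at 2.
  apply Rmult_le_compat_r. apply Rlt_le, Rinv_0_lt_compat; lra. lra.
Qed.

Lemma geom_bounded_term a r M z k : (0 < r)%R -> geom_bounded a r M -> 
  (Cmod (a k * z ^ k) <= M * (Cmod z / r) ^ k)%R.
Proof.
  intros Hr H. rewrite Cmod_mult, Cmod_pow.
  unfold Rdiv. rewrite Rpow_mult_distr, pow_inv.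
  assert (0 < r ^ k)%R by now apply pow_lt.
  assert (P := pow_le _ k (Cmod_ge_0 z)).
  replace (Cmod (a k) * Cmod z ^ k)%R with ((Cmod (a k) * r ^ k) * (Cmod z ^ k * / r ^ k))%R
    by (field; lra).
  apply Rmult_le_compat_r; auto. apply Rmult_le_pos; auto. now apply Rlt_le, Rinv_0_lt_compat.
Qed.

Lemma ps_conv a r M z : (0 < r)%R -> geom_bounded a r M -> (Cmod z < r)%R -> exists l, csum a z l.
Proof.
  intros Hr H Hz.
  assert (Hq : (0 <= Cmod z / r < 1)%R).
  { split. apply Rmult_le_pos. apply Cmod_ge_0. now apply Rlt_le, Rinv_0_lt_compat.
    apply Rmult_lt_reg_r with r; auto. unfold Rdiv. rewrite Rmult_assoc, Rinv_l; lra. }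
  assert (G : ex_series (fun k => M * (Cmod z / r) ^ k)%R).
  { apply (ex_series_scal (K := R_AbsRing) (V := R_NormedModule) M).
    apply ex_series_geom. rewrite Rabs_pos_eq; lra. }
  assert (S1 : ex_series (fun k => Re (a k * z ^ k))).
  { apply (ex_series_le (K := R_AbsRing) (V := R_CompleteNormedModule)) with (2 := G). intros k.
    apply Rle_trans with (1 := re_le_Cmod _). now apply geom_bounded_term. }
  assert (S2 : ex_series (fun k => Im (a k * z ^ k))).
  { apply (ex_series_le (K := R_AbsRing) (V := R_CompleteNormedModule)) with (2 := G). intros k.
    apply Rle_trans with (Cmod (a k * z ^ k)). 2: now apply geom_bounded_term.
    apply Rle_trans with (2 := Rmax_Cmod _). apply Rmax_r. }
  destruct S1 as [l1 L1], S2 as [l2 L2]. exists (l1, l2).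
  apply clim_decr.
  assert (E : forall n, psum a z (S n) =
    (sum_n (fun k => Re (a k * z ^ k)) n, sum_n (fun k => Im (a k * z ^ k)) n)).
  { induction n.
    - rewrite !sum_O. cbn [psum]. rewrite Cplus_0_l. apply surjective_pairing.
    - rewrite !sum_Sn. cbn [psum]. cbn [psum] in IHn. rewrite IHn.
      apply injective_projections; reflexivity. }
  apply clim_le with (fun n => Rabs (sum_n (fun k => Re (a k * z ^ k)) n - l1) +
     Rabs (sum_n (fun k => Im (a k * z ^ k)) n - l2))%R.
  - intros n. rewrite E.
    match goal with |- (Cmod ?x <= _)%R => replace x with
      (RtoC (sum_n (fun k => Re (a k * z ^ k)) n - l1) +
       Ci * RtoC (sum_n (fun k => Im (a k * z ^ k)) n - l2)) end.
    2: { unfold Ci; apply injective_projections; simpl; ring. }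
    apply Rle_trans with (1 := Cmod_triangle _ _).
    rewrite Cmod_mult, Cmod_Ci, !Cmod_R. lra.
  - replace (Finite 0%R) with (Finite (0 + 0)) by (f_equal; lra).
    apply is_lim_seq_plus'.
    + replace (Finite 0%R) with (Rbar_abs (l1 - l1)%R) by (simpl; f_equal; rewrite Rminus_diag; apply Rabs_R0).
      apply is_lim_seq_abs. apply is_lim_seq_minus'. exact L1. apply is_lim_seq_const.
    + replace (Finite 0%R) with (Rbar_abs (l2 - l2)%R) by (simpl; f_equal; rewrite Rminus_diag; apply Rabs_R0).
      apply is_lim_seq_abs. apply is_lim_seq_minus'. exact L2. apply is_lim_seq_const.
Qed.

Definition dcoef (a : nat -> C) (k : nat) : C := RtoC (INR (S k)) * a (S k).

(** This bound and the next two compare the derivative and the Taylor remainders of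
    [z ^ k] with [(rho + d) ^ k], whose binomial expansion has terms of the same
    shape; induction on [k] keeps the constants at [1]. *)
Lemma pow_der_bound (rho d : R) k : (0 <= rho -> 0 < d -> INR (S k) * rho ^ k * d <= (rho + d) ^ S k)%R.
Proof.
  intros Hr Hd. induction k.
  - simpl. lra.
  - replace (INR (S (S k)) * rho ^ S k * d)%R with
      (rho * (INR (S k) * rho ^ k * d) + rho ^ S k * d)%R
      by (rewrite (S_INR (S k)); simpl; ring).
    change ((rho + d) ^ S (S k))%R with ((rho + d) * (rho + d) ^ S k)%R.
    assert (rho ^ S k <= (rho + d) ^ S k)%R by (apply pow_incr; lra).
    nra.
Qed.

Lemma geom_bounded_dcoef a r M rho : (0 < rho < r)%R -> geom_bounded a r M ->
  geom_bounded (dcoef a) rho (M / (r - rho)).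
Proof.
  intros Hr H k. unfold dcoef. rewrite Cmod_mult, Cmod_R, Rabs_pos_eq by apply pos_INR.
  assert (P := pow_der_bound rho (r - rho) k ltac:(lra) ltac:(lra)).
  replace (rho + (r - rho))%R with r in P by ring.
  specialize (H (S k)). assert (Q := Cmod_ge_0 (a (S k))).
  apply Rmult_le_reg_r with (r - rho)%R. lra.
  unfold Rdiv. rewrite (Rmult_assoc M), Rinv_l by lra. nra.
Qed.

Lemma pow_first (z h : C) (rho d : R) k :
  (Cmod z <= rho)%R -> (0 < d)%R -> (Cmod h <= d)%R ->
  (Cmod ((z + h) ^ k - z ^ k) * d <= Cmod h * (rho + d) ^ k)%R.
Proof.
  intros Hz Hd Hh. assert (Z := Cmod_ge_0 z). assert (Hp := Cmod_ge_0 h). induction k.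
  - simpl. replace (1 - 1) with (RtoC 0) by ring. rewrite Cmod_0. nra.
  - replace ((z + h) ^ S k - z ^ S k) with (z * ((z + h) ^ k - z ^ k) + h * (z + h) ^ k)
      by (simpl; ring).
    assert (T := Cmod_triangle (z * ((z + h) ^ k - z ^ k)) (h * (z + h) ^ k)).
    rewrite !Cmod_mult, Cmod_pow in T.
    assert (P : (Cmod (z + h) ^ k <= (rho + d) ^ k)%R).
    { apply pow_incr. split. apply Cmod_ge_0. assert (Y := Cmod_triangle z h). lra. }
    change ((rho + d) ^ S k)%R with ((rho + d) * (rho + d) ^ k)%R.
    assert (Q := Cmod_ge_0 ((z + h) ^ k - z ^ k)).
    assert (Q2 : (0 <= Cmod (z + h) ^ k)%R) by (apply pow_le, Cmod_ge_0).
    set (A := Cmod ((z + h) ^ k - z ^ k)) in *. set (B := (Cmod (z + h) ^ k)%R) in *.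
    set (D := ((rho + d) ^ k)%R) in *.
    apply Rle_trans with ((Cmod z * A + Cmod h * B) * d)%R. nra.
    assert (Cmod z * (A * d) <= rho * (Cmod h * D))%R.
    { apply Rmult_le_compat; auto. apply Rmult_le_pos; lra. }
    assert (Cmod h * B * d <= Cmod h * D * d)%R.
    { apply Rmult_le_compat_r; [lra|]. apply Rmult_le_compat_l; auto. }
    nra.
Qed.

Lemma pow_second (z h : C) (rho d : R) k :
  (Cmod z <= rho)%R -> (0 < d)%R -> (Cmod h <= d)%R ->
  (Cmod ((z + h) ^ S k - z ^ S k - RtoC (INR (S k)) * z ^ k * h) * (d * d)
     <= Cmod h * Cmod h * (rho + d) ^ S k)%R.
Proof.
  intros Hz Hd Hh. assert (Z := Cmod_ge_0 z). assert (Hp := Cmod_ge_0 h). induction k.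
  - simpl. replace ((z + h) * 1 - z * 1 - 1 * 1 * h) with (RtoC 0) by ring.
    rewrite Cmod_0, Rmult_0_l, Rmult_1_r. apply Rmult_le_pos. nra. lra.
  - replace ((z + h) ^ S (S k) - z ^ S (S k) - RtoC (INR (S (S k))) * z ^ S k * h)
      with (z * ((z + h) ^ S k - z ^ S k - RtoC (INR (S k)) * z ^ k * h)
            + h * ((z + h) ^ S k - z ^ S k))
      by (rewrite (S_INR (S k)), RtoC_plus; simpl; ring).
    assert (F := pow_first z h rho d (S k) Hz Hd Hh).
    match goal with |- (Cmod (?x + ?y) * _ <= _)%R => assert (T := Cmod_triangle x y) end.
    rewrite !Cmod_mult in T.
    change ((rho + d) ^ S (S k))%R with ((rho + d) * (rho + d) ^ S k)%R.
    match type of T with (_ <= Cmod z * ?a + _ * ?b)%R => set (A := a) in *; set (B := b) in * end.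
    assert (QA : (0 <= A)%R) by apply Cmod_ge_0.
    assert (QB : (0 <= B)%R) by apply Cmod_ge_0.
    set (D := ((rho + d) ^ S k)%R) in *.
    apply Rle_trans with ((Cmod z * A + Cmod h * B) * (d * d))%R.
    { apply Rmult_le_compat_r; auto. nra. }
    assert (Cmod z * (A * (d * d)) <= rho * (Cmod h * Cmod h * D))%R.
    { apply Rmult_le_compat; auto. apply Rmult_le_pos; nra. }
    assert (Cmod h * (B * d) * d <= Cmod h * (Cmod h * D) * d)%R.
    { apply Rmult_le_compat_r; [lra|]. apply Rmult_le_compat_l; auto. }
    nra.
Qed.

(** Termwise differentiation: the Taylor remainder of order one of [z ^ k] is at
    most [(|h| / d) ^ 2 * (|z| + d) ^ k] for [|h| <= d], and these bounds sum up
    as long as [|z| + d] stays inside the disk of convergence. *)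
Lemma ps_cder a r M (F G : C -> C) : (0 < r)%R -> geom_bounded a r M ->
  (forall z, (Cmod z < r)%R -> csum a z (F z)) ->
  (forall z, (Cmod z < r)%R -> csum (dcoef a) z (G z)) ->
  forall z, (Cmod z < r)%R -> cder F z (G z).
Proof.
  intros Hr HM HF HG z Hz.
  (* [d] is half the distance to the circle of convergence. *)
  set (d := ((r - Cmod z) / 2)%R). assert (Hd : (0 < d)%R) by (unfold d; lra).
  set (rho := Cmod z). assert (Hrho : (rho + d < r)%R) by (unfold d, rho; lra).
  assert (Z := Cmod_ge_0 z). fold rho in Z.
  set (q := ((rho + d) / r)%R).
  assert (Hq : (0 <= q < 1)%R).
  { unfold q; split. apply Rmult_le_pos. lra. now apply Rlt_le, Rinv_0_lt_compat.
    apply Rmult_lt_reg_r with r; auto. unfold Rdiv. rewrite Rmult_assoc, Rinv_l; lra. }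
  assert (HM0 : (0 <= M)%R).
  { apply Rle_trans with (2 := HM O). simpl. assert (X := Cmod_ge_0 (a O)). lra. }
  apply cder_of_bound with (K := (M / (1 - q) / (d * d))%R) (d := d); auto.
  intros w Hw. set (h := w - z) in *.
  assert (Ew : w = z + h) by (unfold h; ring).
  assert (Hwr : (Cmod w < r)%R).
  { rewrite Ew. assert (T := Cmod_triangle z h). fold rho in T. lra. }
  assert (L := HF w Hwr). apply clim_incr in L.
  assert (L2 := HF z Hz). apply clim_incr in L2.
  assert (L3 := HG z Hz).
  assert (LL := clim_plus _ _ _ _ (clim_plus _ _ _ _ L (clim_scal (-(1)) _ _ L2))
                  (clim_scal (- h) _ _ L3)).
  replace (F w - F z - G z * h) with (F w + -(1) * F z + - h * G z) by ring.
  apply clim_bound with (2 := LL). intros n. cbv beta.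
  assert (Hh : (Cmod h <= d)%R) by lra.
  assert (Hhp := Cmod_ge_0 h).
  assert (B : (Cmod (psum a w (S n) + -(1) * psum a z (S n) + - h * psum (dcoef a) z n) * (d * d)
     <= Cmod h * Cmod h * (M * sum_n (fun k => q ^ k)%R n))%R).
  { induction n.
    - cbn [psum]. rewrite sum_O. simpl.
      match goal with |- (Cmod ?x * _ <= _)%R => replace x with (RtoC 0) by ring end.
      rewrite Cmod_0. rewrite Rmult_0_l. apply Rmult_le_pos; nra.
    - rewrite sum_Sn. change plus with Rplus.
      assert (X : psum a w (S (S n)) + -(1) * psum a z (S (S n)) + - h * psum (dcoef a) z (S n)
        = (psum a w (S n) + -(1) * psum a z (S n) + - h * psum (dcoef a) z n)
        + a (S n) * ((z + h) ^ S n - z ^ S n - RtoC (INR (S n)) * z ^ n * h)).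
      { rewrite <- Ew. change (psum a w (S (S n))) with (psum a w (S n) + a (S n) * w ^ S n).
        change (psum a z (S (S n))) with (psum a z (S n) + a (S n) * z ^ S n).
        change (psum (dcoef a) z (S n)) with (psum (dcoef a) z n + dcoef a n * z ^ n).
        unfold dcoef. ring. }
      rewrite X. eapply Rle_trans; [apply Rmult_le_compat_r; [nra|apply Cmod_triangle]|].
      rewrite (Cmod_mult (a (S n))).
      assert (S1 := pow_second z h rho d n (Rle_refl _) Hd Hh).
      specialize (HM (S n)).
      assert (Eq : (q ^ S n * r ^ S n = (rho + d) ^ S n)%R).
      { rewrite <- Rpow_mult_distr. f_equal. unfold q. field. lra. }
      match type of S1 with (?t * _ <= _)%R => set (t0 := t) in *; assert (T0 : (0 <= t)%R) by apply Cmod_ge_0 end.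
      assert (Q0 : (0 <= q ^ S n)%R) by (apply pow_le; lra).
      assert (A0 := Cmod_ge_0 (a (S n))).
      rewrite <- Eq in S1.
      assert (Cmod (a (S n)) * (t0 * (d * d)) <= Cmod h * Cmod h * q ^ S n * M)%R.
      { apply Rle_trans with (Cmod (a (S n)) * (Cmod h * Cmod h * (q ^ S n * r ^ S n)))%R.
        now apply Rmult_le_compat_l.
        replace (Cmod (a (S n)) * (Cmod h * Cmod h * (q ^ S n * r ^ S n)))%R with
          (Cmod h * Cmod h * q ^ S n * (Cmod (a (S n)) * r ^ S n))%R by ring.
        apply Rmult_le_compat_l; auto. apply Rmult_le_pos; auto. nra. }
      nra. }
  apply Rmult_le_reg_r with (d * d)%R. nra.
  apply Rle_trans with (1 := B).
  replace (M / (1 - q) / (d * d) * (Cmod h * Cmod h) * (d * d))%R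
    with (Cmod h * Cmod h * (M * / (1 - q)))%R by (field; split; lra).
  apply Rmult_le_compat_l. nra. apply Rmult_le_compat_l; auto. now apply geom_sum.
Qed.

Lemma csum_geom_bounded a z l : csum a z l -> z <> 0 -> exists M, geom_bounded a (Cmod z) M.
Proof.
  intros H Hz.
  assert (L := clim_plus _ _ _ _ (clim_incr _ _ H) (clim_scal (-(1)) _ _ H)).
  replace (l + - (1) * l) with (RtoC 0) in L by ring.
  assert (B : exists M, forall n, (Cmod (a n * z ^ n) <= M)%R).
  { assert (ex_finite_lim_seq (fun n => Cmod (a n * z ^ n))) as K.
    { exists 0%R. revert L. apply is_lim_seq_ext. intros n. cbn [psum]. f_equal. ring. }
    destruct K as [l0 K]. apply is_lim_seq_spec in K. destruct (K (mkposreal 1 Rlt_0_1)) as [N HN].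
    simpl in HN.
    assert (P : forall m, exists M, forall n, (n < m)%nat -> (Cmod (a n * z ^ n) <= M)%R).
    { induction m. exists 0%R; intros; lia. destruct IHm as [M HM].
      exists (Rmax M (Cmod (a m * z ^ m))). intros n Hn.
      destruct (Nat.eq_dec n m) as [->|]. apply Rmax_r.
      apply Rle_trans with M. apply HM. lia. apply Rmax_l. }
    destruct (P N) as [M HM]. exists (Rmax M (l0 + 1)). intros n.
    destruct (Nat.lt_ge_cases n N). apply Rle_trans with M; auto. apply Rmax_l.
    apply Rle_trans with (l0 + 1)%R. 2: apply Rmax_r.
    specialize (HN n H0). apply Rabs_def2 in HN. lra. }
  destruct B as [M HM]. exists M. intros k. specialize (HM k).
  now rewrite Cmod_mult, Cmod_pow in HM.
Qed.

Lemma geom_bounded_le a r M r1 : (0 <= r1 <= r)%R -> geom_bounded a r M -> geom_bounded a r1 M.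
Proof.
  intros Hr H k. apply Rle_trans with (2 := H k).
  apply Rmult_le_compat_l. apply Cmod_ge_0. now apply pow_incr.
Qed.

(** The derivative is a power series as well, hence continuous.  The radii [r1]
    and [r2] leave room to lose a little at each differentiation. *)
Lemma ps_hol a r M (F : C -> C) : (0 < r)%R -> geom_bounded a r M ->
  (forall z, (Cmod z < r)%R -> csum a z (F z)) -> forall z, (Cmod z < r)%R -> hol F z.
Proof.
  intros Hr HM HF z Hz.
  set (r1 := ((Cmod z + 2 * r) / 3)%R). set (r2 := ((2 * Cmod z + r) / 3)%R).
  assert (Z := Cmod_ge_0 z).
  assert (R1 : (0 < r1 < r)%R) by (unfold r1; lra).
  assert (R2 : (0 < r2 < r1)%R) by (unfold r1, r2; lra).
  assert (B1 := geom_bounded_dcoef _ _ _ _ R1 HM).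
  assert (B2 := geom_bounded_dcoef _ _ _ _ R2 B1).
  assert (C1 : exists G, forall w, (Cmod w < r1)%R -> csum (dcoef a) w (G w)).
  { exists (fun w => epsilon (inhabits (RtoC 0)) (csum (dcoef a) w)).
    intros w Hw. apply epsilon_spec. eapply ps_conv with (2 := B1); auto. unfold r1; lra. }
  destruct C1 as [G HG].
  assert (C2 : exists G2, forall w, (Cmod w < r2)%R -> csum (dcoef (dcoef a)) w (G2 w)).
  { exists (fun w => epsilon (inhabits (RtoC 0)) (csum (dcoef (dcoef a)) w)).
    intros w Hw. apply epsilon_spec. eapply ps_conv with (2 := B2); auto. unfold r2; lra. }
  destruct C2 as [G2 HG2].
  exists G. apply nearC_disk. exists ((r - Cmod z) / 3)%R. split. lra.
  intros w Hw.
  assert (Hw' : (Cmod w < r2)%R).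
  { replace w with (z + (w - z)) by ring. assert (T := Cmod_triangle z (w - z)). unfold r2; lra. }
  split.
  - apply (ps_cder a r1 M F G).
    + unfold r1; lra.
    + apply geom_bounded_le with r; auto. unfold r1; lra.
    + intros v Hv. apply HF. unfold r1 in Hv. lra.
    + exact HG.
    + unfold r1; unfold r2 in Hw'; lra.
  - apply cder_cont with (G2 w).
    apply (ps_cder (dcoef a) r2 (M / (r - r1)) G G2); auto.
    + unfold r2; lra.
    + apply geom_bounded_le with r1; auto. unfold r1, r2; lra.
    + intros v Hv. apply HG. unfold r1; unfold r2 in Hv. lra.
Qed.

Lemma has_expansion_csum f z0 a : has_expansion f z0 a <->
  exists r, (0 < r)%R /\ forall h, (Cmod h < r)%R -> csum a h (f (z0 + h)).
Proof.
  split; intros [r [Hr H]]; exists r; split; auto; intros w Hw.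
  - apply is_pseries_csum. specialize (H (z0 + w)).
    replace (z0 + w - z0) with w in H by ring. auto.
  - apply is_pseries_csum. specialize (H (w - z0) Hw).
    replace (z0 + (w - z0)) with w in H by ring. auto.
Qed.

(** Convergence at one point of modulus [s] between [|z|] and [r] bounds the
    coefficients geometrically, which gives holomorphy within the radius [s]. *)
Lemma csum_hol a r (F : C -> C) : (0 < r)%R ->
  (forall h, (Cmod h < r)%R -> csum a h (F h)) ->
  forall z, (Cmod z < r)%R -> hol F z.
Proof.
  intros Hr H z Hz. assert (Z := Cmod_ge_0 z).
  set (s := ((Cmod z + r) / 2)%R). assert (Hs : (0 < s)%R) by (unfold s; lra).
  assert (Es : Cmod (RtoC s) = s) by (rewrite Cmod_R; apply Rabs_pos_eq; lra).
  destruct (csum_geom_bounded a (RtoC s) (F (RtoC s))) as [M HM].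
  - apply H. rewrite Es. unfold s; lra.
  - intros E. apply RtoC_inj in E. lra.
  - rewrite Es in HM. apply (ps_hol a s M F); auto.
    + intros w Hw. apply H. unfold s in Hw; lra.
    + unfold s; lra.
Qed.

Lemma hol_shift f z0 h : hol f (z0 + h) <-> hol (fun w => f (z0 + w)) h.
Proof.
  split; intros H.
  - apply hol_comp with (g := fun w => z0 + w); auto. apply hol_plus. apply hol_const. apply hol_id.
  - apply hol_ext with (fun w => (fun v => f (z0 + v)) (w - z0)).
    { intros w. f_equal. ring. }
    apply hol_comp with (g := fun w => w - z0) (f := fun v => f (z0 + v)).
    + apply hol_minus. apply hol_id. apply hol_const.
    + replace (z0 + h - z0) with h by ring. exact H.
Qed.

Lemma has_expansion_hol f z0 a : has_expansion f z0 a -> hol f z0.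
Proof.
  intros H. apply has_expansion_csum in H. destruct H as [r [Hr H]].
  replace z0 with (z0 + 0) by ring. apply hol_shift.
  apply (csum_hol a r); auto. rewrite Cmod_0; auto.
Qed.

(** * Paths and circle means *)

Ltac rring := lazymatch goal with |- @eq _ ?a ?b => change (@eq R a b) end; ring.

Notation contR g t := (@continuous R_UniformSpace C_UniformSpace g t).

Definition path_der (g : R -> C) (t : R) (v : C) : Prop :=
  is_derive (fun s => Re (g s)) t (Re v) /\ is_derive (fun s => Im (g s)) t (Im v).

(** Caratheodory's form of the real derivative, to match [cder]. *)
Lemma is_derive_slope (x : R -> R) (t l : R) :
  is_derive x t l <-> exists p : R -> R,
    continuous p t /\ p t = l /\ forall s, (x s = x t + p s * (s - t))%R.
Proof.
  split.
  - intros H. apply is_derive_Reals in H.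
    exists (fun s => if Req_dec_T s t then l else ((x s - x t) / (s - t))%R).
    split; [|split].
    + apply filterlim_locally. intros e. destruct (H e (cond_pos e)) as [d Hd].
      exists d. intros s Hs. destruct (Req_dec_T t t) as [_|]; [|congruence].
      destruct (Req_dec_T s t) as [->|N]. apply ball_center.
      change (Rabs (s - t) < d)%R in Hs.
      specialize (Hd (s - t)%R ltac:(lra) Hs).
      assert (Es : forall x y : R, (x + (y - x))%R = y) by (intros; ring). rewrite Es in Hd. exact Hd.
    + destruct (Req_dec_T t t); congruence.
    + intros s. destruct (Req_dec_T s t) as [->|N]. rring. change (x s = x t + (x s - x t) / (s - t) * (s - t))%R. field. lra.
  - intros [p [Hp [<- E]]]. apply is_derive_Reals. intros e He.
    assert (Hp' := proj1 (filterlim_locally p (p t)) Hp). clear Hp; rename Hp' into Hp. destruct (Hp (mkposreal e He)) as [d Hd].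
    exists d. intros h Hh Hhd.
    assert (B : ball t d (t + h)%R).
    { change (Rabs (t + h - t) < d)%R. replace (t + h - t)%R with h by ring. auto. }
    apply Hd in B. change (Rabs (p (t + h)%R - p t) < e)%R in B.
    rewrite (E (t + h)%R).
    replace ((x t + p (t + h) * (t + h - t) - x t) / h - p t)%R with (p (t + h) - p t)%R
      by (field; auto). exact B.
Qed.

Lemma path_der_slope (g : R -> C) (t : R) (v : C) :
  path_der g t v <-> exists p : R -> C,
    contR p t /\ p t = v /\ forall s, g s = g t + p s * RtoC (s - t).
Proof.
  split.
  - intros [H1 H2]. apply is_derive_slope in H1, H2.
    destruct H1 as [p [Hp [Ep E]]], H2 as [q [Hq [Eq E']]].
    exists (fun s => (p s, q s)). split; [|split].
    + now apply cont_pair.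
    + rewrite Ep, Eq. symmetry. apply surjective_pairing.
    + intros s. apply injective_projections.
      * etransitivity. apply (E s). unfold Re. simpl. ring.
      * etransitivity. apply (E' s). unfold Im. simpl. ring.
  - intros [p [Hp [<- E]]]. split; apply is_derive_slope.
    + exists (fun s => Re (p s)). split; [|split]; auto.
      * now apply cont_Re.
      * intros s. rewrite (E s). unfold Re. simpl. ring.
    + exists (fun s => Im (p s)). split; [|split]; auto.
      * now apply cont_Im.
      * intros s. rewrite (E s). unfold Im. simpl. ring.
Qed.

Lemma path_der_cont g t v : path_der g t v -> contR g t.
Proof.
  intros H. apply path_der_slope in H. destruct H as [p [Hp [_ E]]].
  apply (continuous_ext (fun s => g t + p s * RtoC (s - t))). { intros; now rewrite <- E. }
  apply cont_plus; [apply cont_const|]. apply cont_mult; auto.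
  apply cont_pair; simpl. 2: apply continuous_const.
  apply (continuous_minus (V := R_NormedModule)). apply continuous_id. apply continuous_const.
Qed.

(** Chain rule along a path: both slopes are continuous, so they multiply. *)
Lemma path_der_comp f g t v l : path_der g t v -> cder f (g t) l -> path_der (fun s => f (g s)) t (l * v).
Proof.
  intros Hg [p [Hp [<- E]]]. assert (Cg := path_der_cont _ _ _ Hg).
  apply path_der_slope in Hg. destruct Hg as [q [Hq [<- E']]].
  apply path_der_slope. exists (fun s => p (g s) * q s). split; [|split]; auto.
  - apply cont_mult; auto. now apply cont_comp.
  - intros s. rewrite (E (g s)). rewrite (E' s) at 2. ring.
Qed.

Lemma path_der_line (z v : C) t : path_der (fun s => z + RtoC s * v) t v.
Proof.
  split; unfold Re, Im; simpl; auto_derive; auto; ring.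
Qed.

Lemma cder_0_const f (R0 : R) : (forall z, (Cmod z < R0)%R -> cder f z 0) ->
  forall z, (Cmod z < R0)%R -> f z = f 0.
Proof.
  intros H z Hz.
  assert (P : forall t, (0 <= t <= 1)%R -> path_der (fun s => f (0 + RtoC s * z)) t 0).
  { intros t Ht. assert (X := path_der_comp f (fun s => 0 + RtoC s * z) t z 0 (path_der_line 0 z t)).
    rewrite Cmult_0_l in X. apply X, H. clear X.
    rewrite Cplus_0_l, Cmod_mult, Cmod_R, Rabs_pos_eq by lra.
    assert (X := Cmod_ge_0 z). nra. }
  assert (E1 := eq_is_derive (fun s => Re (f (0 + RtoC s * z))) 0 1
    (fun t Ht => proj1 (P t Ht)) Rlt_0_1).
  assert (E2 := eq_is_derive (fun s => Im (f (0 + RtoC s * z))) 0 1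
    (fun t Ht => proj2 (P t Ht)) Rlt_0_1).
  assert (E : f (0 + RtoC 0 * z) = f (0 + RtoC 1 * z)) by (apply injective_projections; assumption).
  replace (0 + RtoC 0 * z) with (RtoC 0) in E by ring.
  replace (0 + RtoC 1 * z) with z in E by ring. auto.
Qed.

Definition circ (r t : R) : C := (r * cos t, r * sin t)%R.

Lemma Cmod_circ r t : (0 <= r)%R -> Cmod (circ r t) = r.
Proof.
  intros Hr. unfold Cmod, circ; simpl.
  replace (r * cos t * (r * cos t * 1) + r * sin t * (r * sin t * 1))%R
    with (r * r * (Rsqr (sin t) + Rsqr (cos t)))%R by (unfold Rsqr; ring).
  rewrite sin2_cos2, Rmult_1_r. now apply sqrt_square.
Qed.

Lemma path_der_circ r t : path_der (circ r) t (Ci * circ r t).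
Proof.
  split; unfold Re, Im, circ; simpl; auto_derive; auto; ring.
Qed.

Lemma circ_2PI r : circ r (2 * PI) = circ r 0.
Proof. unfold circ. now rewrite cos_2PI, sin_2PI, cos_0, sin_0. Qed.

Definition mean (r : R) (F : C -> C) : C :=
  (RInt (fun t => Re (F (circ r t))) 0 (2 * PI) / (2 * PI),
   RInt (fun t => Im (F (circ r t))) 0 (2 * PI) / (2 * PI))%R.

(** Continuity at the points of the circle in all directions, not only along it:
    this is what composing with holomorphic functions gives. *)
Definition circle_cont (r : R) (F : C -> C) : Prop := forall z, Cmod z = r -> contC F z.

Section circle_means.
Variable r : R.
Hypothesis Hr : (0 <= r)%R.

Lemma PI2_pos : (0 < 2 * PI)%R.
Proof. generalize PI_RGT_0; lra. Qed.

Lemma circle_cont_path F t : circle_cont r F -> contR (fun s => F (circ r s)) t.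
Proof.
  intros H. apply cont_comp with (F := F). exact (path_der_cont _ _ _ (path_der_circ r t)).
  apply H. now apply Cmod_circ.
Qed.

Lemma circle_cont_Re F : circle_cont r F -> ex_RInt (fun t => Re (F (circ r t))) 0 (2 * PI).
Proof.
  intros H. apply (ex_RInt_continuous (V := R_CompleteNormedModule)). intros t _.
  apply (cont_Re (fun s => F (circ r s))). now apply circle_cont_path.
Qed.

Lemma circle_cont_Im F : circle_cont r F -> ex_RInt (fun t => Im (F (circ r t))) 0 (2 * PI).
Proof.
  intros H. apply (ex_RInt_continuous (V := R_CompleteNormedModule)). intros t _.
  apply (cont_Im (fun s => F (circ r s))). now apply circle_cont_path.
Qed.

Lemma mean_ext F G : (forall z, Cmod z = r -> F z = G z) -> mean r F = mean r G.
Proof.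
  intros H. unfold mean. f_equal; f_equal; apply RInt_ext; intros t _;
    rewrite H; auto; now apply Cmod_circ.
Qed.

Lemma mean_const c : mean r (fun _ => c) = c.
Proof.
  unfold mean. rewrite !RInt_const. assert (P := PI2_pos).
  apply injective_projections; simpl; unfold scal; simpl; unfold mult; simpl; unfold Re, Im; field; lra.
Qed.

Lemma mean_plus F G : circle_cont r F -> circle_cont r G ->
  mean r (fun z => F z + G z) = mean r F + mean r G.
Proof.
  intros HF HG. assert (P := PI2_pos). unfold mean. apply injective_projections; simpl.
  - rewrite <- Rdiv_plus_distr. f_equal.
    apply (RInt_plus (V := R_CompleteNormedModule) (fun t => Re (F (circ r t))) (fun t => Re (G (circ r t))));
    now apply circle_cont_Re.
  - rewrite <- Rdiv_plus_distr. f_equal.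
    apply (RInt_plus (V := R_CompleteNormedModule) (fun t => Im (F (circ r t))) (fun t => Im (G (circ r t))));
    now apply circle_cont_Im.
Qed.

Lemma mean_scal c F : circle_cont r F -> mean r (fun z => c * F z) = c * mean r F.
Proof.
  intros HF. assert (P := PI2_pos).
  assert (L : forall (a b : R) (u v : R -> R), ex_RInt u 0 (2 * PI) -> ex_RInt v 0 (2 * PI) ->
    RInt (fun t => a * u t + b * v t)%R 0 (2 * PI) =
    (a * RInt u 0 (2 * PI) + b * RInt v 0 (2 * PI))%R).
  { intros a b u v Hu Hv.
    rewrite <- (RInt_scal (V := R_CompleteNormedModule) u) by auto.
    rewrite <- (RInt_scal (V := R_CompleteNormedModule) v) by auto.
    apply (RInt_plus (V := R_CompleteNormedModule) (fun t => scal a (u t)) (fun t => scal b (v t)));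
    apply (ex_RInt_scal (V := R_NormedModule)); auto. }
  assert (H1 := circle_cont_Re _ HF). assert (H2 := circle_cont_Im _ HF).
  unfold mean. apply injective_projections; simpl.
  - rewrite (RInt_ext _ (fun t => Re c * Re (F (circ r t)) + (- Im c) * Im (F (circ r t)))%R).
    2: { intros t _. unfold Re, Im; simpl. ring. }
    rewrite L by auto. unfold Re, Im. field. apply PI_neq0.
  - rewrite (RInt_ext _ (fun t => Im c * Re (F (circ r t)) + Re c * Im (F (circ r t)))%R).
    2: { intros t _. unfold Re, Im; simpl. ring. }
    rewrite L by auto. unfold Re, Im. field. apply PI_neq0.
Qed.

Lemma RInt_bound (u : R -> R) (M : R) : ex_RInt u 0 (2 * PI) ->
  (forall t, (Rabs (u t) <= M)%R) -> (Rabs (RInt u 0 (2 * PI) / (2 * PI)) <= M)%R.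
Proof.
  intros Hu H. assert (P := PI2_pos).
  assert (B := abs_RInt_le_const u 0 (2 * PI) M ltac:(lra) Hu (fun t _ => H t)).
  rewrite Rabs_div, (Rabs_pos_eq (2 * PI)) by lra.
  apply Rmult_le_reg_r with (2 * PI)%R; auto. unfold Rdiv. rewrite Rmult_assoc, Rinv_l by lra. lra.
Qed.

(** The factor [2] comes from bounding the two coordinates separately; every
    application absorbs constants. *)
Lemma mean_bound F M : circle_cont r F -> (forall z, Cmod z = r -> (Cmod (F z) <= M)%R) ->
  (Cmod (mean r F) <= 2 * M)%R.
Proof.
  intros HF H.
  assert (HM : forall t, (Cmod (F (circ r t)) <= M)%R) by (intros; apply H; now apply Cmod_circ).
  assert (B1 := RInt_bound _ M (circle_cont_Re _ HF) (fun t => Rle_trans _ _ _ (re_le_Cmod _) (HM t))).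
  assert (B2 := RInt_bound _ M (circle_cont_Im _ HF)
    (fun t => Rle_trans _ _ _ (Rle_trans _ _ _ (Rmax_r _ _) (Rmax_Cmod _)) (HM t))).
  unfold mean.
  set (x := (RInt (fun t => Re (F (circ r t))) 0 (2 * PI) / (2 * PI))%R) in *.
  set (y := (RInt (fun t => Im (F (circ r t))) 0 (2 * PI) / (2 * PI))%R) in *.
  replace ((x, y) : C) with (RtoC x + Ci * RtoC y)
    by (unfold Ci; apply injective_projections; simpl; ring).
  apply Rle_trans with (1 := Cmod_triangle _ _). rewrite Cmod_mult, Cmod_Ci, !Cmod_R. lra.
Qed.

(** [z * g' z] is, up to the factor [i], the derivative of [g] along the closed
    circle. *)
Lemma mean_deriv g g' : (forall z, Cmod z = r -> cder g z (g' z)) -> circle_cont r g' ->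
  mean r (fun z => g' z * z) = 0.
Proof.
  intros Hg Hc.
  assert (D : forall t, path_der (fun s => g (circ r s)) t (g' (circ r t) * (Ci * circ r t))).
  { intros t. apply path_der_comp. apply path_der_circ. apply Hg. now apply Cmod_circ. }
  assert (K : circle_cont r (fun z => g' z * (Ci * z))).
  { intros z Hz. apply cont_mult. now apply Hc. apply cont_mult. apply cont_const. apply contC_id. }
  assert (I1 : RInt (fun t => Re (g' (circ r t) * (Ci * circ r t))) 0 (2 * PI) = 0%R).
  { apply (is_RInt_unique (V := R_CompleteNormedModule)).
    replace 0%R with (minus (Re (g (circ r (2 * PI)))) (Re (g (circ r 0)))) at 2
      by (rewrite circ_2PI; apply (minus_eq_zero (G := R_AbelianGroup))).
    apply (is_RInt_derive (V := R_CompleteNormedModule) (fun s => Re (g (circ r s)))).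
    - intros t _. apply (D t).
    - intros t _. apply (cont_Re (fun s => g' (circ r s) * (Ci * circ r s))).
      exact (circle_cont_path _ t K). }
  assert (I2 : RInt (fun t => Im (g' (circ r t) * (Ci * circ r t))) 0 (2 * PI) = 0%R).
  { apply (is_RInt_unique (V := R_CompleteNormedModule)).
    replace 0%R with (minus (Im (g (circ r (2 * PI)))) (Im (g (circ r 0)))) at 2
      by (rewrite circ_2PI; apply (minus_eq_zero (G := R_AbelianGroup))).
    apply (is_RInt_derive (V := R_CompleteNormedModule) (fun s => Im (g (circ r s)))).
    - intros t _. apply (D t).
    - intros t _. apply (cont_Im (fun s => g' (circ r s) * (Ci * circ r s))).
      exact (circle_cont_path _ t K). }
  assert (M0 : mean r (fun z => g' z * (Ci * z)) = 0).
  { unfold mean. rewrite I1, I2. unfold Rdiv. rewrite Rmult_0_l. reflexivity. }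
  rewrite (mean_ext _ (fun z => - Ci * (g' z * (Ci * z)))).
  2: { intros z _. replace (- Ci * (g' z * (Ci * z))) with (- (Ci * Ci) * (g' z * z)) by ring.
       assert (Ci * Ci = - (1)) as -> by (unfold Ci; apply injective_projections; simpl; ring). ring. }
  rewrite mean_scal by auto. rewrite M0. ring.
Qed.

End circle_means.

Lemma circle_cont_plus r F G : circle_cont r F -> circle_cont r G -> circle_cont r (fun z => F z + G z).
Proof. intros H K z Hz. apply cont_plus; auto. Qed.
Lemma circle_cont_mult r F G : circle_cont r F -> circle_cont r G -> circle_cont r (fun z => F z * G z).
Proof. intros H K z Hz. apply cont_mult; auto. Qed.
Lemma circle_cont_const r c : circle_cont r (fun _ => c).
Proof. intros z Hz. apply cont_const. Qed.
Lemma circle_cont_id r : circle_cont r (fun z => z).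
Proof. intros z Hz. apply contC_id. Qed.
Lemma circle_cont_minus r F G : circle_cont r F -> circle_cont r G -> circle_cont r (fun z => F z - G z).
Proof. intros H K z Hz. apply cont_minus; auto. Qed.
Lemma circle_cont_inv r F : circle_cont r F -> (forall z, Cmod z = r -> F z <> 0) -> circle_cont r (fun z => / F z).
Proof. intros H K z Hz. apply cont_inv; auto. Qed.
Lemma circle_cont_div r F G : circle_cont r F -> circle_cont r G -> (forall z, Cmod z = r -> G z <> 0) ->
  circle_cont r (fun z => F z / G z).
Proof. intros H K N z Hz. apply cont_div; auto. Qed.
Lemma circle_cont_pow r F n : circle_cont r F -> circle_cont r (fun z => F z ^ n).
Proof.
  intros H. induction n. apply (circle_cont_const r 1). apply (circle_cont_mult r F (fun z => F z ^ n)); auto.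
Qed.

Lemma circ_onto r z : (0 <= r)%R -> Cmod z = r ->
  exists t, (- PI <= t <= PI)%R /\ z = circ r t.
Proof.
  intros Hr Hz. destruct (Req_dec_T r 0) as [->|Hn].
  { exists 0%R. split. generalize PI_RGT_0; lra. apply Cmod_eq_0 in Hz. subst.
    unfold circ. rewrite !Rmult_0_l. reflexivity. }
  destruct z as [x y].
  assert (E : (x * x + y * y = r * r)%R).
  { assert (X := Cmod2_alt (x, y)). rewrite Hz in X. unfold Re, Im in X; simpl in X. lra. }
  assert (E1 : ((x / r) * (x / r) + (y / r) * (y / r) = 1)%R).
  { replace ((x / r) * (x / r) + (y / r) * (y / r))%R with ((x * x + y * y) / (r * r))%R by (field; auto).
    rewrite E. field; auto. }
  assert (B : (-1 <= x / r <= 1)%R) by nra.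
  assert (A := acos_bound (x / r)).
  assert (Sq : sin (acos (x / r)) = Rabs (y / r)).
  { rewrite sin_acos by auto. rewrite <- sqrt_Rsqr_abs. f_equal. unfold Rsqr. lra. }
  destruct (Rle_dec 0 (y / r)) as [P|P].
  - exists (acos (x / r)). split. lra. unfold circ. rewrite cos_acos, Sq, Rabs_pos_eq by auto.
    f_equal; field; auto.
  - exists (- acos (x / r))%R. split. lra. unfold circ. rewrite cos_neg, sin_neg, cos_acos, Sq, Rabs_left by lra.
    f_equal; field; auto.
Qed.

Lemma cont_Cmod (T : UniformSpace) (F : T -> C) x :
  @continuous T C_UniformSpace F x -> continuous (fun y => Cmod (F y)) x.
Proof.
  intros H. assert (H1 := cont_Re _ _ H). assert (H2 := cont_Im _ _ H).
  apply (continuous_ext (fun y => sqrt (Re (F y) * Re (F y) + Im (F y) * Im (F y))%R)).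
  { intros y. unfold Cmod, Re, Im. f_equal. rring. }
  apply (continuous_comp (fun y => (Re (F y) * Re (F y) + Im (F y) * Im (F y))%R) sqrt).
  - apply (continuous_plus (V := R_NormedModule)); apply (continuous_mult (K := R_AbsRing)); auto.
  - apply continuous_sqrt.
Qed.

Lemma circle_cont_max r F : (0 <= r)%R -> circle_cont r F ->
  exists A, (0 < A)%R /\ forall z, Cmod z = r -> (Cmod (F z) <= A)%R.
Proof.
  intros Hr HF.
  destruct (continuity_ab_maj (fun t => Cmod (F (circ r t))) (- PI) PI) as [t0 [H0 _]].
  - generalize PI_RGT_0; lra.
  - intros t _. apply continuity_pt_filterlim.
    apply (cont_Cmod _ (fun s => F (circ r s))). now apply circle_cont_path.
  - exists (Cmod (F (circ r t0)) + 1)%R. split. generalize (Cmod_ge_0 (F (circ r t0))); lra.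
    intros z Hz. destruct (circ_onto r z Hr Hz) as [t [Ht ->]]. specialize (H0 t Ht). lra.
Qed.

Lemma circle_cont_min r F : (0 <= r)%R -> circle_cont r F -> (forall z, Cmod z = r -> F z <> 0) ->
  exists m, (0 < m)%R /\ forall z, Cmod z = r -> (m <= Cmod (F z))%R.
Proof.
  intros Hr HF H0. destruct (circle_cont_max r (fun z => / F z) Hr) as [A [HA H]].
  { now apply circle_cont_inv. }
  exists (/ A)%R. split. now apply Rinv_0_lt_compat.
  intros z Hz. specialize (H z Hz). rewrite Cmod_inv in H by auto.
  assert (P : (0 < Cmod (F z))%R) by now apply Cmod_gt_0, H0.
  rewrite <- (Rinv_inv (Cmod (F z))). apply Rinv_le_contravar; auto.
  now apply Rinv_0_lt_compat.
Qed.

(** Expand [1 / (b - w)] into a geometric series; the remainder after [n] terms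
    is [O((|w| / m) ^ n)] uniformly on the circle. *)
Lemma cauchy_transform r a b (m : R) : (0 <= r)%R -> (0 < m)%R -> circle_cont r a -> circle_cont r b ->
  (forall z, Cmod z = r -> (m <= Cmod (b z))%R) ->
  forall w, (Cmod w < m)%R ->
    csum (fun k => mean r (fun z => a z / b z ^ S k)) w (mean r (fun z => a z / (b z - w))).
Proof.
  intros Hr Hm Ha Hb Hbm w Hw.
  destruct (circle_cont_max r a Hr Ha) as [A [HA HAm]].
  assert (W := Cmod_ge_0 w).
  assert (D : forall z, Cmod z = r -> (m - Cmod w <= Cmod (b z - w))%R).
  { intros z Hz. specialize (Hbm z Hz). replace (b z) with ((b z - w) + w) in Hbm by ring.
    assert (T := Cmod_triangle (b z - w) w). lra. }
  assert (Nb : forall z, Cmod z = r -> b z <> 0).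
  { intros z Hz. apply Cmod_gt_0. specialize (Hbm z Hz). lra. }
  assert (Nd : forall z, Cmod z = r -> b z - w <> 0).
  { intros z Hz. apply Cmod_gt_0. specialize (D z Hz). lra. }
  assert (Np : forall n z, Cmod z = r -> b z ^ n <> 0).
  { intros n z Hz. apply Cpow_nz; auto. }
  assert (Cd : circle_cont r (fun z => b z - w)) by (apply circle_cont_minus; auto; apply circle_cont_const).
  assert (C1 : forall n, circle_cont r (fun z => a z / b z ^ n)).
  { intros n. apply circle_cont_div; auto. now apply circle_cont_pow. }
  assert (C2 : forall n, circle_cont r (fun z => a z / b z ^ n / (b z - w))).
  { intros n. apply circle_cont_div; auto. }
  assert (E : forall n, mean r (fun z => a z / (b z - w)) =
    psum (fun k => mean r (fun z => a z / b z ^ S k)) w n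
    + w ^ n * mean r (fun z => a z / b z ^ n / (b z - w))).
  { induction n.
    - cbn [psum]. rewrite Cplus_0_l. simpl. rewrite Cmult_1_l. apply mean_ext; auto.
      intros z Hz. field. auto.
    - rewrite IHn. cbn [psum].
      rewrite (mean_ext r Hr (fun z => a z / b z ^ n / (b z - w))
        (fun z => a z / b z ^ S n + w * (a z / b z ^ S n / (b z - w)))).
      2: { intros z Hz. simpl. specialize (Np n z Hz). field. auto. }
      rewrite mean_plus, mean_scal; auto.
      + simpl. ring.
      + apply circle_cont_mult; auto. apply circle_cont_const. }
  set (q := (Cmod w / m)%R).
  assert (Hq : (0 <= q < 1)%R).
  { unfold q; split. apply Rmult_le_pos; auto. now apply Rlt_le, Rinv_0_lt_compat.
    apply Rmult_lt_reg_r with m; auto. unfold Rdiv. rewrite Rmult_assoc, Rinv_l; lra. }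
  apply clim_le with (fun n => 2 * (A / (m - Cmod w)) * q ^ n)%R.
  - intros n. rewrite (E n).
    match goal with |- (Cmod (?x - (?x + ?y)) <= _)%R => replace (x - (x + y)) with (- y) by ring end.
    rewrite Cmod_opp, Cmod_mult, Cmod_pow.
    assert (B : (Cmod (mean r (fun z => (a z / b z ^ n / (b z - w))%C)) <= 2 * (A / m ^ n / (m - Cmod w)))%R).
    { apply mean_bound; auto. intros z Hz.
      rewrite !Cmod_div, Cmod_pow; auto.
      specialize (D z Hz). specialize (Hbm z Hz). specialize (HAm z Hz).
      assert (P := pow_lt m n Hm). assert (P2 := pow_incr m (Cmod (b z)) n ltac:(lra)).
      unfold Rdiv. apply Rmult_le_compat.
      - apply Rmult_le_pos. apply Cmod_ge_0. apply Rlt_le, Rinv_0_lt_compat. lra.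
      - apply Rlt_le, Rinv_0_lt_compat. lra.
      - apply Rmult_le_compat; auto. apply Cmod_ge_0. apply Rlt_le, Rinv_0_lt_compat. lra.
        apply Rinv_le_contravar; lra.
      - apply Rinv_le_contravar; lra. }
    apply Rle_trans with (1 := Rmult_le_compat_l _ _ _ (pow_le _ n W) B).
    apply Req_le. unfold q, Rdiv. rewrite Rpow_mult_distr, pow_inv. field.
    split. apply pow_nonzero. lra. lra.
  - replace (Finite 0%R) with (Rbar_mult (2 * (A / (m - Cmod w)))%R 0%R) by (simpl; f_equal; ring).
    apply is_lim_seq_scal_l. apply is_lim_seq_geom. rewrite Rabs_pos_eq; lra.
Qed.

(** * Cauchy's formula *)

Definition hol_disk (R0 : R) (f : C -> C) : Prop := forall z, (Cmod z < R0)%R -> hol f z.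

Lemma circ_neq r z w : (Cmod w < r)%R -> Cmod z = r -> z - w <> 0.
Proof.
  intros Hw Hz E. replace z with (z - w + w) in Hz by ring.
  rewrite E, Cplus_0_l in Hz. lra.
Qed.

(** In the geometric expansion of [x / (x - z)] only the constant term has a mean:
    for [k >= 1], [x ^ (- k)] is, up to a constant, [x] times its own derivative. *)
Lemma mean_cauchy_kernel r z : (Cmod z < r)%R -> mean r (fun x => x / (x - z)) = 1.
Proof.
  intros Hz. assert (Z := Cmod_ge_0 z). assert (Hr : (0 < r)%R) by lra.
  assert (N : forall x, Cmod x = r -> x <> 0).
  { intros x Hx. apply Cmod_gt_0. lra. }
  assert (K := cauchy_transform r (fun x => x) (fun x => x) r ltac:(lra) Hr (circle_cont_id r) (circle_cont_id r)
    (fun x Hx => Req_le _ _ (eq_sym Hx)) z Hz).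
  cbv beta in K.
  apply clim_unique with (1 := K). apply clim_decr.
  apply clim_ext with (fun _ => RtoC 1). 2: apply clim_const.
  assert (M0 : mean r (fun x => x / x ^ 1) = 1).
  { rewrite (mean_ext r ltac:(lra) _ (fun _ => 1)). apply mean_const.
    intros x Hx. simpl. field. auto. }
  assert (MS : forall k, mean r (fun x => x / x ^ S (S k)) = 0).
  { intros k. rewrite (mean_ext r ltac:(lra) _
      (fun x => (- / RtoC (INR (S k)) * - (RtoC (INR (S k)) / (x ^ S k * x))) * x)).
    2: { intros x Hx. simpl. assert (x ^ k <> 0) by (apply Cpow_nz; auto).
         assert (RtoC (INR (S k)) <> 0).
         { intros E. apply RtoC_inj in E. revert E. apply not_0_INR. lia. }
         change (match k with O => 1 | S _ => INR k + 1 end)%R with (INR (S k)).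
         field. auto. }
    assert (HD : forall j x, Cmod x = r -> cder (fun y => / y ^ S j) x (- (RtoC (INR (S j)) / (x ^ S j * x)))).
    { intros j x Hx. assert (X0 := N x Hx). induction j.
      - replace (- (RtoC (INR 1) / (x ^ 1 * x))) with (- (1 / (x * x))) by (simpl; field; auto).
        apply cder_ext_loc with (fun y => / y).
        + assert (X1 : forall y : C, / y = / y ^ 1) by (intros; f_equal; simpl; ring).
          apply filter_forall. exact X1.
        + apply (cder_inv (fun y => y)); auto. apply cder_id.
      - apply cder_ext_loc with (fun y => / y * / y ^ S j).
        + assert (Nn := cont_neq _ _ _ (contC_id x) X0).
          revert Nn. apply filter_imp.
          assert (X1 : forall y : C, y <> 0 -> / y * / y ^ S j = / y ^ S (S j)).
          { intros y Hy. simpl. assert (y ^ j <> 0) by (now apply Cpow_nz). field. auto. }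
          exact X1.
        + replace (- (RtoC (INR (S (S j))) / (x ^ S (S j) * x))) with
            (- (1 / (x * x)) * / x ^ S j + / x * (- (RtoC (INR (S j)) / (x ^ S j * x)))).
          apply (cder_mult (fun y => / y) (fun y => / y ^ S j)); auto.
          apply (cder_inv (fun y => y)); auto. apply cder_id.
          rewrite (S_INR (S j)), RtoC_plus. simpl. assert (x ^ j <> 0) by (now apply Cpow_nz).
          field. auto. }
    apply (mean_deriv r ltac:(lra) (fun y => - / RtoC (INR (S k)) * / y ^ S k)).
    - intros x Hx. 
      replace (- / RtoC (INR (S k)) * - (RtoC (INR (S k)) / (x ^ S k * x))) with
       (0 * / x ^ S k + - / RtoC (INR (S k)) * - (RtoC (INR (S k)) / (x ^ S k * x))) by ring.
      apply (cder_mult (fun _ => - / RtoC (INR (S k))) (fun y => / y ^ S k)). apply cder_const. auto.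
    - apply circle_cont_mult. apply circle_cont_const. 
      intros x Hx. apply cont_opp, cont_div. apply cont_const.
      apply (circle_cont_mult r (fun y => y ^ S k) (fun y => y)); auto. apply circle_cont_pow, circle_cont_id. apply circle_cont_id.
      apply Cmult_neq_0; auto. apply Cpow_nz; auto. }
  intros n. symmetry. induction n.
  - cbn [psum]. rewrite M0. simpl. ring.
  - change (psum ?a z (S (S n))) with (psum a z (S n) + a (S n) * z ^ S n).
    cbv beta. rewrite IHn, MS. ring.
Qed.

Lemma RInt_param_derive (u u' : R -> R -> R) (a b c s : R) :
  (a < s < b)%R ->
  (forall v t, (a < v < b)%R -> is_derive (fun w => u w t) v (u' v t)) ->
  (forall t, continuous (fun p : R * R => u' (fst p) (snd p)) (s, t)) ->
  (forall v, (a < v < b)%R -> ex_RInt (u v) 0 c) ->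
  is_derive (fun v => RInt (u v) 0 c) s (RInt (u' s) 0 c).
Proof.
  intros Hs Hu Hc Hi.
  assert (L : locally s (fun v => (a < v < b)%R)).
  { exists (mkposreal (Rmin (s - a) (b - s)) ltac:(apply Rmin_pos; lra)). intros v Hv.
    change (Rabs (v - s) < Rmin (s - a) (b - s))%R in Hv. apply Rabs_def2 in Hv.
    assert (X := Rmin_l (s - a) (b - s)). assert (Y := Rmin_r (s - a) (b - s)). split; lra. }
  rewrite <- (RInt_ext (fun t => Derive (fun w => u w t) s)).
  2: { intros t _. apply is_derive_unique, Hu, Hs. }
  apply (is_derive_RInt_param u 0 c s).
  - revert L. apply filter_imp. intros v Hv t _. exists (u' v t). now apply Hu.
  - intros t _. apply continuity_2d_pt_ext_loc with u'.
    + destruct L as [d Hd]. exists d. intros v t' Hv _. symmetry. apply is_derive_unique, Hu, Hd, Hv.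
    + apply continuity_2d_pt_filterlim. apply (Hc t).
  - revert L. apply filter_imp. intros v Hv. now apply Hi.
Qed.

(** Contract the circle to the point [z]: the mean of
    [f (z + s (x - z)) * x / (x - z)] over the circle does not depend on [s],
    because its [s]-derivative is the mean of a derivative along the circle.
    At [s = 1] this is the Cauchy integral, at [s = 0] it is [f z]. *)
Theorem cauchy_formula f R0 r z : hol_disk R0 f -> (r < R0)%R -> (Cmod z < r)%R ->
  mean r (fun x => f x * (x / (x - z))) = f z.
Proof.
  intros Hf Hr Hz. assert (Z := Cmod_ge_0 z).
  set (g := fun s x => z + RtoC s * (x - z)).
  (* For [s] in [(- eta, 1 + eta)] the contracted circle lies in the disk of radius
     [R0], because [(1 + 2 eta) r = R0]. *)
  set (eta := ((R0 - r) / (2 * r))%R).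
  assert (Heta : (0 < eta)%R) by (unfold eta; apply Rdiv_lt_0_compat; lra).
  assert (Hg : forall s x, (- eta < s < 1 + eta)%R -> Cmod x = r -> (Cmod (g s x) < R0)%R).
  { intros s x Hs Hx. unfold g.
    replace (z + RtoC s * (x - z)) with (RtoC (1 - s) * z + RtoC s * x) by (rewrite RtoC_minus; ring).
    apply Rle_lt_trans with (1 := Cmod_triangle _ _). rewrite !Cmod_mult, !Cmod_R, Hx.
    assert (A : (Rabs (1 - s) + Rabs s < 1 + 2 * eta)%R).
    { unfold Rabs. destruct (Rcase_abs (1 - s)), (Rcase_abs s); lra. }
    assert (B := Rabs_pos (1 - s)).
    assert (Hrr : ((1 + 2 * eta) * r = R0)%R) by (unfold eta; field; lra).
    apply Rle_lt_trans with ((Rabs (1 - s) + Rabs s) * r)%R. nra.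
    rewrite <- Hrr. apply Rmult_lt_compat_r; lra. }
  assert (Nx : forall x, Cmod x = r -> x - z <> 0) by (intros; now apply circ_neq with r).
  set (h := fun s x => f (g s x) * (x / (x - z))).
  assert (Ck : circle_cont r (fun x => x / (x - z))).
  { apply circle_cont_div; auto. apply circle_cont_id. apply circle_cont_minus. apply circle_cont_id. apply circle_cont_const. }
  assert (Cg : forall s, circle_cont r (g s)).
  { intros s. apply circle_cont_plus. apply circle_cont_const. apply circle_cont_mult. apply circle_cont_const.
    apply circle_cont_minus. apply circle_cont_id. apply circle_cont_const. }
  assert (Ch : forall s, (- eta < s < 1 + eta)%R -> circle_cont r (h s)).
  { intros s Hs. apply (circle_cont_mult r (fun x => f (g s x))); auto.
    intros x Hx. apply cont_comp. now apply Cg. apply hol_cont, Hf, Hg; auto. }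
  assert (D : forall s x, (- eta < s < 1 + eta)%R -> Cmod x = r ->
     path_der (fun u => h u x) s (deriv f (g s x) * x)).
  { intros s x Hs Hx.
    assert (P := path_der_comp (fun y => f y * (x / (x - z))) (fun u => g u x) s (x - z)
       (deriv f (g s x) * (x / (x - z))) (path_der_line z (x - z) s)).
    replace (deriv f (g s x) * (x / (x - z)) * (x - z)) with (deriv f (g s x) * x) in P
      by (field; auto).
    apply P.
    replace (deriv f (g s x) * (x / (x - z))) with
      (deriv f (g s x) * (x / (x - z)) + f (g s x) * 0) by ring.
    apply (cder_mult f (fun _ => x / (x - z))). apply hol_cder, Hf, Hg; auto. apply cder_const. }
  assert (M0 : forall s, (- eta < s < 1 + eta)%R -> mean r (fun x => deriv f (g s x) * x) = 0).
  { intros s Hs.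
    assert (Cd : circle_cont r (fun x => deriv f (g s x))).
    { intros x Hx. apply cont_comp. now apply Cg. apply hol_deriv_cont, Hf, Hg; auto. }
    destruct (Req_dec_T s 0) as [->|Hs0].
    (* [s = 0] is separate: there the path degenerates to a point. *)
    - rewrite (mean_ext r ltac:(lra) _ (fun x => deriv f z * (1 * x))).
      2: { intros x _. unfold g. replace (z + RtoC 0 * (x - z)) with z by ring. ring. }
      rewrite mean_scal by (first [lra | apply circle_cont_mult; [apply circle_cont_const|apply circle_cont_id]]).
      assert (X := mean_deriv r ltac:(lra) (fun y => y) (fun _ => 1) (fun x _ => cder_id x) (circle_cont_const r 1)).
      change (mean r (Cmult 1) = 0) in X. rewrite X. ring.
    - assert (Ns : RtoC s <> 0) by (intros E; apply RtoC_inj in E; auto).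
      rewrite (mean_ext r ltac:(lra) _ (fun x => / RtoC s * (deriv f (g s x) * RtoC s * x))).
      2: { intros x _. field. auto. }
      assert (Cd' : circle_cont r (fun x => deriv f (g s x) * RtoC s)).
      { apply circle_cont_mult; auto. apply circle_cont_const. }
      rewrite mean_scal by (first [lra | apply circle_cont_mult; [auto|apply circle_cont_id]]).
      rewrite (mean_deriv r ltac:(lra) (fun x => f (g s x)) (fun x => deriv f (g s x) * RtoC s)); auto.
      ring. intros x Hx. apply (cder_comp f (g s)).
      + exists (fun _ => RtoC s). split; [apply cont_const|]. split; auto. intros w. unfold g. ring.
      + apply hol_cder, Hf, Hg; auto. }
  assert (Cont : forall s t, (- eta < s < 1 + eta)%R ->
    @continuous (prod_UniformSpace R_UniformSpace R_UniformSpace) C_UniformSpace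
      (fun p => deriv f (g (fst p) (circ r (snd p))) * circ r (snd p)) (s, t)).
  { intros s t Hs.
    assert (C1 : @continuous (prod_UniformSpace R_UniformSpace R_UniformSpace) C_UniformSpace
      (fun p => circ r (snd p)) (s, t)).
    { apply (continuous_comp (fun p : R * R => snd p) (circ r)). apply continuous_snd.
      exact (path_der_cont _ _ _ (path_der_circ r t)). }
    apply cont_mult; auto. apply (cont_comp (deriv f)).
    - unfold g. apply cont_plus. apply cont_const. apply cont_mult.
      + apply cont_pair; simpl. apply continuous_fst. apply continuous_const.
      + apply cont_minus; auto. apply cont_const.
    - apply hol_deriv_cont, Hf, Hg; auto. apply Cmod_circ. lra. }
  assert (Hr0 : (0 <= r)%R) by lra.
  assert (Der : forall s, (0 <= s <= 1)%R -> path_der (fun v => mean r (h v)) s 0).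
  { intros s Hs. assert (Hs' : (- eta < s < 1 + eta)%R) by lra.
    assert (E0 := M0 s Hs'). unfold mean in E0.
    assert (P := PI2_pos).
    assert (Q : forall y : R, (y / (2 * PI) = 0 -> y = 0)%R).
    { intros y Hy. replace y with (y / (2 * PI) * (2 * PI))%R by (field; lra). rewrite Hy; ring. }
    assert (K : forall (u : R -> R) v, is_derive u v 0%R -> is_derive (fun y => u y / (2 * PI))%R v 0%R).
    { intros u v Hu. replace 0%R with (scal 0%R (/ (2 * PI))%R) by (apply Rmult_0_l).
      exact (is_derive_scal_l (K := R_AbsRing) (V := R_NormedModule) u v 0%R (/ (2 * PI))%R Hu). }
    split.
    - apply (K (fun v => RInt (fun t => Re (h v (circ r t))) 0 (2 * PI))).
      refine (eq_ind _ (fun l => is_derive (fun v => RInt (fun t => Re (h v (circ r t))) 0 (2 * PI)) s l)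
        _ _ (Q _ (f_equal Re E0))).
      apply (RInt_param_derive (fun v t => Re (h v (circ r t)))
        (fun v t => Re (deriv f (g v (circ r t)) * circ r t)) (- eta) (1 + eta)); auto.
      + intros v t Hv. apply (D v (circ r t) Hv). now apply Cmod_circ.
      + intros t. apply (cont_Re (fun p : R * R => deriv f (g (fst p) (circ r (snd p))) * circ r (snd p))).
        now apply Cont.
      + intros v Hv. apply circle_cont_Re; auto.
    - apply (K (fun v => RInt (fun t => Im (h v (circ r t))) 0 (2 * PI))).
      refine (eq_ind _ (fun l => is_derive (fun v => RInt (fun t => Im (h v (circ r t))) 0 (2 * PI)) s l)
        _ _ (Q _ (f_equal Im E0))).
      apply (RInt_param_derive (fun v t => Im (h v (circ r t)))
        (fun v t => Im (deriv f (g v (circ r t)) * circ r t)) (- eta) (1 + eta)); auto.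
      + intros v t Hv. apply (D v (circ r t) Hv). now apply Cmod_circ.
      + intros t. apply (cont_Im (fun p : R * R => deriv f (g (fst p) (circ r (snd p))) * circ r (snd p))).
        now apply Cont.
      + intros v Hv. apply circle_cont_Im; auto. }
  assert (E1 := eq_is_derive (fun s => Re (mean r (h s))) 0 1
    (fun t Ht => proj1 (Der t Ht)) Rlt_0_1).
  assert (E2 := eq_is_derive (fun s => Im (mean r (h s))) 0 1
    (fun t Ht => proj2 (Der t Ht)) Rlt_0_1).
  assert (E : mean r (h 0%R) = mean r (h 1%R)) by (apply injective_projections; assumption).
  transitivity (mean r (h 1%R)).
  { apply mean_ext; auto. intros x _. unfold h, g. f_equal. f_equal. ring. }
  rewrite <- E. transitivity (mean r (fun x => f z * (x / (x - z)))).
  { apply mean_ext; auto. intros x _. unfold h, g. f_equal. f_equal. ring. }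
  rewrite mean_scal by auto. rewrite mean_cauchy_kernel by auto. ring.
Qed.

Lemma hol_circle_cont r R0 f : (r < R0)%R -> hol_disk R0 f -> circle_cont r f.
Proof. intros Hr Hf z Hz. apply hol_cont, Hf. lra. Qed.

(** Cauchy's formula is a Cauchy transform in [z] with [b x = x]. *)
Theorem taylor f R0 r : hol_disk R0 f -> (0 < r < R0)%R ->
  exists a, forall z, (Cmod z < r)%R -> csum a z (f z).
Proof.
  intros Hf Hr. exists (fun k => mean r (fun x => f x * x / x ^ S k)). intros z Hz.
  rewrite <- (cauchy_formula f R0 r z Hf (proj2 Hr) Hz).
  assert (Cf : circle_cont r f) by (apply hol_circle_cont with R0; auto; lra).
  assert (K := cauchy_transform r (fun x => f x * x) (fun x => x) r ltac:(lra) ltac:(lra)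
    (circle_cont_mult _ _ _ Cf (circle_cont_id r)) (circle_cont_id r)
    (fun x Hx => Req_le _ _ (eq_sym Hx)) z Hz).
  cbv beta in K.
  rewrite (mean_ext r ltac:(lra) (fun x => f x * (x / (x - z))) (fun x => f x * x / (x - z))); auto.
  intros x Hx. unfold Cdiv. ring.
Qed.

Theorem hol_has_expansion f z0 : hol f z0 -> exists a, has_expansion f z0 a.
Proof.
  intros Hf. apply hol_near, nearC_disk in Hf. destruct Hf as [d [Hd Hf]].
  destruct (taylor (fun h => f (z0 + h)) d (d / 2)) as [a Ha].
  - intros h Hh. apply hol_shift, Hf. replace (z0 + h - z0) with h by ring. auto.
  - lra.
  - exists a. apply has_expansion_csum. exists (d / 2)%R. split; auto. lra.
Qed.

(** The local power series of [f] can be differentiated termwise. *)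
Lemma hol_deriv f z0 : hol f z0 -> hol (deriv f) z0.
Proof.
  intros Hf. destruct (hol_has_expansion f z0 Hf) as [a Ha].
  apply has_expansion_csum in Ha. destruct Ha as [r [Hr Ha]].
  assert (E2 : Cmod (RtoC (r / 2)) = (r / 2)%R) by (rewrite Cmod_R; apply Rabs_pos_eq; lra).
  destruct (csum_geom_bounded a (RtoC (r / 2)) (f (z0 + RtoC (r / 2)))) as [M HM].
  { apply Ha. lra. } { intros E. apply RtoC_inj in E. lra. }
  rewrite E2 in HM.
  assert (HR : (0 < r / 3 < r / 2)%R) by lra.
  assert (HM' := geom_bounded_dcoef _ _ _ _ HR HM).
  assert (X : exists G, forall w, (Cmod w < r / 3)%R -> csum (dcoef a) w (G w)).
  { exists (fun w => epsilon (inhabits (RtoC 0)) (csum (dcoef a) w)).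
    intros w Hw. apply epsilon_spec. eapply ps_conv with (2 := HM'); auto. lra. }
  destruct X as [G HG].
  assert (D : forall h, (Cmod h < r / 3)%R -> cder (fun h => f (z0 + h)) h (G h)).
  { intros h Hh. apply (ps_cder a (r / 3) M (fun h => f (z0 + h)) G); auto. lra.
    apply geom_bounded_le with (r / 2)%R; auto. lra. intros w Hw. apply Ha. lra. }
  assert (HGh : hol G 0).
  { apply (csum_hol (dcoef a) (r / 3)); auto. lra. rewrite Cmod_0. lra. }
  apply hol_ext_loc with (fun w => G (w - z0)).
  - apply nearC_disk. exists (r / 3)%R. split. lra. intros w Hw.
    symmetry. apply deriv_eq.
    assert (Y := cder_comp (fun h => f (z0 + h)) (fun v => v - z0) w (G (w - z0)) (1 + 0)
      (cder_plus _ _ _ _ _ (cder_id w) (cder_const (- z0) w)) (D _ Hw)).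
    replace (G (w - z0) * (1 + 0)) with (G (w - z0)) in Y by ring.
    apply cder_ext_loc with (2 := Y).
    assert (Z : forall y, f (z0 + (y - z0)) = f y) by (intros y; f_equal; ring).
    apply filter_forall. exact Z.
  - apply (hol_comp G (fun w => w - z0)).
    + apply hol_minus. apply hol_id. apply hol_const.
    + replace (z0 - z0) with (RtoC 0) by ring. exact HGh.
Qed.

(** * Maximum principles on the disk *)

(** The upper limit of [|g|] at the unit circle is at most [1]. *)
Definition boundary_le_1 (g : C -> C) : Prop :=
  forall e, (0 < e)%R -> exists rho, (rho < 1)%R /\
    forall z, (rho < Cmod z < 1)%R -> (Cmod (g z) <= 1 + e)%R.

Lemma hol_pow g z n : hol g z -> hol (fun w => g w ^ n) z.
Proof.
  intros H. induction n. apply (hol_const 1). apply (hol_mult g (fun w => g w ^ n)); auto.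
Qed.

Lemma pow_bounded_le_1 (q K : R) : (0 <= q)%R -> (forall n, (q ^ n <= K)%R) -> (q <= 1)%R.
Proof.
  intros Hq H. destruct (Rle_dec q 1) as [|N]; auto. exfalso.
  destruct (INR_unbounded (K / (q - 1))) as [n Hn].
  assert (P := poly n (q - 1) ltac:(lra)). replace (1 + (q - 1))%R with q in P by ring.
  specialize (H n).
  assert (K < INR n * (q - 1))%R.
  { apply Rmult_lt_compat_r with (r := (q - 1)%R) in Hn; [|lra].
    unfold Rdiv in Hn. rewrite Rmult_assoc, Rinv_l in Hn by lra. lra. }
  lra.
Qed.

(** Cauchy's formula for [g ^ n] bounds [|g z| ^ n] by a multiple of
    [max |g| ^ n] that does not depend on [n]; hence [|g z| <= max |g|]. *)
Theorem max_principle g : hol_disk 1 g -> boundary_le_1 g ->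
  forall z, (Cmod z < 1)%R -> (Cmod (g z) <= 1)%R.
Proof.
  intros Hg Hb z Hz. apply Rnot_lt_le. intros Hlt.
  set (e := ((Cmod (g z) - 1) / 2)%R). assert (He : (0 < e)%R) by (unfold e; lra).
  destruct (Hb e He) as [rho [Hrho Hm]].
  set (r := Rmax ((1 + rho) / 2) ((1 + Cmod z) / 2)).
  assert (Z := Cmod_ge_0 z).
  assert (R1 := Rmax_l ((1 + rho) / 2) ((1 + Cmod z) / 2)). fold r in R1.
  assert (R2 := Rmax_r ((1 + rho) / 2) ((1 + Cmod z) / 2)). fold r in R2.
  assert (R3 : (r < 1)%R) by (unfold r; apply Rmax_lub_lt; lra).
  set (K := (2 * (r / (r - Cmod z)))%R).
  assert (B : forall n, ((Cmod (g z) / (1 + e)) ^ n <= K)%R).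
  { intros n.
    assert (F := cauchy_formula (fun w => g w ^ n) 1 r z
      (fun w Hw => hol_pow g w n (Hg w Hw)) R3 ltac:(lra)). cbv beta in F.
    assert (Bd : (Cmod (mean r (fun x => (g x ^ n * (x / (x - z)))%C)) <=
       2 * ((1 + e) ^ n * (r / (r - Cmod z))))%R).
    { apply mean_bound. lra.
      - apply circle_cont_mult.
        + apply circle_cont_pow, hol_circle_cont with 1%R; auto.
        + apply circle_cont_div. apply circle_cont_id. apply circle_cont_minus. apply circle_cont_id. apply circle_cont_const.
          intros x Hx. apply circ_neq with r; auto. lra.
      - intros x Hx. rewrite Cmod_mult, Cmod_pow, Cmod_div by (apply circ_neq with r; auto; lra).
        rewrite Hx. apply Rmult_le_compat.
        + apply pow_le, Cmod_ge_0.
        + apply Rmult_le_pos. lra. apply Rlt_le, Rinv_0_lt_compat.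
          apply Cmod_gt_0, circ_neq with r; auto; lra.
        + apply pow_incr. split. apply Cmod_ge_0. apply Hm. lra.
        + apply Rmult_le_compat_l. lra. apply Rinv_le_contravar. lra.
          rewrite <- Hx. replace x with ((x - z) + z) at 1 by ring.
          assert (T := Cmod_triangle (x - z) z). lra. }
    rewrite F, Cmod_pow in Bd. unfold Rdiv at 1. rewrite Rpow_mult_distr, pow_inv.
    assert (P := pow_lt (1 + e) n ltac:(lra)).
    apply Rmult_le_reg_r with ((1 + e) ^ n)%R; auto.
    rewrite Rmult_assoc, Rinv_l by lra. unfold K. lra. }
  apply pow_bounded_le_1 in B.
  - apply Rmult_le_compat_r with (r := (1 + e)%R) in B; [|lra].
    unfold Rdiv in B. rewrite Rmult_assoc, Rinv_l in B by lra. unfold e in B. lra.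
  - apply Rmult_le_pos. apply Cmod_ge_0. apply Rlt_le, Rinv_0_lt_compat. lra.
Qed.

(** The primitive of [u] is nondecreasing and vanishes at both ends. *)
Lemma RInt_0_nonneg (u : R -> R) (b : R) : (forall t, continuous u t) -> (forall t, (0 <= u t)%R) ->
  RInt u 0 b = 0%R -> forall t, (0 < t < b)%R -> u t = 0%R.
Proof.
  intros Hc Hp H0 t Ht.
  assert (Ex : forall x y, ex_RInt u x y).
  { intros x y. apply (ex_RInt_continuous (V := R_CompleteNormedModule)). auto. }
  assert (Z : forall x, (0 <= x <= b)%R -> RInt u 0 x = 0%R).
  { intros x Hx. assert (Y := RInt_Chasles u 0 x b (Ex _ _) (Ex _ _)).
    rewrite H0 in Y. change (RInt u 0 x + RInt u x b = 0)%R in Y.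
    assert (0 <= RInt u 0 x)%R by (apply RInt_ge_0; auto; lra).
    assert (0 <= RInt u x b)%R by (apply RInt_ge_0; auto; lra). lra. }
  assert (D : is_derive (fun x => RInt u 0 x) t (u t)).
  { apply (is_derive_RInt u (fun x => RInt u 0 x) 0).
    - apply filter_forall. intros x. apply (RInt_correct (V := R_CompleteNormedModule)). apply Ex.
    - apply Hc. }
  assert (D0 : is_derive (fun x => RInt u 0 x) t 0%R).
  { apply is_derive_ext_loc with (fun _ => 0%R). 2: apply (is_derive_const (V := R_NormedModule)).
    exists (mkposreal (Rmin t (b - t)) ltac:(apply Rmin_pos; lra)). intros x Hx.
    change (Rabs (x - t) < Rmin t (b - t))%R in Hx. apply Rabs_def2 in Hx.
    assert (X := Rmin_l t (b - t)). assert (Y := Rmin_r t (b - t)). symmetry. apply Z. lra. }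
  rewrite <- (is_derive_unique _ _ _ D). now apply is_derive_unique.
Qed.

(** Normalised to [g 0 = 1]: the mean of [1 - Re g] over a circle is [0], so [g = 1] on
    it, and then inside by Cauchy's formula. *)
Theorem strong_max_principle g : hol_disk 1 g -> (forall z, (Cmod z < 1)%R -> (Cmod (g z) <= 1)%R) ->
  Cmod (g 0) = 1%R -> forall z, (Cmod z < 1)%R -> g z = g 0.
Proof.
  intros Hg Hle H1 z Hz. assert (Z := Cmod_ge_0 z).
  assert (N0 : g 0 <> 0) by (apply Cmod_gt_0; lra).
  set (r := ((1 + Cmod z) / 2)%R). assert (Hr : (0 < r < 1 /\ Cmod z < r)%R) by (unfold r; lra).
  set (H := fun w => 1 - g w / g 0).
  assert (HH : hol_disk 1 H).
  { intros w Hw. apply hol_minus. apply hol_const. apply hol_div; auto. apply hol_const. }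
  assert (Cc : circle_cont r H) by (apply hol_circle_cont with 1%R; auto; lra).
  assert (Hle' : forall w, (Cmod w < 1)%R -> (Cmod (g w / g 0) <= 1)%R).
  { intros w Hw. rewrite Cmod_div, H1 by auto. unfold Rdiv. rewrite Rinv_1, Rmult_1_r. auto. }
  assert (HRe : forall w, (Cmod w < 1)%R -> (0 <= Re (H w))%R).
  { intros w Hw. unfold H. specialize (Hle' w Hw). assert (X := re_le_Cmod (g w / g 0)).
    apply Rabs_le_between in X. change (0 <= 1 - Re (g w / g 0))%R. lra. }
  assert (Ct : forall t, (Cmod (circ r t) < 1)%R) by (intros; rewrite Cmod_circ; lra).
  assert (M0 : mean r H = 0).
  { rewrite (mean_ext r ltac:(lra) H (fun x => H x * (x / (x - 0)))).
    - rewrite (cauchy_formula H 1 r 0 HH); try lra. unfold H. field; auto. rewrite Cmod_0; lra.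
    - intros x Hx. field. apply Cmod_gt_0. lra. }
  assert (I0 : RInt (fun t => Re (H (circ r t))) 0 (2 * PI) = 0%R).
  { assert (P := PI2_pos). apply (f_equal Re) in M0. unfold mean in M0.
    change (RInt (fun t => Re (H (circ r t))) 0 (2 * PI) / (2 * PI) = 0)%R in M0.
    replace (RInt (fun t => Re (H (circ r t))) 0 (2 * PI)) with
      (RInt (fun t => Re (H (circ r t))) 0 (2 * PI) / (2 * PI) * (2 * PI))%R by (field; lra).
    rewrite M0. apply Rmult_0_l. }
  assert (K : forall t, (0 < t < 2 * PI)%R -> H (circ r t) = 0).
  { intros t Ht.
    assert (E : Re (H (circ r t)) = 0%R).
    { apply (RInt_0_nonneg (fun t => Re (H (circ r t))) (2 * PI)); auto.
      intros s. apply (cont_Re (fun s => H (circ r s))). apply circle_cont_path; auto. lra. }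
    assert (X := Hle' _ (Ct t)). unfold H in E |- *.
    set (v := g (circ r t) / g 0) in *. change (1 - Re v = 0)%R in E.
    assert (Y := Cmod2_alt v). assert (Cmod v ^ 2 <= 1)%R.
    { assert (P := Cmod_ge_0 v). nra. }
    assert (Im v = 0%R) by nra.
    change (1 - v = 0). apply injective_projections; [change (1 - Re v = 0)%R|change (0 - Im v = 0)%R]; lra. }
  assert (E : H z = 0).
  (* [H] vanishes on the circle minus one point, which the integral does not see. *)
  { rewrite <- (cauchy_formula H 1 r z HH); try lra.
    transitivity (mean r (fun _ => 0)). 2: apply mean_const.
    assert (P := PI2_pos).
    unfold mean. f_equal; f_equal; apply RInt_ext; intros t Ht;
    rewrite Rmin_left, Rmax_right in Ht by lra; rewrite K, Cmult_0_l by auto; reflexivity. }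
  unfold H in E. replace (g z) with ((g z / g 0) * g 0) by (field; auto).
  replace (g z / g 0) with (1 - (1 - g z / g 0)) by ring. rewrite E. ring.
Qed.

(** * The exponential function and logarithms *)

Definition exp_coef (k : nat) : C := / RtoC (INR (fact k)).

Lemma exp_coef_geom_bounded r : (0 <= r)%R -> geom_bounded exp_coef r (exp r).
Proof.
  intros Hr k. unfold exp_coef. rewrite <- RtoC_inv, Cmod_R by apply INR_fact_neq_0.
  assert (P := INR_fact_lt_0 k).
  rewrite Rabs_pos_eq by (apply Rlt_le, Rinv_0_lt_compat; auto).
  apply Rle_trans with (sum_f_R0 (fun k => r ^ k / INR (fact k))%R k).
  - assert (Q : forall j, (0 <= r ^ j / INR (fact j))%R).
    { intros j. apply Rmult_le_pos. now apply pow_le. apply Rlt_le, Rinv_0_lt_compat, INR_fact_lt_0. }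
    destruct k.
    + simpl. lra.
    + rewrite tech5. assert (0 <= sum_f_R0 (fun k => r ^ k / INR (fact k))%R k)%R by (apply cond_pos_sum; auto).
      unfold Rdiv at 2. lra.
  - apply exp_ge_taylor; auto.
Qed.

Definition cexp (z : C) : C := epsilon (inhabits (RtoC 0)) (csum exp_coef z).

Lemma cexp_csum z : csum exp_coef z (cexp z).
Proof.
  unfold cexp. apply epsilon_spec.
  apply (ps_conv exp_coef (Cmod z + 1) (exp (Cmod z + 1))); assert (Z := Cmod_ge_0 z); try lra.
  apply exp_coef_geom_bounded. lra.
Qed.

Lemma cexp_cder z : cder cexp z (cexp z).
Proof.
  assert (Z := Cmod_ge_0 z).
  apply (ps_cder exp_coef (Cmod z + 1) (exp (Cmod z + 1)) cexp cexp); try lra.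
  - apply exp_coef_geom_bounded. lra.
  - intros; apply cexp_csum.
  - intros w _. 
    assert (E : forall n, psum exp_coef w n = psum (dcoef exp_coef) w n).
    { induction n; auto. cbn [psum]. rewrite IHn. f_equal. f_equal. unfold dcoef, exp_coef.
      rewrite fact_simpl, mult_INR, RtoC_mult.
      assert (RtoC (INR (S n)) <> 0) by (intros X; apply RtoC_inj in X; revert X; apply not_0_INR; lia).
      assert (RtoC (INR (fact n)) <> 0) by (intros X; apply RtoC_inj in X; revert X; apply INR_fact_neq_0).
      field. auto. }
    apply clim_ext with (1 := E). apply cexp_csum.
Qed.

Lemma hol_cexp z : hol cexp z.
Proof.
  exists cexp. apply filter_forall. intros w. split. apply cexp_cder.
  exact (cder_cont _ _ _ (cexp_cder w)).
Qed.

Lemma cexp_0 : cexp 0 = 1.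
Proof.
  apply clim_unique with (1 := cexp_csum 0). apply clim_decr.
  apply clim_ext with (fun _ => RtoC 1). 2: apply clim_const.
  intros n. symmetry. induction n.
  - cbn [psum]. unfold exp_coef. simpl. field.
  - change (psum exp_coef 0 (S (S n))) with (psum exp_coef 0 (S n) + exp_coef (S n) * 0 ^ S n).
    rewrite IHn. simpl. ring.
Qed.

(** The derivative of [z |-> exp z * exp (a + b - z)] is zero. *)
Lemma cexp_plus a b : cexp (a + b) = cexp a * cexp b.
Proof.
  set (F := fun z => cexp z * cexp (a + b - z)).
  assert (D : forall z, cder F z 0).
  { intros z. replace (RtoC 0) with (cexp z * cexp (a + b - z) + cexp z * (cexp (a + b - z) * (0 + - (1)))) by ring.
    apply (cder_mult cexp (fun z => cexp (a + b - z))). apply cexp_cder.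
    apply (cder_comp cexp (fun z => a + b - z)). 2: apply cexp_cder.
    apply (cder_plus (fun _ => a + b) (fun z => - z)). apply cder_const.
    exists (fun _ => - (1)). split. apply cont_const. split; auto. intros; ring. }
  assert (E := cder_0_const F (Cmod a + 1) (fun z _ => D z) a ltac:(lra)).
  unfold F in E. rewrite cexp_0 in E.
  replace (a + b - a) with b in E by ring. replace (a + b - 0) with (a + b) in E by ring.
  rewrite E. ring.
Qed.

Lemma cexp_neq_0 z : cexp z <> 0.
Proof.
  intros E. assert (X := cexp_plus z (- z)). rewrite E in X.
  replace (z + - z) with (RtoC 0) in X by ring. rewrite cexp_0 in X.
  assert (Y : RtoC 1 <> 0) by (apply RtoC_neq_0; lra). apply Y. rewrite X. ring.
Qed.

(** Integrate the Taylor series termwise. *)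
Lemma primitive_small g r : hol_disk 1 g -> (0 < r < 1)%R ->
  exists G : C -> C, G 0 = 0 /\ forall z, (Cmod z < r)%R -> cder G z (g z).
Proof.
  intros Hg Hr. set (s := ((1 + r) / 2)%R).
  destruct (taylor g 1 s Hg ltac:(unfold s; lra)) as [a Ha].
  assert (Er : Cmod (RtoC r) = r) by (rewrite Cmod_R; apply Rabs_pos_eq; lra).
  destruct (csum_geom_bounded a (RtoC r) (g (RtoC r))) as [M HM].
  { apply Ha. rewrite Er. unfold s; lra. } { apply RtoC_neq_0. lra. }
  rewrite Er in HM.
  assert (HM0 : (0 <= M)%R).
  { apply Rle_trans with (2 := HM O). simpl. assert (X := Cmod_ge_0 (a O)). lra. }
  set (b := fun k => match k with O => RtoC 0 | S j => a j / RtoC (INR (S j)) end).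
  assert (Eb : forall k, dcoef b k = a k).
  { intros k. unfold dcoef, b. field. apply RtoC_neq_0, not_0_INR. lia. }
  assert (Hb : geom_bounded b r (M * r)).
  { intros k. destruct k.
    - unfold b. rewrite Cmod_0, Rmult_0_l. apply Rmult_le_pos; lra.
    - assert (N : INR (S k) <> 0%R) by (apply not_0_INR; lia).
      unfold b. rewrite Cmod_div, Cmod_R, Rabs_pos_eq; auto using RtoC_neq_0, pos_INR.
      assert (Q : (/ INR (S k) <= 1)%R).
      { rewrite <- Rinv_1. apply Rinv_le_contravar. lra. apply (le_INR 1). lia. }
      assert (Q0 : (0 < / INR (S k))%R) by (apply Rinv_0_lt_compat, lt_0_INR; lia).
      specialize (HM k). simpl pow. unfold Rdiv.
      assert (P : (0 <= Cmod (a k) * r ^ k)%R).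
      { apply Rmult_le_pos. apply Cmod_ge_0. apply pow_le. lra. }
      replace (Cmod (a k) * / INR (S k) * (r * r ^ k))%R with
        (Cmod (a k) * r ^ k * / INR (S k) * r)%R by ring.
      apply Rmult_le_compat_r. lra. nra. }
  set (G := fun z => epsilon (inhabits (RtoC 0)) (csum b z)).
  assert (HG : forall z, (Cmod z < r)%R -> csum b z (G z)).
  { intros z Hz. unfold G. apply epsilon_spec. eapply ps_conv with (2 := Hb); auto. lra. }
  assert (D : forall z, (Cmod z < r)%R -> cder G z (g z)).
  { intros z Hz. apply (ps_cder b r (M * r) G g); auto. lra.
    intros w Hw. apply clim_ext with (psum a w).
    - induction n; auto. cbn [psum]. now rewrite IHn, Eb.
    - apply Ha. unfold s; lra. }
  exists (fun z => G z + - G 0). split. ring.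
  intros z Hz. replace (g z) with (g z + 0) by ring.
  apply (cder_plus G (fun _ => - G 0)). auto. apply cder_const.
Qed.

(** Primitives on smaller disks that vanish at [0] agree, so they glue. *)
Lemma primitive g : hol_disk 1 g -> exists G : C -> C, forall z, (Cmod z < 1)%R -> cder G z (g z).
Proof.
  intros Hg.
  set (P := fun (r : R) (G : C -> C) => G 0 = 0 /\ forall z, (Cmod z < r)%R -> cder G z (g z)).
  set (F := fun r => epsilon (inhabits (fun z : C => z)) (P r)).
  assert (HF : forall r, (0 < r < 1)%R -> P r (F r)).
  { intros r Hr. unfold F. apply epsilon_spec. now apply primitive_small. }
  assert (Ag : forall r s z, (0 < r < 1)%R -> (0 < s < 1)%R -> (Cmod z < r)%R -> (Cmod z < s)%R ->
    F r z = F s z).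
  { intros r s z Hr Hs Hzr Hzs. destruct (HF r Hr) as [E1 D1], (HF s Hs) as [E2 D2].
    assert (E := cder_0_const (fun w => F r w + - (1) * F s w) (Rmin r s)).
    assert (X : F r z + - (1) * F s z = F r 0 + - (1) * F s 0).
    { apply E. 2: now apply Rmin_glb_lt.
      intros w Hw. assert (W1 := Rmin_l r s). assert (W2 := Rmin_r r s).
      replace (RtoC 0) with (g w + (0 * F s w + - (1) * g w)) by ring.
      apply (cder_plus (F r) (fun w => - (1) * F s w)). apply D1; lra.
      apply (cder_mult (fun _ => - (1)) (F s)). apply cder_const. apply D2; lra. }
    rewrite E1, E2 in X. replace (F r z) with (F r z + - (1) * F s z + F s z) by ring.
    rewrite X. ring. }
  set (rad := fun z => ((1 + Cmod z) / 2)%R).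
  assert (Hrad : forall z, (Cmod z < 1)%R -> (0 < rad z < 1 /\ Cmod z < rad z)%R).
  { intros z Hz. unfold rad. assert (Z := Cmod_ge_0 z). lra. }
  exists (fun z => F (rad z) z). intros z Hz.
  destruct (Hrad z Hz) as [H1 H2].
  apply cder_ext_loc with (F (rad z)).
  - apply nearC_disk. exists (rad z - Cmod z)%R. split. lra. intros w Hw.
    assert (T := Cmod_triangle z (w - z)). replace (z + (w - z)) with w in T by ring.
    destruct (Hrad w ltac:(lra)). apply Ag; auto; lra.
  - now apply HF.
Qed.

(** With [L] a primitive of [u' / u], the function [u * exp (- L)] has derivative
    zero.  This is where the disk being simply connected enters. *)
Lemma hol_log u : hol_disk 1 u -> (forall z, (Cmod z < 1)%R -> u z <> 0) ->
  exists L, hol_disk 1 L /\ forall z, (Cmod z < 1)%R -> u z = u 0 * cexp (L z).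
Proof.
  intros Hu N.
  destruct (primitive (fun z => deriv u z / u z)) as [L0 HL0].
  { intros z Hz. apply hol_div; [now apply hol_deriv, Hu|now apply Hu|auto]. }
  set (L := fun z => L0 z + - L0 0).
  assert (HL : forall z, (Cmod z < 1)%R -> cder L z (deriv u z / u z)).
  { intros z Hz. replace (deriv u z / u z) with (deriv u z / u z + 0) by ring.
    apply (cder_plus L0 (fun _ => - L0 0)); auto. apply cder_const. }
  exists L. split.
  - intros z Hz. exists (fun z => deriv u z / u z). apply nearC_disk.
    exists (1 - Cmod z)%R. split. lra. intros w Hw.
    assert (T := Cmod_triangle z (w - z)). replace (z + (w - z)) with w in T by ring.
    split. apply HL. lra. apply hol_cont, hol_div. apply hol_deriv, Hu. lra. apply Hu; lra. apply N; lra.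
  - intros z Hz.
    assert (E : u z * cexp (- L z) = u 0 * cexp (- L 0)).
    { apply (cder_0_const (fun z => u z * cexp (- L z)) 1); auto. clear z Hz. intros z Hz.
      replace (RtoC 0) with (deriv u z * cexp (- L z) +
        u z * (cexp (- L z) * (0 * L z + - (1) * (deriv u z / u z)))) by (field; auto).
      apply (cder_mult u (fun z => cexp (- L z))). now apply hol_cder, Hu.
      apply (cder_comp cexp (fun z => - L z)). 2: apply cexp_cder.
      apply cder_ext_loc with (fun z => - (1) * L z).
      + assert (Y : forall w, - (1) * L w = - L w) by (intros; ring). apply filter_forall. exact Y.
      + apply (cder_mult (fun _ => - (1)) L). apply cder_const. auto. }
    replace (- L 0) with (RtoC 0) in E by (unfold L; ring). rewrite cexp_0 in E.
    replace (u z) with (u z * (cexp (- L z) * cexp (L z))).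
    + rewrite Cmult_assoc, E. ring.
    + rewrite <- cexp_plus. replace (- L z + L z) with (RtoC 0) by ring. rewrite cexp_0. ring.
Qed.

(** * Zeros, multiplicities and fibres *)

Lemma csum_0 a : csum a 0 (a 0%nat).
Proof.
  apply clim_decr. apply clim_ext with (fun _ => a 0%nat). 2: apply clim_const.
  induction n.
  - cbn [psum]. simpl. ring.
  - change (psum a 0 (S (S n))) with (psum a 0 (S n) + a (S n) * 0 ^ S n).
    rewrite <- IHn. simpl. ring.
Qed.

(** Divide a power series whose first [m] coefficients vanish by [h ^ m]. *)
Lemma csum_shift a m h l : csum a h l -> (forall k, (k < m)%nat -> a k = 0) -> h <> 0 ->
  csum (fun k => a (m + k)%nat) h (l / h ^ m).
Proof.
  intros H H0 Hh. assert (N : h ^ m <> 0) by now apply Cpow_nz.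
  assert (P0 : forall k, (k <= m)%nat -> psum a h k = 0).
  { induction k; intros Hk; auto. cbn [psum]. rewrite IHk, H0 by lia. ring. }
  assert (P : forall n, psum a h (m + n) = h ^ m * psum (fun k => a (m + k)%nat) h n).
  { induction n. rewrite Nat.add_0_r, P0 by lia. cbn [psum]. ring.
    rewrite Nat.add_succ_r. cbn [psum]. rewrite IHn, Cpow_add_r. ring. }
  assert (S : forall j u (c : C), clim u c -> clim (fun n => u (j + n)%nat) c).
  { induction j; intros u c Hu; auto. apply (IHj (fun n => u (S n))). now apply clim_incr. }
  apply (S m) in H.
  apply clim_ext with (fun n => / h ^ m * psum a h (m + n)).
  - intros n. rewrite P. field. auto.
  - replace (l / h ^ m) with (/ h ^ m * l) by (unfold Cdiv; ring). now apply clim_scal.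
Qed.

(** Multiplicity through a local factor, a form that divides easily. *)
Definition vanishes (k : C -> C) (z0 : C) (m : nat) : Prop :=
  exists u, hol u z0 /\ u z0 <> 0 /\ nearC z0 (fun z => k z = (z - z0) ^ m * u z).

Lemma expansion_factor k z0 a m : has_expansion k z0 a -> (forall j, (j < m)%nat -> a j = 0) ->
  exists u, hol u z0 /\ u z0 = a m /\ nearC z0 (fun z => k z = (z - z0) ^ m * u z).
Proof.
  intros H H0. apply has_expansion_csum in H. destruct H as [r [Hr H]].
  set (U := fun h => if Ceq_dec h 0 then a m else k (z0 + h) / h ^ m).
  assert (HU : forall h, (Cmod h < r)%R -> csum (fun j => a (m + j)%nat) h (U h)).
  { intros h Hh. unfold U. destruct (Ceq_dec h 0) as [->|N].
    - assert (X := csum_0 (fun j => a (m + j)%nat)). cbv beta in X. now rewrite Nat.add_0_r in X.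
    - apply csum_shift; auto. }
  exists (fun z => U (z - z0)). split; [|split].
  - apply (hol_comp U (fun z => z - z0)).
    + apply hol_minus. apply hol_id. apply hol_const.
    + replace (z0 - z0) with (RtoC 0) by ring. apply (csum_hol (fun j => a (m + j)%nat) r); auto.
      rewrite Cmod_0; auto.
  - replace (z0 - z0) with (RtoC 0) by ring. unfold U. destruct (Ceq_dec 0 0); congruence.
  - apply nearC_disk. exists r. split; auto. intros z Hz. unfold U.
    destruct (Ceq_dec (z - z0) 0) as [E|N].
    + assert (L := H _ Hz). rewrite E in L. replace (z0 + 0) with z in L.
      2: { replace z with (z0 + (z - z0)) by ring. rewrite E. ring. }
      rewrite (clim_unique _ _ _ L (csum_0 a)), E. destruct m.
      * simpl. ring.
      * rewrite (H0 O) by lia. simpl. ring.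
    + replace (z0 + (z - z0)) with z by ring. field. now apply Cpow_nz.
Qed.

Lemma multiplicity_vanishes f w z0 m : multiplicity f w z0 m -> vanishes (fun z => f z - w) z0 m.
Proof.
  intros [a [H [Hm H0]]]. destruct (expansion_factor _ _ _ _ H H0) as [u [Hu [E N]]].
  exists u. split; auto. split; auto. congruence.
Qed.

Definition zprod (s : list C) (z : C) : C := fold_right Cmult 1 (map (fun a => z - a) s).
Definition lsum (h : C -> C) (s : list C) : C := fold_right Cplus 0 (map h s).

Lemma hol_zprod s z : hol (zprod s) z.
Proof.
  induction s. apply (hol_const 1).
  apply (hol_mult (fun z => z - a) (zprod s)); auto. apply hol_minus. apply hol_id. apply hol_const.
Qed.

Lemma zprod_eq_0 s z : zprod s z = 0 <-> In z s.
Proof.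
  induction s.
  - simpl. split; [|tauto]. intros E. revert E. apply RtoC_neq_0. lra.
  - change (zprod (a :: s) z) with ((z - a) * zprod s z). simpl. rewrite <- IHs. split.
    + intros E. destruct (Ceq_dec a z); auto. right.
      destruct (Ceq_dec (zprod s z) 0); auto. exfalso. revert E. apply Cmult_neq_0; auto.
      apply Cminus_neq_0. auto.
    + intros [->|E]. ring. rewrite E. ring.
Qed.

Lemma zprod_split s z w :
  zprod s w = (w - z) ^ count_occ Ceq_dec s z * zprod (remove Ceq_dec z s) w.
Proof.
  induction s.
  - simpl. unfold zprod. simpl. ring.
  - change (zprod (a :: s) w) with ((w - a) * zprod s w). rewrite IHs. simpl.
    destruct (Ceq_dec a z) as [->|N].
    + destruct (Ceq_dec z z); [|congruence]. simpl. ring.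
    + destruct (Ceq_dec z a); [congruence|].
      change (zprod (a :: remove Ceq_dec z s) w) with ((w - a) * zprod (remove Ceq_dec z s) w). ring.
Qed.

(** The quotient by [zprod s] is defined at each point by the local factor there;
    the local factors agree wherever [zprod s] does not vanish. *)
Lemma divide_zeros k s :
  (forall z, (Cmod z < 1)%R -> vanishes k z (count_occ Ceq_dec s z)) ->
  exists u, hol_disk 1 u /\ (forall z, (Cmod z < 1)%R -> u z <> 0) /\
    forall z, (Cmod z < 1)%R -> k z = zprod s z * u z.
Proof.
  intros Hv.
  set (P := fun z v => hol v z /\ v z <> 0 /\ nearC z (fun w => k w = zprod s w * v w)).
  assert (Nr : forall z, nearC z (fun w => zprod (remove Ceq_dec z s) w <> 0)).
  { intros z. apply cont_neq. apply hol_cont, hol_zprod. intros E. apply zprod_eq_0 in E.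
    revert E. apply remove_In. }
  assert (HP : forall z, (Cmod z < 1)%R -> exists v, P z v).
  { intros z Hz. destruct (Hv z Hz) as [u [Hu [Hu0 N]]].
    assert (N0 := near_self _ _ (Nr z)).
    exists (fun w => u w / zprod (remove Ceq_dec z s) w). split; [|split].
    - apply hol_div; auto. apply hol_zprod.
    - unfold Cdiv. apply Cmult_neq_0; auto. apply Cinv_neq_0; auto.
    - generalize (filter_and _ _ N (Nr z)). apply filter_imp. intros w [E Nw].
      rewrite E, (zprod_split s z). set (x := _ ^ _). field. auto. }
  set (V := fun z => epsilon (inhabits (fun z : C => z)) (P z)).
  assert (HV : forall z, (Cmod z < 1)%R -> P z (V z)).
  { intros z Hz. unfold V. apply epsilon_spec. auto. }
  exists (fun z => V z z). split; [|split].
  - intros z Hz. destruct (HV z Hz) as [H1 [_ H3]].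
    apply hol_ext_loc with (V z); auto.
    assert (Nd := near_unit_disk z Hz).
    generalize (filter_and _ _ (filter_and _ _ H3 (Nr z)) Nd). apply filter_imp.
    intros w [[E Nw] Hw]. destruct (Ceq_dec w z) as [->|Nz]; auto.
    destruct (HV w Hw) as [_ [_ E']]. apply near_self in E'.
    assert (Z : zprod s w <> 0).
    { rewrite (zprod_split s z). apply Cmult_neq_0; auto. apply Cpow_nz, Cminus_neq_0; auto. }
    rewrite E in E'.
    replace (V z w) with (zprod s w * V z w / zprod s w) by (field; auto).
    rewrite E'. field. auto.
  - intros z Hz. apply (HV z Hz).
  - intros z Hz. destruct (HV z Hz) as [_ [_ E]]. now apply near_self in E.
Qed.

(** * Counting with the logarithmic derivative *)

Lemma mean_z_mult R0 r H : hol_disk R0 H -> (0 < r < R0)%R -> mean r (fun z => z * H z) = 0.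
Proof.
  intros HH Hr.
  assert (K : hol_disk R0 (fun z => z * H z)) by (intros z Hz; apply hol_mult; auto; apply hol_id).
  rewrite (mean_ext r ltac:(lra) _ (fun x => (fun z => z * H z) x * (x / (x - 0)))).
  - rewrite (cauchy_formula _ R0 r 0 K); try lra. ring. rewrite Cmod_0; lra.
  - intros x Hx. field. apply Cmod_gt_0. lra.
Qed.

Definition inside (r : R) (s : list C) : list C :=
  filter (fun a => if Rlt_dec (Cmod a) r then true else false) s.

Lemma deriv_ext f g z : nearC z (fun w => f w = g w) -> hol f z -> deriv g z = deriv f z.
Proof.
  intros N H. apply deriv_eq. apply cder_ext_loc with f; auto. now apply hol_cder.
Qed.

(** The argument principle weighted by [h]: in [k' / k] each root [a] contributes
    [1 / (z - a)], hence [h a] or [0] by Cauchy's formula, and [u' / u] contributes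
    nothing. *)
Lemma weighted_count s u h r : hol_disk 1 u -> (forall z, (Cmod z < 1)%R -> u z <> 0) ->
  hol_disk 1 h -> (0 < r < 1)%R -> (forall a, In a s -> Cmod a <> r) ->
  forall k, (forall z, (Cmod z < 1)%R -> k z = zprod s z * u z) ->
  mean r (fun z => z * (h z * (deriv k z / k z))) = lsum h (inside r s).
Proof.
  intros Hu Nu Hh Hr. induction s as [|a s IH]; intros Ha k Hk.
  - rewrite (mean_ext r ltac:(lra) _ (fun z => z * (h z * (deriv u z / u z)))).
    + apply (mean_z_mult 1); auto. intros z Hz.
      apply hol_mult; auto. apply hol_div; auto. apply hol_deriv; auto.
    + intros z Hz. rewrite (Hk z) by lra. rewrite (deriv_ext u k z).
      * unfold zprod; simpl. rewrite Cmult_1_l. auto.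
      * generalize (near_unit_disk z ltac:(lra)). apply filter_imp. intros w Hw. rewrite (Hk w Hw).
        unfold zprod; simpl. now rewrite Cmult_1_l.
      * apply Hu. lra.
  - set (k1 := fun z => zprod s z * u z).
    assert (Hk1 : hol_disk 1 k1) by (intros z Hz; apply (hol_mult (zprod s) u); auto; apply hol_zprod).
    assert (IH1 : mean r (fun z => z * (h z * (deriv k1 z / k1 z))) = lsum h (inside r s)).
    { apply IH; auto. intros b Hb. apply Ha. now right. }
    assert (Na : Cmod a <> r) by (apply Ha; now left).
    assert (Nz : forall z, Cmod z = r -> z - a <> 0).
    { intros z Hz. apply Cminus_neq_0. congruence. }
    assert (Nk1 : forall z, Cmod z = r -> k1 z <> 0).
    { intros z Hz. apply Cmult_neq_0. 2: apply Nu; lra. intros E. apply zprod_eq_0 in E.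
      apply (Ha z); auto. now right. }
    assert (C1 : circle_cont r (fun z => z * (h z / (z - a)))).
    { apply circle_cont_mult. apply circle_cont_id. apply circle_cont_div; auto. apply hol_circle_cont with 1%R; auto. lra.
      apply circle_cont_minus. apply circle_cont_id. apply circle_cont_const. }
    assert (C2 : circle_cont r (fun z => z * (h z * (deriv k1 z / k1 z)))).
    { apply circle_cont_mult. apply circle_cont_id. apply circle_cont_mult. apply hol_circle_cont with 1%R; auto. lra.
      apply circle_cont_div; auto; apply hol_circle_cont with 1%R; auto; try lra. intros z Hz.
      now apply hol_deriv, Hk1. }
    rewrite (mean_ext r ltac:(lra) _
      (fun z => z * (h z / (z - a)) + z * (h z * (deriv k1 z / k1 z)))).
    + rewrite mean_plus by (auto; lra). rewrite IH1.
      assert (M : mean r (fun z => z * (h z / (z - a))) = if Rlt_dec (Cmod a) r then h a else 0).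
      { destruct (Rlt_dec (Cmod a) r) as [L|L].
        - rewrite <- (cauchy_formula h 1 r a Hh); try lra. apply mean_ext. lra.
          intros z Hz. unfold Cdiv. ring.
        - apply (mean_z_mult (Rmin 1 (Cmod a))).
          + intros z Hz. assert (X := Rmin_l 1 (Cmod a)). assert (Y := Rmin_r 1 (Cmod a)).
            apply hol_div. apply Hh; lra. apply hol_minus. apply hol_id. apply hol_const.
            apply Cminus_neq_0. intros ->. lra.
          + split. lra. apply Rmin_glb_lt; lra. }
      rewrite M. simpl. destruct (Rlt_dec (Cmod a) r).
      * reflexivity.
      * apply Cplus_0_l.
    + intros z Hz. rewrite (Hk z) by lra.
      rewrite (deriv_ext (fun z => (z - a) * k1 z) k z).
      * rewrite (deriv_eq _ z ((1 + 0) * k1 z + (z - a) * deriv k1 z)).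
        -- change (zprod (a :: s) z) with ((z - a) * zprod s z).
           specialize (Nk1 z Hz). unfold k1 in Nk1 |- *.
           set (D := deriv _ z).
           assert (zprod s z <> 0) by (intros E; rewrite E in Nk1; apply Nk1; ring).
           assert (u z <> 0) by (apply Nu; lra).
           field. auto.
        -- apply (cder_mult (fun z => z - a) k1).
           apply (cder_plus (fun z => z) (fun _ => - a)). apply cder_id. apply cder_const.
           apply hol_cder, Hk1. lra.
      * generalize (near_unit_disk z ltac:(lra)). apply filter_imp.
        assert (Y : forall w, (Cmod w < 1)%R -> (w - a) * k1 w = k w).
        { intros w Hw. rewrite (Hk w Hw). unfold k1.
          change (zprod (a :: s) w) with ((w - a) * zprod s w). ring. }
        exact Y.
      * apply hol_mult. apply hol_minus. apply hol_id. apply hol_const. apply Hk1. lra.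
Qed.

(** The solution lists of [exactly_n_to_one], with multiplicities expressed by a
    global factorisation, which is the form that can be divided and integrated. *)
Definition fibre (f : C -> C) (n : nat) (w : C) (s : list C) : Prop :=
  length s = n /\ (forall a, In a s -> (Cmod a < 1)%R) /\
  exists u, hol_disk 1 u /\ (forall z, (Cmod z < 1)%R -> u z <> 0) /\
    forall z, (Cmod z < 1)%R -> f z - w = zprod s z * u z.

Lemma exactly_n_to_one_fibre n f : exactly_n_to_one n f ->
  exists fib, forall z, (Cmod z < 1)%R -> fibre f n (f z) (fib (f z)).
Proof.
  intros H. exists (fun w => epsilon (inhabits nil) (fibre f n w)).
  intros z Hz. apply epsilon_spec.
  destruct (H (f z)) as [s [L [D M]]]. { now exists z. }
  exists s. split; auto. split. exact D.
  apply (divide_zeros (fun x => f x - f z)). intros x Hx.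
  apply multiplicity_vanishes, M, Hx.
Qed.

Lemma fibre_In f n w s z : fibre f n w s -> In z s <-> (Cmod z < 1)%R /\ f z = w.
Proof.
  intros [_ [D [u [_ [Nu E]]]]]. split.
  - intros Hz. assert (Hd := D z Hz). split; auto. apply zprod_eq_0 in Hz.
    specialize (E z Hd). rewrite Hz, Cmult_0_l in E.
    replace (f z) with (f z - w + w) by ring. rewrite E. ring.
  - intros [Hd Ez]. apply zprod_eq_0. specialize (E z Hd).
    destruct (Ceq_dec (zprod s z) 0) as [|N]; auto. exfalso.
    apply (Cmult_neq_0 _ _ N (Nu z Hd)). rewrite <- E, Ez. ring.
Qed.

Lemma fibre_count f n w s h r : hol_disk 1 f -> fibre f n w s -> hol_disk 1 h -> (0 < r < 1)%R ->
  (forall z, Cmod z = r -> f z <> w) ->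
  mean r (fun z => z * (h z * (deriv f z / (f z - w)))) = lsum h (inside r s).
Proof.
  intros Hf F Hh Hr Hw. assert (F' := F). destruct F' as [_ [_ [u [Hu [Nu E]]]]].
  rewrite <- (weighted_count s u h r Hu Nu Hh Hr) with (k := fun z => f z - w); auto.
  - apply mean_ext. lra. intros z Hz. f_equal. f_equal. f_equal.
    symmetry. apply deriv_eq. replace (deriv f z) with (deriv f z + 0) by ring.
    apply (cder_plus f (fun _ => - w)). apply hol_cder, Hf. lra. apply cder_const.
  - intros a Ha E'. apply (fibre_In f n w) in Ha; auto. apply (Hw a); tauto.
Qed.

Lemma list_in_disk (s : list C) : (forall a, In a s -> (Cmod a < 1)%R) ->
  exists r, (0 < r < 1)%R /\ forall a, In a s -> (Cmod a < r)%R.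
Proof.
  induction s as [|b s IH]; intros H.
  - exists (1 / 2)%R. split. lra. intros a [].
  - destruct IH as [r [Hr K]]. { intros; apply H; now right. }
    assert (Hb := H b (or_introl eq_refl)).
    exists (Rmax r ((1 + Cmod b) / 2)). split.
    + split. apply Rlt_le_trans with r. lra. apply Rmax_l. apply Rmax_lub_lt; lra.
    + intros a [->|Ha].
      * apply Rlt_le_trans with (2 := Rmax_r _ _). lra.
      * apply Rlt_le_trans with (2 := Rmax_l _ _). auto.
Qed.

Lemma lsum_1 s : lsum (fun _ => 1) s = RtoC (INR (length s)).
Proof.
  induction s. reflexivity.
  change (lsum (fun _ => 1) (a :: s)) with (1 + lsum (fun _ => 1) s). rewrite IHs.
  simpl length. rewrite S_INR, RtoC_plus. ring.
Qed.

Lemma filter_full (A : Type) (P : A -> bool) (s : list A) :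
  length (filter P s) = length s -> filter P s = s.
Proof.
  induction s; simpl; auto. destruct (P a); simpl; intros H.
  - f_equal. apply IHs. lia.
  - assert (X := filter_length_le P s). lia.
Qed.

Lemma inside_all r s : (forall a, In a s -> (Cmod a < r)%R) -> inside r s = s.
Proof.
  induction s; simpl; intros H; auto. destruct (Rlt_dec (Cmod a) r) as [_|N].
  - f_equal. apply IHs. auto.
  - exfalso. apply N. auto.
Qed.

(** The counting integral is a Cauchy transform in the value [w]. *)
Lemma fibre_integral_hol f h r w0 m : hol_disk 1 f -> hol_disk 1 h -> (0 < r < 1)%R -> (0 < m)%R ->
  (forall z, Cmod z = r -> (m <= Cmod (f z - w0))%R) ->
  forall w, (Cmod (w - w0) < m)%R ->
    hol (fun w => mean r (fun z => z * (h z * (deriv f z / (f z - w))))) w.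
Proof.
  intros Hf Hh Hr Hm Hb w Hw.
  assert (Cf : circle_cont r f) by (apply hol_circle_cont with 1%R; auto; lra).
  assert (Ca : circle_cont r (fun z => z * (h z * deriv f z))).
  { apply circle_cont_mult. apply circle_cont_id. apply circle_cont_mult; apply hol_circle_cont with 1%R; auto; try lra.
    intros z Hz. now apply hol_deriv, Hf. }
  assert (K := cauchy_transform r (fun z => z * (h z * deriv f z)) (fun z => f z - w0) m ltac:(lra) Hm
    Ca (circle_cont_minus _ _ _ Cf (circle_cont_const r w0)) Hb).
  apply csum_hol with (z := w - w0) in K; auto.
  replace w with (w0 + (w - w0)) by ring. apply hol_shift.
  eapply hol_ext. 2: exact K.
  intros v. cbv beta. apply mean_ext. lra. intros z Hz.
  replace (f z - w0 - v) with (f z - (w0 + v)) by ring. unfold Cdiv. ring.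
Qed.

(** Properness: the number of solutions inside [|z| < r] is an integer that varies
    continuously with the value, and it is already [n] at [f z0]; since there are
    [n] solutions in all, none lies outside. *)
Lemma fibres_stay_inside f n fib z0 : hol_disk 1 f ->
  (forall z, (Cmod z < 1)%R -> fibre f n (f z) (fib (f z))) -> (Cmod z0 < 1)%R ->
  exists r m, (0 < r < 1)%R /\ (0 < m)%R /\
    (forall z, Cmod z = r -> (m <= Cmod (f z - f z0))%R) /\
    forall z, (Cmod z < 1)%R -> (Cmod (f z - f z0) < m)%R ->
      forall a, In a (fib (f z)) -> (Cmod a < r)%R.
Proof.
  intros Hf Hfib Hz0. assert (F0 := Hfib z0 Hz0).
  destruct (list_in_disk (fib (f z0)) (proj1 (proj2 F0))) as [r [Hr Hin]].
  destruct (circle_cont_min r (fun z => f z - f z0)) as [m0 [Hm0 Hb]].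
  { lra. } { apply circle_cont_minus. apply hol_circle_cont with 1%R; auto; lra. apply circle_cont_const. }
  { intros z Hz. apply Cminus_neq_0. intros E.
    assert (In z (fib (f z0))) by (apply (fibre_In f n (f z0)); auto; split; auto; lra).
    apply Hin in H. lra. }
  assert (H1 : hol_disk 1 (fun _ => 1)) by (intros z _; apply hol_const).
  assert (HJ := fibre_integral_hol f (fun _ => 1) r (f z0) m0 Hf H1 Hr Hm0 Hb (f z0)).
  replace (f z0 - f z0) with (RtoC 0) in HJ by ring. rewrite Cmod_0 in HJ. specialize (HJ Hm0).
  apply hol_cont in HJ. destruct (proj1 (contC_disk _ _) HJ 1%R Rlt_0_1) as [d [Hd HJd]].
  exists r, (Rmin m0 d). split; auto. split. now apply Rmin_pos. split.
  { intros z Hz. apply Rle_trans with (1 := Rmin_l _ _). auto. }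
  intros z Hz Hzm.
  assert (Z1 := Rlt_le_trans _ _ _ Hzm (Rmin_l _ _)).
  assert (Z2 := Rlt_le_trans _ _ _ Hzm (Rmin_r _ _)).
  specialize (HJd (f z) Z2). assert (F := Hfib z Hz).
  rewrite (fibre_count f n (f z) (fib (f z)) (fun _ => 1) r) in HJd; auto.
  2: { intros x Hx E. specialize (Hb x Hx). rewrite E in Hb. lra. }
  rewrite (fibre_count f n (f z0) (fib (f z0)) (fun _ => 1) r) in HJd; auto.
  2: { intros x Hx E. specialize (Hb x Hx). rewrite E in Hb.
       replace (f z0 - f z0) with (RtoC 0) in Hb by ring. rewrite Cmod_0 in Hb. lra. }
  rewrite (inside_all r (fib (f z0)) Hin), !lsum_1, (proj1 F0) in HJd.
  rewrite <- RtoC_minus, Cmod_R in HJd.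
  assert (L := filter_length_le (fun a => if Rlt_dec (Cmod a) r then true else false) (fib (f z))).
  fold (inside r (fib (f z))) in L. rewrite (proj1 F) in L.
  assert (E : length (inside r (fib (f z))) = n).
  { apply Rabs_def2 in HJd. destruct (Nat.eq_dec (length (inside r (fib (f z)))) n); auto. exfalso.
    assert (X : (S (length (inside r (fib (f z)))) <= n)%nat) by lia.
    apply le_INR in X. rewrite S_INR in X. lra. }
  assert (E2 : inside r (fib (f z)) = fib (f z)).
  { apply filter_full. fold (inside r (fib (f z))). now rewrite E, (proj1 F). }
  intros a Ha. rewrite <- E2 in Ha. apply filter_In in Ha. destruct Ha as [_ Ha].
  destruct (Rlt_dec (Cmod a) r); auto. discriminate.
Qed.

(** By properness one circle encloses all fibres of nearby values, so the sum over
    the fibre is the counting integral over this fixed circle. *)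
Lemma fibre_sum_hol f n fib h z0 : hol_disk 1 f ->
  (forall z, (Cmod z < 1)%R -> fibre f n (f z) (fib (f z))) -> hol_disk 1 h -> (Cmod z0 < 1)%R ->
  exists J m, (0 < m)%R /\ hol J (f z0) /\
    forall z, (Cmod z < 1)%R -> (Cmod (f z - f z0) < m)%R -> lsum h (fib (f z)) = J (f z).
Proof.
  intros Hf Hfib Hh Hz0.
  destruct (fibres_stay_inside f n fib z0 Hf Hfib Hz0) as [r [m [Hr [Hm [Hb Hin]]]]].
  exists (fun w => mean r (fun z => z * (h z * (deriv f z / (f z - w))))), m.
  split; auto. split.
  - apply (fibre_integral_hol f h r (f z0) m); auto.
    replace (f z0 - f z0) with (RtoC 0) by ring. now rewrite Cmod_0.
  - intros z Hz H1.
    rewrite (fibre_count f n (f z) (fib (f z)) h r); auto.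
    + rewrite inside_all; auto. now apply Hin.
    + intros x Hx E. specialize (Hb x Hx). rewrite E in Hb. lra.
Qed.

Lemma near_value f z0 m : contC f z0 -> (0 < m)%R -> nearC z0 (fun z => (Cmod (f z - f z0) < m)%R).
Proof.
  intros Hf Hm. destruct (proj1 (contC_disk _ _) Hf m Hm) as [d [Hd Hc]].
  apply nearC_disk. exists d. auto.
Qed.

(** * Finite Blaschke products *)

Definition bfac (a z : C) : C := (z - a) / (1 - Cconj a * z).
Definition bprod (s : list C) (z : C) : C := fold_right Cmult 1 (map (fun a => bfac a z) s).
Definition bden (s : list C) (z : C) : C := fold_right Cmult 1 (map (fun a => 1 - Cconj a * z) s).

Lemma bfac_den_bound a z : (Cmod a < 1)%R -> (Cmod z < 1)%R ->
  (1 - Cmod a <= Cmod (1 - Cconj a * z))%R.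
Proof.
  intros Ha Hz.
  assert (T := Cmod_triangle (1 - Cconj a * z) (Cconj a * z)).
  replace (1 - Cconj a * z + Cconj a * z) with (RtoC 1) in T by ring.
  rewrite Cmod_1, Cmod_mult, Cmod_conj in T. assert (X := Cmod_ge_0 a). assert (Y := Cmod_ge_0 z). nra.
Qed.

Lemma bfac_den_neq_0 a z : (Cmod a < 1)%R -> (Cmod z < 1)%R -> 1 - Cconj a * z <> 0.
Proof.
  intros Ha Hz. apply Cmod_gt_0. assert (X := bfac_den_bound a z Ha Hz). lra.
Qed.

Lemma bden_neq_0 s z : (forall a, In a s -> (Cmod a < 1)%R) -> (Cmod z < 1)%R -> bden s z <> 0.
Proof.
  intros Hs Hz. induction s.
  - apply RtoC_neq_0. lra.
  - change (bden (a :: s) z) with ((1 - Cconj a * z) * bden s z).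
    apply Cmult_neq_0. apply bfac_den_neq_0; auto. apply Hs; now left.
    apply IHs. intros; apply Hs; now right.
Qed.

Lemma bprod_quot s z : (forall a, In a s -> (Cmod a < 1)%R) -> (Cmod z < 1)%R ->
  bprod s z = zprod s z / bden s z.
Proof.
  intros Hs Hz. induction s.
  - unfold bprod, zprod, bden; simpl. field.
  - assert (N := bden_neq_0 s z (fun b Hb => Hs b (or_intror Hb)) Hz).
    assert (N1 := bfac_den_neq_0 a z (Hs a (or_introl eq_refl)) Hz).
    change (bden (a :: s) z) with ((1 - Cconj a * z) * bden s z).
    change (zprod (a :: s) z) with ((z - a) * zprod s z).
    change (bprod (a :: s) z) with (bfac a z * bprod s z).
    rewrite IHs. unfold bfac. field. auto. intros; apply Hs; now right.
Qed.

Lemma hol_bden s z : hol (bden s) z.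
Proof.
  induction s. apply (hol_const 1).
  apply (hol_mult (fun z => 1 - Cconj a * z) (bden s)); auto.
  apply hol_minus. apply hol_const. apply hol_mult. apply hol_const. apply hol_id.
Qed.

Lemma hol_bprod s z : (forall a, In a s -> (Cmod a < 1)%R) -> (Cmod z < 1)%R -> hol (bprod s) z.
Proof.
  intros Hs Hz. apply hol_ext_loc with (fun z => zprod s z / bden s z).
  - generalize (near_unit_disk z Hz). apply filter_imp. intros w Hw. now rewrite bprod_quot.
  - apply hol_div. apply hol_zprod. apply hol_bden. now apply bden_neq_0.
Qed.

(** Both [|bfac a z| < 1] in the disk and [|bfac a z| -> 1] at its boundary come
    from this identity. *)
Lemma bfac_identity a z :
  (Cmod (1 - Cconj a * z) ^ 2 - Cmod (z - a) ^ 2 = (1 - Cmod a ^ 2) * (1 - Cmod z ^ 2))%R.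
Proof.
  rewrite !Cmod2_alt. destruct a as [a1 a2], z as [z1 z2]. unfold Re, Im; simpl. ring.
Qed.

Lemma bfac_lt_1 a z : (Cmod a < 1)%R -> (Cmod z < 1)%R -> (Cmod (bfac a z) < 1)%R.
Proof.
  intros Ha Hz. assert (N := bfac_den_neq_0 a z Ha Hz). unfold bfac. rewrite Cmod_div by auto.
  assert (P : (0 < Cmod (1 - Cconj a * z))%R) by now apply Cmod_gt_0.
  apply Rmult_lt_reg_r with (Cmod (1 - Cconj a * z)); auto.
  unfold Rdiv. rewrite Rmult_assoc, Rinv_l, Rmult_1_r, Rmult_1_l by lra.
  assert (I := bfac_identity a z). assert (X := Cmod_ge_0 a). assert (Y := Cmod_ge_0 z).
  assert (W := Cmod_ge_0 (z - a)).
  assert (Q : (0 < (1 - Cmod a ^ 2) * (1 - Cmod z ^ 2))%R) by (apply Rmult_lt_0_compat; nra).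
  nra.
Qed.

Lemma bfac_sym a z : (Cmod a < 1)%R -> (Cmod z < 1)%R -> Cmod (bfac a z) = Cmod (bfac z a).
Proof.
  intros Ha Hz. unfold bfac. rewrite !Cmod_div; auto using bfac_den_neq_0.
  replace (z - a) with (- (a - z)) by ring. rewrite Cmod_opp. f_equal.
  rewrite <- (Cmod_conj (1 - Cconj z * a)), Cminus_conj, Cmult_conj, Cconj_conj.
  f_equal. replace (Cconj 1) with (RtoC 1). ring.
  unfold Cconj. apply injective_projections; simpl; ring.
Qed.

Lemma bprod_le_1 s z : (forall a, In a s -> (Cmod a < 1)%R) -> (Cmod z < 1)%R ->
  (Cmod (bprod s z) <= 1)%R.
Proof.
  intros Hs Hz. induction s.
  - unfold bprod; simpl. rewrite Cmod_1. lra.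
  - change (bprod (a :: s) z) with (bfac a z * bprod s z). rewrite Cmod_mult.
    assert (B := bfac_lt_1 a z (Hs a (or_introl eq_refl)) Hz).
    assert (IH := IHs (fun b Hb => Hs b (or_intror Hb))).
    assert (X := Cmod_ge_0 (bfac a z)). assert (Y := Cmod_ge_0 (bprod s z)). nra.
Qed.

Lemma bprod_lt_1 s z : s <> nil -> (forall a, In a s -> (Cmod a < 1)%R) -> (Cmod z < 1)%R ->
  (Cmod (bprod s z) < 1)%R.
Proof.
  intros Hn Hs Hz. destruct s as [|a s]; [congruence|].
  change (bprod (a :: s) z) with (bfac a z * bprod s z). rewrite Cmod_mult.
  assert (B := bfac_lt_1 a z (Hs a (or_introl eq_refl)) Hz).
  assert (IH := bprod_le_1 s z (fun b Hb => Hs b (or_intror Hb)) Hz).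
  assert (X := Cmod_ge_0 (bfac a z)). assert (Y := Cmod_ge_0 (bprod s z)). nra.
Qed.

Lemma bfac_boundary a e : (Cmod a < 1)%R -> (0 < e)%R -> exists rho, (rho < 1)%R /\
  forall z, (rho < Cmod z < 1)%R -> (1 - e <= Cmod (bfac a z))%R.
Proof.
  intros Ha He. set (K := ((1 - Cmod a) * (1 - Cmod a))%R).
  assert (HK : (0 < K)%R) by (unfold K; apply Rmult_lt_0_compat; lra).
  exists (1 - e * K / 2)%R. split. { assert (0 < e * K)%R by now apply Rmult_lt_0_compat. lra. }
  intros z [Hz1 Hz]. assert (I := bfac_identity a z). assert (D := bfac_den_bound a z Ha Hz).
  assert (N := bfac_den_neq_0 a z Ha Hz). assert (B := bfac_lt_1 a z Ha Hz).
  assert (X := Cmod_ge_0 a). assert (Y := Cmod_ge_0 z). assert (W := Cmod_ge_0 (bfac a z)).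
  assert (E : Cmod (z - a) = (Cmod (bfac a z) * Cmod (1 - Cconj a * z))%R).
  { rewrite <- Cmod_mult. f_equal. unfold bfac. field. auto. }
  rewrite E in I. set (b := Cmod (bfac a z)) in *. set (d := Cmod (1 - Cconj a * z)) in *.
  assert (Q : ((1 - Cmod a ^ 2) * (1 - Cmod z ^ 2) <= 1 * (2 * (1 - Cmod z)))%R).
  { apply Rmult_le_compat; nra. }
  assert (Q2 : (K * (1 - b * b) <= d * d * (1 - b * b))%R).
  { apply Rmult_le_compat_r. nra. unfold K. nra. }
  assert (Q3 : (K * (1 - b) <= K * (1 - b * b))%R) by (apply Rmult_le_compat_l; nra).
  assert (Q4 : (K * (1 - b) <= K * e)%R) by nra.
  apply Rmult_le_reg_l in Q4; auto. lra.
Qed.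

Lemma bprod_boundary s e : (forall a, In a s -> (Cmod a < 1)%R) -> (0 < e)%R ->
  exists rho, (rho < 1)%R /\ forall z, (rho < Cmod z < 1)%R -> (1 - e <= Cmod (bprod s z))%R.
Proof.
  intros Hs. revert e. induction s as [|a s IH]; intros e He.
  - exists 0%R. split. lra. intros z _. unfold bprod; simpl. rewrite Cmod_1. lra.
  - destruct (IH (fun b Hb => Hs b (or_intror Hb)) (e / 2)%R ltac:(lra)) as [r1 [H1 B1]].
    destruct (bfac_boundary a (e / 2) (Hs a (or_introl eq_refl)) ltac:(lra)) as [r2 [H2 B2]].
    exists (Rmax r1 r2). split. now apply Rmax_lub_lt.
    intros z Hz. assert (M1 := Rmax_l r1 r2). assert (M2 := Rmax_r r1 r2).
    specialize (B1 z ltac:(lra)). specialize (B2 z ltac:(lra)).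
    change (bprod (a :: s) z) with (bfac a z * bprod s z). rewrite Cmod_mult.
    assert (X := bprod_le_1 s z (fun b Hb => Hs b (or_intror Hb)) ltac:(lra)).
    assert (Y := bfac_lt_1 a z (Hs a (or_introl eq_refl)) ltac:(lra)).
    assert (X0 := Cmod_ge_0 (bprod s z)). assert (Y0 := Cmod_ge_0 (bfac a z)). nra.
Qed.

Definition rprod (h : C -> R) (s : list C) : R := fold_right Rmult 1%R (map h s).

Lemma Cmod_bprod s z : Cmod (bprod s z) = rprod (fun a => Cmod (bfac a z)) s.
Proof.
  induction s. unfold bprod, rprod; simpl. apply Cmod_1.
  change (bprod (a :: s) z) with (bfac a z * bprod s z). rewrite Cmod_mult, IHs. reflexivity.
Qed.

Lemma rprod_mult h k s : rprod (fun a => h a * k a)%R s = (rprod h s * rprod k s)%R.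
Proof.
  induction s; unfold rprod in *; simpl. ring. rewrite IHs. ring.
Qed.

Lemma rprod_ext h k s : (forall a, In a s -> h a = k a) -> rprod h s = rprod k s.
Proof.
  intros H. induction s; auto. unfold rprod in *; simpl. f_equal. apply H; now left.
  apply IHs. intros; apply H; now right.
Qed.

Lemma rprod_const c s : rprod (fun _ => c) s = (c ^ length s)%R.
Proof. induction s; auto. unfold rprod in *; simpl. now rewrite IHs. Qed.

Lemma rprod_swap (h : C -> C -> R) s t :
  rprod (fun a => rprod (h a) t) s = rprod (fun b => rprod (fun a => h a b) s) t.
Proof.
  induction s.
  - unfold rprod at 1. simpl. symmetry. rewrite (rprod_ext _ (fun _ => 1%R)).
    rewrite rprod_const. apply pow1. reflexivity.
  - change (rprod (fun a => rprod (h a) t) (a :: s))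
      with (rprod (h a) t * rprod (fun a => rprod (h a) t) s)%R.
    rewrite IHs, <- rprod_mult. apply rprod_ext. reflexivity.
Qed.

Lemma rprod_bounds h s : (forall a, In a s -> (0 <= h a <= 1)%R) -> (0 <= rprod h s <= 1)%R.
Proof.
  intros H. induction s.
  - unfold rprod; simpl. lra.
  - change (rprod h (a :: s)) with (h a * rprod h s)%R.
    assert (Ha := H a (or_introl eq_refl)).
    assert (IH := IHs (fun b Hb => H b (or_intror Hb))). nra.
Qed.

Lemma rprod_lower h s e : (0 <= e <= 1)%R -> (forall a, In a s -> (1 - e <= h a)%R) ->
  ((1 - e) ^ length s <= rprod h s)%R.
Proof.
  intros He H. induction s.
  - unfold rprod; simpl. lra.
  - change (rprod h (a :: s)) with (h a * rprod h s)%R. simpl.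
    assert (Ha := H a (or_introl eq_refl)).
    assert (IH := IHs (fun b Hb => H b (or_intror Hb))).
    assert (P : (0 <= (1 - e) ^ length s)%R) by (apply pow_le; lra). nra.
Qed.

Lemma rprod_eq_1 h s a : (forall a, In a s -> (0 <= h a <= 1)%R) -> rprod h s = 1%R ->
  In a s -> h a = 1%R.
Proof.
  intros H. induction s as [|b s IH]; intros E Ha. destruct Ha.
  change (rprod h (b :: s)) with (h b * rprod h s)%R in E.
  assert (Hb := H b (or_introl eq_refl)).
  assert (Hs := rprod_bounds h s (fun c Hc => H c (or_intror Hc))).
  destruct Ha as [->|Ha]. nra.
  apply IH; auto. intros; apply H; now right. nra.
Qed.

(** * The factorisation *)

(** [1 - n d = 1 / (1 + e) + d] for the chosen [d]; conclude with Bernoulli's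
    inequality. *)
Lemma bernoulli (n : nat) (e : R) : (0 < e)%R ->
  exists d, (0 < d < 1)%R /\ (1 <= (1 + e) * (1 - d) ^ n)%R.
Proof.
  intros He. set (d := (e / ((INR n + 1) * (1 + e)))%R).
  assert (N := pos_INR n).
  assert (Hd : (0 < d)%R) by (unfold d; apply Rdiv_lt_0_compat; [lra|nra]).
  assert (E : (d * (INR n + 1) * (1 + e) = e)%R) by (unfold d; field; lra).
  assert (Hd1 : (d < 1)%R).
  { apply Rnot_le_lt. intros H. assert (1 <= d * (INR n + 1))%R by nra. nra. }
  exists d. split. lra.
  assert (B : forall k, (1 - INR k * d <= (1 - d) ^ k)%R).
  { induction k. simpl. lra. rewrite S_INR. simpl.
    apply Rle_trans with ((1 - d) * (1 - INR k * d))%R.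
    - assert (K := pos_INR k). assert (0 <= INR k * d * d)%R by (apply Rmult_le_pos; nra). lra.
    - apply Rmult_le_compat_l. lra. auto. }
  specialize (B n). apply Rle_trans with ((1 + e) * (1 - INR n * d))%R. nra.
  apply Rmult_le_compat_l. lra. auto.
Qed.

Lemma cexp_pow x n : cexp (RtoC (INR n) * x) = cexp x ^ n.
Proof.
  induction n.
  - simpl INR. rewrite Cmult_0_l, cexp_0. reflexivity.
  - rewrite S_INR, RtoC_plus. replace ((RtoC (INR n) + 1) * x) with (x + RtoC (INR n) * x) by ring.
    rewrite cexp_plus, IHn. reflexivity.
Qed.

Lemma Cmod_cexp_lsum L s : Cmod (cexp (lsum L s)) = rprod (fun a => Cmod (cexp (L a))) s.
Proof.
  induction s. unfold lsum, rprod; simpl. rewrite cexp_0. apply Cmod_1.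
  change (lsum L (a :: s)) with (L a + lsum L s). rewrite cexp_plus, Cmod_mult, IHs. reflexivity.
Qed.

Lemma lsum_const h c s : (forall a, In a s -> h a = c) -> lsum h s = RtoC (INR (length s)) * c.
Proof.
  intros H. induction s.
  - unfold lsum; simpl. ring.
  - change (lsum h (a :: s)) with (h a + lsum h s). rewrite (H a (or_introl eq_refl)), IHs.
    simpl length. rewrite S_INR, RtoC_plus. ring. intros; apply H; now right.
Qed.

Lemma pow_le_root (x e : R) n : (0 < n)%nat -> (0 <= e)%R -> (x ^ n <= 1 + e)%R -> (x <= 1 + e)%R.
Proof.
  intros Hn He H. apply Rnot_lt_le. intros Hx.
  assert (Q : (x ^ 1 <= x ^ n)%R) by (apply Rle_pow; [lra|lia]). simpl in Q. lra.
Qed.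

(** Estimates for [n]-th powers, with error [(1 - d) ^ n], suffice. *)
Lemma boundary_le_1_pow g n : (0 < n)%nat ->
  (forall d, (0 < d < 1)%R -> exists rho, (rho < 1)%R /\
    forall z, (rho < Cmod z < 1)%R -> (Cmod (g z) ^ n * (1 - d) ^ n <= 1)%R) ->
  boundary_le_1 g.
Proof.
  intros Hn H e He. destruct (bernoulli n e He) as [d [Hd B]].
  destruct (H d Hd) as [rho [Hrho K]]. exists rho. split; auto.
  intros z Hz. apply pow_le_root with n; auto. lra.
  assert (P : (0 < (1 - d) ^ n)%R) by (apply pow_lt; lra).
  apply Rmult_le_reg_r with ((1 - d) ^ n)%R; auto. specialize (K z Hz). lra.
Qed.

Section n_to_one.
Variables (f : C -> C) (n : nat) (fib : C -> list C).
Hypothesis Hn : (0 < n)%nat.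
Hypothesis Hf : hol_disk 1 f.
Hypothesis Hfib : forall z, (Cmod z < 1)%R -> fibre f n (f z) (fib (f z)).

Lemma fib_in z a : (Cmod z < 1)%R -> In a (fib (f z)) <-> (Cmod a < 1)%R /\ f a = f z.
Proof. intros Hz. apply (fibre_In f n). auto. Qed.

(** By compactness of [|z| <= rho], the fibres meeting it stay in some smaller disk
    [|z| < 1 - d]; so a fibre with a point outside that disk avoids [|z| <= rho]. *)
Lemma fibres_to_boundary rho : (rho < 1)%R -> exists r, (r < 1)%R /\
  forall z, (r < Cmod z < 1)%R -> forall a, In a (fib (f z)) -> (rho < Cmod a)%R.
Proof.
  intros Hrho.
  (* [Q u v d]: the fibres through the points of the square of radius [d] around
     [(u, v)] with [|z| <= rho] stay in the disk of radius [1 - d]. *)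
  set (Q := fun (u v : R) (d : posreal) => forall z, (Cmod z <= rho)%R ->
    (Rabs (Re z - u) < d)%R -> (Rabs (Im z - v) < d)%R ->
    forall a, In a (fib (f z)) -> (Cmod a < 1 - d)%R).
  assert (Box : forall (z : C) u v (d : R), (Rabs (Re z - u) < d)%R -> (Rabs (Im z - v) < d)%R ->
     (Cmod (z - (u, v)%R) < 2 * d)%R).
  { intros z u v d H1 H2. replace (z - (u, v)%R) with (RtoC (Re z - u) + Ci * RtoC (Im z - v)).
    - apply Rle_lt_trans with (1 := Cmod_triangle _ _). rewrite Cmod_mult, Cmod_Ci, !Cmod_R. lra.
    - destruct z as [x y]. unfold Ci, Re, Im; apply injective_projections; simpl; ring. }
  assert (HQ : forall u v, exists d, Q u v d).
  { intros u v. destruct (Rlt_dec (Cmod (u, v)) 1) as [H1|H1].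
    - destruct (fibres_stay_inside f n fib (u, v) Hf Hfib H1) as [r [m [Hr [Hm [_ Hin]]]]].
      assert (N := near_value f (u, v) m (hol_cont _ _ (Hf _ H1)) Hm).
      apply nearC_disk in N. destruct N as [d0 [Hd0 N]].
      assert (Hd : (0 < Rmin (d0 / 2) (1 - r))%R) by (apply Rmin_pos; lra).
      exists (mkposreal _ Hd). intros z Hz Hx Hy a Ha. simpl in *.
      assert (X := Rmin_l (d0 / 2) (1 - r)). assert (Y := Rmin_r (d0 / 2) (1 - r)).
      assert (B := Box z u v _ Hx Hy).
      assert (Hz1 : (Cmod z < 1)%R) by lra.
      assert (Hv : (Cmod (f z - f (u, v)) < m)%R) by (apply N; lra).
      specialize (Hin z Hz1 Hv a Ha). lra.
    (* Around a point outside the disk, the square misses [|z| <= rho]. *)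
    - assert (Hd : (0 < (1 - rho) / 2)%R) by lra.
      exists (mkposreal _ Hd). intros z Hz Hx Hy. simpl in *. exfalso.
      assert (B := Box z u v _ Hx Hy).
      set (p := ((u, v) : C)) in *.
      assert (T := Cmod_triangle z (- (z - p))). rewrite Cmod_opp in T.
      replace (z + - (z - p)) with p in T by ring. lra. }
  set (delta := fun u v => epsilon (inhabits (mkposreal 1 Rlt_0_1)) (Q u v)).
  assert (HD : forall u v, Q u v (delta u v)).
  { intros u v. unfold delta. apply epsilon_spec. auto. }
  destruct (compactness_value_2d (-1) 1 (-1) 1 delta) as [d Hd].
  assert (K : forall z, (Cmod z <= rho)%R -> forall a, In a (fib (f z)) -> (Cmod a < 1 - d)%R).
  { intros z Hz a Ha. apply Rnot_le_lt. intros Hle.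
    assert (X := Rle_trans _ _ _ (Rmax_l _ _) (Rmax_Cmod z)).
    assert (Y := Rle_trans _ _ _ (Rmax_r _ _) (Rmax_Cmod z)).
    apply Rabs_le_between in X, Y.
    apply (Hd (fst z) (snd z)); try lra.
    intros [u [v [_ [_ [H1 [H2 H3]]]]]].
    assert (L := HD u v z Hz H1 H2 a Ha). lra. }
  exists (1 - d)%R. split. { generalize (cond_pos d); lra. }
  intros z [Hz1 Hz2] a Ha. apply Rnot_le_lt. intros Hle.
  apply fib_in in Ha; auto. destruct Ha as [Ha E].
  assert (L := K a Hle z). rewrite E in L.
  assert (In z (fib (f z))) by (apply fib_in; auto). specialize (L H). lra.
Qed.

Definition zeros : list C := fib (f 0).
Definition phi (z : C) : C := bprod zeros z.

Lemma disk_0 : (Cmod 0 < 1)%R.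
Proof. rewrite Cmod_0. lra. Qed.

Lemma zeros_disk a : In a zeros -> (Cmod a < 1)%R.
Proof. intros H. apply (Hfib 0 disk_0). exact H. Qed.

Lemma zeros_length : length zeros = n.
Proof. apply (Hfib 0 disk_0). Qed.

Lemma zeros_0 : In (RtoC 0) zeros.
Proof. apply fib_in. apply disk_0. split; auto. apply disk_0. Qed.

Lemma zeros_not_nil : zeros <> nil.
Proof. intros E. assert (H := zeros_0). rewrite E in H. destruct H. Qed.

Lemma phi_hol : hol_disk 1 phi.
Proof. intros z Hz. apply hol_bprod; auto. exact zeros_disk. Qed.

Lemma phi_lt_1 z : (Cmod z < 1)%R -> (Cmod (phi z) < 1)%R.
Proof. intros. apply bprod_lt_1; auto. apply zeros_not_nil. exact zeros_disk. Qed.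

Lemma phi_eq_0 z : (Cmod z < 1)%R -> phi z = 0 <-> In z zeros.
Proof.
  intros Hz. rewrite <- zprod_eq_0. unfold phi. rewrite bprod_quot by (auto; exact zeros_disk).
  assert (N := bden_neq_0 zeros z zeros_disk Hz). split; intros E.
  - destruct (Ceq_dec (zprod zeros z) 0) as [|Nz]; auto. exfalso. revert E.
    unfold Cdiv. apply Cmult_neq_0; auto. now apply Cinv_neq_0.
  - rewrite E. unfold Cdiv. ring.
Qed.

(** [phi] and [f - f 0] have the same zeros with the same multiplicities. *)
Lemma phi_unit : exists u, hol_disk 1 u /\ (forall z, (Cmod z < 1)%R -> u z <> 0) /\
  forall z, (Cmod z < 1)%R -> phi z = (f z - f 0) * u z.
Proof.
  destruct (Hfib 0 disk_0) as [_ [_ [u0 [Hu [Nu E]]]]].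
  assert (N : forall z, (Cmod z < 1)%R -> bden zeros z * u0 z <> 0).
  { intros z Hz. apply Cmult_neq_0; auto. apply bden_neq_0; auto. exact zeros_disk. }
  exists (fun z => / (bden zeros z * u0 z)). split; [|split].
  - intros z Hz. apply hol_inv; auto. apply hol_mult; auto. apply hol_bden.
  - intros z Hz. now apply Cinv_neq_0, N.
  - intros z Hz. rewrite (E z Hz). unfold phi. rewrite bprod_quot by (auto; exact zeros_disk).
    fold zeros. assert (N1 := bden_neq_0 zeros z zeros_disk Hz). field. auto.
Qed.

Lemma phi_boundary e : (0 < e)%R -> exists rho, (rho < 1)%R /\
  forall z, (rho < Cmod z < 1)%R -> (1 - e <= Cmod (phi z))%R.
Proof. intros He. apply bprod_boundary; auto. exact zeros_disk. Qed.

(** Write [phi = (f - f 0) u] with [u = u 0 * exp L], and let [M z] be the mean of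
    [L] over the fibre through [z].  Then [exp (M - L)] has modulus
    [prod |phi a| ^ (1 / n) / |phi z|], the product being over that fibre; it tends to
    [1] at the boundary, so it is constant, and [exp L] inherits from [exp M] the
    constancy on fibres. *)
Theorem phi_fibre z z' : (Cmod z < 1)%R -> (Cmod z' < 1)%R -> f z = f z' -> phi z = phi z'.
Proof.
  destruct phi_unit as [u [Hu [Nu E]]].
  destruct (hol_log u Hu Nu) as [L [HL EL]].
  assert (Nn : RtoC (INR n) <> 0) by (apply RtoC_neq_0, not_0_INR; lia).
  set (M := fun z => / RtoC (INR n) * lsum L (fib (f z))).
  assert (HM : hol_disk 1 M).
  { intros x Hx. destruct (fibre_sum_hol f n fib L x Hf Hfib HL Hx) as [J [m [Hm [HJ EJ]]]].
    apply (hol_mult (fun _ => / RtoC (INR n)) (fun z => lsum L (fib (f z)))). apply hol_const.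
    apply hol_ext_loc with (fun z => J (f z)).
    - generalize (filter_and _ _ (near_value f x m (hol_cont _ _ (Hf x Hx)) Hm) (near_unit_disk x Hx)).
      apply filter_imp. intros y [H1 H2]. symmetry. auto.
    - apply hol_comp; auto. }
  set (Q := fun z => cexp (M z - L z)).
  assert (HQ : hol_disk 1 Q).
  { intros x Hx. apply (hol_comp cexp (fun z => M z - L z)). apply hol_minus; auto. apply hol_cexp. }
  assert (NQ : forall x, Q x <> 0) by (intros; apply cexp_neq_0).
  assert (EQ : forall x, Q x * cexp (L x) = cexp (M x)).
  { intros x. unfold Q. rewrite <- cexp_plus. f_equal. ring. }
  assert (Key : forall x, (Cmod x < 1)%R ->
    (Cmod (Q x) ^ n * Cmod (phi x) ^ n = rprod (fun a => Cmod (phi a)) (fib (f x)))%R).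
  { intros x Hx. assert (F := Hfib x Hx).
    rewrite (rprod_ext (fun a => Cmod (phi a))
      (fun a => Cmod (f x - f 0) * Cmod (u 0) * Cmod (cexp (L a)))%R).
    2: { intros a Ha. apply fib_in in Ha; auto. destruct Ha as [Ha Ea].
         rewrite (E a Ha), (EL a Ha), !Cmod_mult, Ea. ring. }
    rewrite rprod_mult, rprod_const, (proj1 F), <- Cmod_cexp_lsum.
    replace (lsum L (fib (f x))) with (RtoC (INR n) * M x) by (unfold M; field; auto).
    rewrite cexp_pow, <- EQ, Cmod_pow, (E x Hx), (EL x Hx), !Cmod_mult, !Rpow_mult_distr. ring. }
  assert (Bd : forall d, (0 < d < 1)%R -> exists rho, (rho < 1)%R /\
    forall x, (rho < Cmod x < 1)%R ->
      ((1 - d) ^ n <= Cmod (phi x) ^ n <= 1)%R /\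
      ((1 - d) ^ n <= rprod (fun a => Cmod (phi a)) (fib (f x)) <= 1)%R).
  { intros d Hd. destruct (phi_boundary d ltac:(lra)) as [r1 [Hr1 B1]].
    destruct (fibres_to_boundary r1 Hr1) as [r2 [Hr2 B2]].
    exists (Rmax r1 r2). split. now apply Rmax_lub_lt.
    intros x Hx. assert (M1 := Rmax_l r1 r2). assert (M2 := Rmax_r r1 r2).
    assert (Hx1 : (Cmod x < 1)%R) by lra. split; [split|split].
    - apply pow_incr. split. lra. apply B1. lra.
    - rewrite <- (pow1 n). apply pow_incr. split. apply Cmod_ge_0. now apply Rlt_le, phi_lt_1.
    - rewrite <- (proj1 (Hfib x Hx1)). apply rprod_lower. lra.
      intros a Ha. apply B1. split. apply (B2 x); auto. lra. apply (Hfib x Hx1). auto.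
    - apply rprod_bounds. intros a Ha. split. apply Cmod_ge_0.
      apply Rlt_le, phi_lt_1. apply (Hfib x Hx1). auto. }
  assert (L1 : forall x, (Cmod x < 1)%R -> (Cmod (Q x) <= 1)%R).
  { apply max_principle; auto. apply boundary_le_1_pow with n; auto. intros d Hd.
    destruct (Bd d Hd) as [rho [Hrho K]]. exists rho. split; auto. intros x Hx.
    destruct (K x Hx) as [K1 K2]. rewrite <- Key in K2 by lra.
    assert (P := pow_le (Cmod (Q x)) n (Cmod_ge_0 _)). nra. }
  assert (L2 : forall x, (Cmod x < 1)%R -> (Cmod (/ Q x) <= 1)%R).
  { apply max_principle.
    - intros x Hx. apply hol_inv; auto.
    - apply boundary_le_1_pow with n; auto. intros d Hd.
      destruct (Bd d Hd) as [rho [Hrho K]]. exists rho. split; auto. intros x Hx.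
      destruct (K x Hx) as [K1 K2]. rewrite <- Key in K2 by lra.
      assert (P0 : (0 < Cmod (Q x))%R) by now apply Cmod_gt_0.
      assert (P := pow_lt (Cmod (Q x)) n P0).
      rewrite Cmod_inv, pow_inv by auto.
      apply Rmult_le_reg_l with (Cmod (Q x) ^ n)%R; auto.
      rewrite <- Rmult_assoc, Rinv_r by lra. nra. }
  assert (Q1 : Cmod (Q 0) = 1%R).
  { assert (X := L1 0 disk_0). assert (Y := L2 0 disk_0). rewrite Cmod_inv in Y by auto.
    assert (P0 : (0 < Cmod (Q 0))%R) by now apply Cmod_gt_0.
    apply Rle_antisym; auto. apply Rmult_le_compat_l with (r := Cmod (Q 0)) in Y; [|lra].
    rewrite Rinv_r in Y by lra. lra. }
  assert (QC := strong_max_principle Q HQ L1 Q1).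
  intros Hz Hz' Ef.
  assert (EM : M z = M z') by (unfold M; now rewrite Ef).
  assert (Ee : cexp (L z) = cexp (L z')).
  { replace (cexp (L z)) with (Q z * cexp (L z) / Q z) by (field; auto).
    replace (cexp (L z')) with (Q z' * cexp (L z') / Q z') by (field; auto).
    now rewrite !EQ, EM, (QC z Hz), (QC z' Hz'). }
  now rewrite (E z Hz), (E z' Hz'), (EL z Hz), (EL z' Hz'), Ef, Ee.
Qed.

(** Being constant on fibres, [phi] is its own average over them, so it is a
    holomorphic function [J / n] of [f] near each value.  Dividing [J - J w1] by
    [w - w1] shows that [phi - phi z1] vanishes on the fibre through [z1] to at least
    the order of [f - f z1]. *)
Lemma phi_divisible z1 : (Cmod z1 < 1)%R -> exists k, hol_disk 1 k /\
  forall z, (Cmod z < 1)%R -> phi z - phi z1 = zprod (fib (f z1)) z * k z.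
Proof.
  intros Hz1. set (w1 := f z1).
  assert (Nn : RtoC (INR n) <> 0) by (apply RtoC_neq_0, not_0_INR; lia).
  destruct (fibre_sum_hol f n fib phi z1 Hf Hfib phi_hol Hz1) as [J [m [Hm [HJ EJ]]]].
  assert (EB : forall z, (Cmod z < 1)%R -> (Cmod (f z - w1) < m)%R -> RtoC (INR n) * phi z = J (f z)).
  { intros z Hz Hv. rewrite <- EJ by auto. rewrite (lsum_const phi (phi z)).
    - now rewrite (proj1 (Hfib z Hz)).
    - intros a Ha. apply fib_in in Ha; auto. apply phi_fibre; tauto. }
  assert (HJ1 : hol (fun w => J w - J w1) w1) by (apply hol_minus; auto; apply hol_const).
  destruct (hol_has_expansion _ _ HJ1) as [a Ha].
  destruct (expansion_factor _ _ _ 1 Ha) as [q [Hq [_ Nq]]].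
  { intros j Hj. assert (j = O) as -> by lia.
    apply has_expansion_csum in Ha. destruct Ha as [r [Hr Ha]]. specialize (Ha 0).
    rewrite Cmod_0 in Ha. specialize (Ha Hr). rewrite (clim_unique _ _ _ (csum_0 a) Ha).
    replace (w1 + 0) with w1 by ring. ring. }
  destruct (Hfib z1 Hz1) as [_ [_ [u1 [Hu1 [Nu1 E1]]]]]. fold w1 in E1.
  set (k := fun z => if Ceq_dec (f z) w1 then q w1 / RtoC (INR n) else (phi z - phi z1) / (f z - w1)).
  exists (fun z => u1 z * k z). split.
  - intros z Hz. apply (hol_mult u1 k); auto. assert (Cz := hol_cont _ _ (Hf z Hz)).
    destruct (Ceq_dec (f z) w1) as [Ez|Nz].
    + apply hol_ext_loc with (fun z => q (f z) / RtoC (INR n)).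
      * assert (Nq' : nearC z (fun x => J (f x) - J w1 = (f x - w1) ^ 1 * q (f x))).
        { apply (Cz (fun y => J y - J w1 = (y - w1) ^ 1 * q y)). rewrite Ez. exact Nq. }
        assert (Nv := near_value f z m Cz Hm). rewrite Ez in Nv.
        generalize (filter_and _ _ (filter_and _ _ Nv (near_unit_disk z Hz)) Nq').
        apply filter_imp. intros x [[H1 H2] H3]. unfold k.
        destruct (Ceq_dec (f x) w1) as [Ex|Nx]. now rewrite Ex.
        apply Cminus_neq_0 in Nx.
        assert (X1 := EB x H2 H1).
        assert (X2 : RtoC (INR n) * phi z1 = J w1).
        { apply EB; auto. fold w1. replace (w1 - w1) with (RtoC 0) by ring. now rewrite Cmod_0. }
        rewrite <- X1, <- X2 in H3.
        assert (Y : q (f x) = RtoC (INR n) * (phi x - phi z1) / (f x - w1)).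
        { replace (RtoC (INR n) * (phi x - phi z1)) with ((f x - w1) ^ 1 * q (f x)) by (rewrite <- H3; ring).
          simpl. field. auto. }
        rewrite Y. field. auto.
      * apply hol_div; auto. apply hol_comp; auto. now rewrite Ez. apply hol_const.
    + apply hol_ext_loc with (fun z => (phi z - phi z1) / (f z - w1)).
      * generalize (cont_neq f z w1 Cz Nz). apply filter_imp. intros x Hx. unfold k.
        destruct (Ceq_dec (f x) w1); congruence.
      * apply hol_div. apply hol_minus. now apply phi_hol. apply hol_const.
        apply hol_minus; auto. apply hol_const. now apply Cminus_neq_0.
  - intros z Hz. rewrite Cmult_assoc, <- (E1 z Hz). unfold k.
    destruct (Ceq_dec (f z) w1) as [Ez|Nz].
    + rewrite (phi_fibre z z1); auto. rewrite Ez. ring.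
    + field. now apply Cminus_neq_0.
Qed.

(** The quotient [g] of [bfac (phi z1) (phi z)] by the Blaschke product of the fibre
    through [z1] is at most [1] in modulus.  By the symmetry
    [|bfac a b| = |bfac b a|], its values at the zeros of [phi] multiply to modulus
    [1]; so it is a unimodular constant. *)
Theorem phi_level z1 : (Cmod z1 < 1)%R -> fibre phi n (phi z1) (fib (f z1)).
Proof.
  intros Hz1. set (s := fib (f z1)). set (c := phi z1).
  destruct (Hfib z1 Hz1) as [Ls [Ds _]]. fold s in Ls, Ds.
  split; auto. split; auto.
  destruct (Ceq_dec c 0) as [Ec|Nc].
  (* The level [0] is the definition of [phi]; the products below need [c <> 0]. *)
  - assert (Es : s = zeros).
    { unfold s, zeros. f_equal. apply phi_eq_0 in Ec; auto. apply fib_in in Ec; auto using disk_0. tauto. }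
    exists (fun z => / bden zeros z). split; [|split].
    + intros z Hz. apply hol_inv. apply hol_bden. apply bden_neq_0; auto. exact zeros_disk.
    + intros z Hz. apply Cinv_neq_0, bden_neq_0; auto. exact zeros_disk.
    + intros z Hz. rewrite Ec, Es. unfold phi. rewrite bprod_quot by (auto; exact zeros_disk).
      unfold Cdiv. ring.
  - destruct (phi_divisible z1 Hz1) as [k [Hk Ek]]. fold s c in Ek.
    assert (Hc : (Cmod c < 1)%R) by now apply phi_lt_1.
    assert (Nd : forall z, (Cmod z < 1)%R -> 1 - Cconj c * phi z <> 0).
    { intros z Hz. apply bfac_den_neq_0; auto. now apply phi_lt_1. }
    assert (Nb : forall z, (Cmod z < 1)%R -> bden s z <> 0) by (intros; apply bden_neq_0; auto).
    set (g := fun z => k z * bden s z / (1 - Cconj c * phi z)).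
    assert (Hg : hol_disk 1 g).
    { intros z Hz. apply hol_div; auto. apply hol_mult; auto. apply hol_bden.
      apply hol_minus. apply hol_const. apply hol_mult. apply hol_const. now apply phi_hol. }
    assert (Eg : forall z, (Cmod z < 1)%R -> bfac c (phi z) = bprod s z * g z).
    { intros z Hz. unfold bfac, g. rewrite (Ek z Hz), bprod_quot by auto. field. auto. }
    assert (Lg : forall z, (Cmod z < 1)%R -> (Cmod (g z) <= 1)%R).
    { apply max_principle; auto. apply boundary_le_1_pow with 1%nat; auto. intros d Hd.
      destruct (bprod_boundary s d Ds ltac:(lra)) as [rho [Hrho K]]. exists rho. split; auto.
      intros z Hz. specialize (K z Hz). assert (Hz' : (Cmod z < 1)%R) by lra.
      assert (X := bfac_lt_1 c (phi z) Hc (phi_lt_1 z Hz')). rewrite (Eg z Hz'), Cmod_mult in X.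
      assert (P := Cmod_ge_0 (g z)). simpl. rewrite !Rmult_1_r. nra. }
    assert (Pz : (rprod (fun a => Cmod (bprod s a)) zeros * rprod (fun a => Cmod (g a)) zeros
       = Cmod c ^ n)%R).
    { rewrite <- rprod_mult, <- zeros_length, <- rprod_const. apply rprod_ext.
      intros a Ha. assert (Da := zeros_disk a Ha). rewrite <- Cmod_mult, <- (Eg a Da).
      apply phi_eq_0 in Ha; auto. rewrite Ha. unfold bfac.
      replace ((0 - c) / (1 - Cconj c * 0)) with (- c) by field. apply Cmod_opp. }
    assert (Ps : rprod (fun a => Cmod (bprod s a)) zeros = (Cmod c ^ n)%R).
    { rewrite (rprod_ext _ (fun a => rprod (fun b => Cmod (bfac b a)) s)).
      2: { intros a _. apply Cmod_bprod. }
      rewrite rprod_swap, <- Ls, <- rprod_const. apply rprod_ext. intros b Hb.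
      rewrite (rprod_ext _ (fun a => Cmod (bfac a b))).
      2: { intros a Ha. apply bfac_sym; auto. now apply zeros_disk. }
      rewrite <- Cmod_bprod. fold (phi b). f_equal. apply phi_fibre; auto.
      apply fib_in in Hb; tauto. }
    assert (P0 : (0 < Cmod c ^ n)%R) by (apply pow_lt; now apply Cmod_gt_0).
    assert (G1 : rprod (fun a => Cmod (g a)) zeros = 1%R).
    { rewrite Ps in Pz. apply Rmult_eq_reg_l with (Cmod c ^ n)%R; lra. }
    assert (G0 : Cmod (g 0) = 1%R).
    { apply (rprod_eq_1 (fun a => Cmod (g a)) zeros); auto.
      - intros a Ha. split. apply Cmod_ge_0. now apply Lg, zeros_disk.
      - exact zeros_0. }
    assert (GC := strong_max_principle g Hg Lg G0).
    assert (N0 : g 0 <> 0) by (apply Cmod_gt_0; lra).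
    exists (fun z => g 0 * (1 - Cconj c * phi z) / bden s z). split; [|split].
    + intros z Hz. apply hol_div; auto using hol_bden. apply hol_mult. apply hol_const.
      apply hol_minus. apply hol_const. apply hol_mult. apply hol_const. now apply phi_hol.
    + intros z Hz. unfold Cdiv. apply Cmult_neq_0. apply Cmult_neq_0; auto. apply Cinv_neq_0; auto.
    + intros z Hz. rewrite <- (GC z Hz).
      assert (X := Eg z Hz). rewrite bprod_quot in X by auto.
      replace (phi z - c) with (bfac c (phi z) * (1 - Cconj c * phi z)) by (unfold bfac; field; auto).
      rewrite X. field. auto.
Qed.

Lemma phi_separates z z' : (Cmod z < 1)%R -> (Cmod z' < 1)%R -> phi z = phi z' -> f z = f z'.
Proof.
  intros Hz Hz' E. apply (fib_in z' z); auto. apply (fibre_In phi n (phi z')); auto. now apply phi_level.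
Qed.

(** If [c] were omitted, the inverse of [bfac c (phi z)] would be bounded by [1] by
    the maximum principle, but [|bfac c (phi 0)| < 1]. *)
Lemma phi_onto c : (Cmod c < 1)%R -> exists z, (Cmod z < 1)%R /\ phi z = c.
Proof.
  intros Hc. apply NNPP. intros H.
  assert (N : forall z, (Cmod z < 1)%R -> bfac c (phi z) <> 0).
  { intros z Hz. unfold bfac, Cdiv. apply Cmult_neq_0.
    apply Cminus_neq_0. intros E. apply H. now exists z.
    apply Cinv_neq_0, bfac_den_neq_0; auto. now apply phi_lt_1. }
  assert (L : forall z, (Cmod z < 1)%R -> (Cmod (/ bfac c (phi z)) <= 1)%R).
  { apply (max_principle (fun z => / bfac c (phi z))).
    - intros z Hz. apply hol_inv; auto. apply hol_div.
      apply hol_minus. now apply phi_hol. apply hol_const.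
      apply hol_minus. apply hol_const. apply hol_mult. apply hol_const. now apply phi_hol.
      apply bfac_den_neq_0; auto. now apply phi_lt_1.
    - apply boundary_le_1_pow with 1%nat; auto. intros d Hd.
      destruct (bfac_boundary c d Hc ltac:(lra)) as [r1 [Hr1 K1]].
      destruct (phi_boundary ((1 - r1) / 2) ltac:(lra)) as [r2 [Hr2 K2]].
      exists r2. split; auto. intros z Hz. assert (Hz' : (Cmod z < 1)%R) by lra.
      specialize (K2 z Hz). assert (X := phi_lt_1 z Hz'). specialize (K1 (phi z) ltac:(lra)).
      rewrite Cmod_inv by auto. assert (P : (0 < Cmod (bfac c (phi z)))%R) by now apply Cmod_gt_0, N.
      simpl. rewrite !Rmult_1_r. apply Rmult_le_reg_l with (Cmod (bfac c (phi z))); auto.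
      rewrite <- Rmult_assoc, Rinv_r by lra. lra. }
  specialize (L 0 disk_0). rewrite Cmod_inv in L by (apply N, disk_0).
  assert (X := bfac_lt_1 c (phi 0) Hc (phi_lt_1 0 disk_0)).
  assert (P : (0 < Cmod (bfac c (phi 0)))%R) by (apply Cmod_gt_0, N, disk_0).
  apply Rmult_le_compat_l with (r := Cmod (bfac c (phi 0))) in L; [|lra].
  rewrite Rinv_r in L by lra. lra.
Qed.

(** Any preimage under [phi] will do, by [phi_separates]. *)
Definition ftilde (c : C) : C :=
  f (epsilon (inhabits (RtoC 0)) (fun z => (Cmod z < 1)%R /\ phi z = c)).

Lemma ftilde_phi z : (Cmod z < 1)%R -> ftilde (phi z) = f z.
Proof.
  intros Hz. unfold ftilde.
  destruct (epsilon_spec (inhabits (RtoC 0)) (fun y => (Cmod y < 1)%R /\ phi y = phi z)) as [H1 H2].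
  { now exists z. }
  now apply phi_separates.
Qed.

(** Near [c], [ftilde] is [1 / n] times the sum of [f] over the fibres of [phi]. *)
Lemma ftilde_hol c : (Cmod c < 1)%R -> hol ftilde c.
Proof.
  intros Hc. assert (Nn : RtoC (INR n) <> 0) by (apply RtoC_neq_0, not_0_INR; lia).
  assert (C0 := Cmod_ge_0 c).
  destruct (phi_boundary ((1 - Cmod c) / 2) ltac:(lra)) as [rho [Hrho K]].
  set (r := ((1 + Rmax rho 0) / 2)%R).
  assert (X := Rmax_l rho 0). assert (Y := Rmax_r rho 0).
  assert (Z : (Rmax rho 0 < 1)%R) by (apply Rmax_lub_lt; lra).
  assert (Hr : (0 < r < 1)%R) by (unfold r; lra).
  set (m := ((1 - Cmod c) / 2)%R). assert (Hm : (0 < m)%R) by (unfold m; lra).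
  assert (Hb : forall z, Cmod z = r -> (m <= Cmod (phi z - c))%R).
  { intros z Hz. assert (K1 := K z ltac:(rewrite Hz; unfold r; lra)).
    assert (T := Cmod_triangle (phi z - c) c). replace (phi z - c + c) with (phi z) in T by ring.
    unfold m. lra. }
  assert (HJ := fibre_integral_hol phi f r c m phi_hol Hf Hr Hm Hb c).
  replace (c - c) with (RtoC 0) in HJ by ring. rewrite Cmod_0 in HJ. specialize (HJ Hm).
  apply hol_ext_loc with (fun w => / RtoC (INR n) *
    mean r (fun z => z * (f z * (deriv phi z / (phi z - w))))).
  - apply nearC_disk. exists m. split; auto. intros w Hw.
    assert (T := Cmod_triangle (w - c) c). replace (w - c + c) with w in T by ring.
    assert (Hw1 : (Cmod w < 1)%R) by (unfold m in Hw; lra).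
    destruct (phi_onto w Hw1) as [z [Hz Ez]]. assert (F := phi_level z Hz). rewrite Ez in F.
    rewrite (fibre_count phi n w (fib (f z)) f r phi_hol F Hf Hr).
    2: { intros y Hy E. specialize (Hb y Hy). rewrite E in Hb. lra. }
    rewrite inside_all.
    2: { intros a Ha. apply (fibre_In phi n w) in Ha; auto. destruct Ha as [Ha Ea].
         apply Rnot_le_lt. intros Hle. assert (K1 := K a ltac:(unfold r in Hle; lra)).
         rewrite Ea in K1. unfold m in Hw. lra. }
    rewrite (lsum_const f (f z)).
    2: { intros a Ha. apply fib_in in Ha; tauto. }
    rewrite (proj1 F), <- Ez, ftilde_phi by auto. field. auto.
  - apply hol_mult. apply hol_const. exact HJ.
Qed.

End n_to_one.

Theorem mainTheorem2 :
  forall (n : nat) (f : C -> C),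
    (0 < n)%nat ->
    analytic_on unit_disk f ->
    exactly_n_to_one n f ->
    exists phi ftilde : C -> C,
      finite_blaschke_product phi /\
      analytic_on unit_disk ftilde /\
      one_to_one_on unit_disk ftilde /\
      (forall z : C, unit_disk z -> f z = ftilde (phi z)).
Proof.
  intros n f Hn Ha He.
  assert (Hf : hol_disk 1 f).
  { intros z Hz. destruct (Ha z Hz) as [a Hza]. exact (has_expansion_hol f z a Hza). }
  destruct (exactly_n_to_one_fibre n f He) as [fib Hfib].
  exists (phi f fib), (ftilde f fib). split; [|split; [|split]].
  - exists 1, (zeros f fib). split; [apply Cmod_1|]. split; [|split].
    + now apply zeros_not_nil with n.
    + exact (zeros_disk f n fib Hfib).
    + intros z _. unfold phi, blaschke. symmetry. apply Cmult_1_l.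
  - intros c Hc. apply hol_has_expansion. now apply ftilde_hol with n.
  - intros c1 c2 H1 H2 E.
    destruct (phi_onto f n fib Hfib c1 H1) as [z1 [D1 E1]].
    destruct (phi_onto f n fib Hfib c2 H2) as [z2 [D2 E2]].
    rewrite <- E1, <- E2 in E |- *.
    rewrite !(ftilde_phi f n fib) in E by auto.
    apply (phi_fibre f n fib); auto.
  - intros z Hz. symmetry. now apply ftilde_phi with n.
Qed.
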